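(* Let $k\geq 1$ and let $\mathcal{F}$ be a $k$-recognisable class of graphs such that every graph in $\mathcal{F}$ has pathwidth at most $k-1$. Then the decision problem $\textsc{HomInd}(\mathcal{F})$ can be solved in deterministic polynomial time.
   Context: All graphs are finite, simple and undirected. $\hom(F,G)$ denotes the number of homomorphisms from $F$ to $G$. Two graphs $G,H$ are homomorphism indistinguishable over a class $\mathcal{F}$, written $G \equiv_{\mathcal{F}} H$, if $\hom(F,G)=\hom(F,H)$ for all $F\in\mathcal{F}$. For a fixed class $\mathcal{F}$, the problem $\textsc{HomInd}(\mathcal{F})$ takes as input two graphs $G,H$ and asks whether $G\equiv_{\mathcal{F}} H$. A distinctly $k$-labelled graph is a pair $(F,\boldsymbol{u})$ where $F$ is a graph and $\boldsymbol{u}\in V(F)^k$ has pairwise distinct entries; $\mathcal{D}(k)$ denotes the class of these. For $(F,\boldsymbol{u}),(F',\boldsymbol{u}')\in\mathcal{D}(k)$, the gluing $(F,\boldsymbol{u})\odot(F',\boldsymbol{u}')$ is obtained from the disjoint union of $F$ and $F'$ by merging $u_i$ with $u'_i$ for each $i\in[k]$ (the merged vertex carrying label $i$). $\operatorname{soe}(F,\boldsymbol{u}) := F$. For a class $\mathcal{F}$ of graphs, $\boldsymbol{F}_1\sim_{\mathcal{F}}\boldsymbol{F}_2$ (for $\boldsymbol{F}_1,\boldsymbol{F}_2\in\mathcal{D}(k)$) iff for all $\boldsymbol{K}\in\mathcal{D}(k)$: $\operatorname{soe}(\boldsymbol{K}\odot\boldsymbol{F}_1)\in\mathcal{F} \iff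 \operatorname{soe}(\boldsymbol{K}\odot\boldsymbol{F}_2)\in\mathcal{F}$. $\mathcal{F}$ is $k$-recognisable if $\sim_{\mathcal{F}}$ has finitely many equivalence classes. *)

(* Defs.v *)
From HB Require Import structures.
From mathcomp Require Import all_boot all_order all_algebra.
From mathcomp Require Import boolp.

Set Implicit Arguments.
Unset Strict Implicit.
Unset Printing Implicit Defensive.

Record sgraph := SGraph {
  vertex :> finType;
  edge : rel vertex;
  edge_sym : symmetric edge;
  edge_irr : irreflexive edge }.

Definition graph_iso (G H : sgraph) : Prop :=
  exists2 f : G -> H, bijective f & {mono f : x y / edge x y}.

(* A class of graphs is, as usual, a property of isomorphism types. *)
Record graph_class := GraphClass {
  in_class :> sgraph -> Prop;
  in_class_iso : forall G H : sgraph, graph_iso G H -> in_class G -> in_class H }.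

Definition is_hom (F G : sgraph) (f : {ffun F -> G}) : bool :=
  [forall x, forall y, edge x y ==> edge (f x) (f y)].

Definition hom (F G : sgraph) : nat := #|[set f : {ffun F -> G} | is_hom f]|.

Definition hom_indist (C : graph_class) (G H : sgraph) : Prop :=
  forall F : sgraph, C F -> hom F G = hom F H.

Definition is_path_decomp (G : sgraph) (s : seq {set G}) : Prop :=
  [/\ forall x : G, exists2 B, B \in s & x \in B,
      forall x y : G, edge x y -> exists2 B, B \in s & (x \in B) && (y \in B)
    & forall i j l : nat, i <= j <= l -> l < size s ->
        nth set0 s i :&: nth set0 s l \subset nth set0 s j].

(* Truncated predecessor: the null graph gets width 0 rather than -1. *)
Definition decomp_width (G : sgraph) (s : seq {set G}) : nat :=
  (\max_(B <- s) #|B|).-1.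

Lemma path_decomp_exists (G : sgraph) :
  exists w, `[< exists2 s : seq {set G}, is_path_decomp s & decomp_width s = w >].
Proof.
exists (decomp_width [:: [set: G]]); apply/asboolP; exists [:: [set: G]] => //.
split=> [x|x y _|]; first by exists setT; rewrite ?inE.
  by exists setT; rewrite ?inE.
move=> i j l /andP[_ le_jl]; rewrite ltnS leqn0 => /eqP l0.
by move: le_jl; rewrite l0 leqn0 => /eqP->; apply: subsetIr.
Qed.

Definition pathwidth (G : sgraph) : nat := ex_minn (path_decomp_exists G).

Record dlgraph (k : nat) := DLGraph {
  soe : sgraph;
  label : 'I_k -> soe;
  label_inj : injective label }.

Arguments label {k} d _.

(* The vertex set of the gluing is V(F1) together with the unlabelled vertices
   of F2; glue_inl and glue_inr are the maps induced by the merging, and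
   glue_inr sends the i-th labelled vertex of F2 to that of F1. *)
Definition glue_vertex (k : nat) (F1 F2 : dlgraph k) : finType :=
  (soe F1 + {y : soe F2 | y \notin codom (label F2)})%type.

Definition glue_inl (k : nat) (F1 F2 : dlgraph k) (x : soe F1) :
  glue_vertex F1 F2 := inl x.

Definition glue_inr (k : nat) (F1 F2 : dlgraph k) (y : soe F2) :
    glue_vertex F1 F2 :=
  match decP (@idP (y \in codom (label F2))) with
  | left y_lab => inl (label F1 (iinv y_lab))
  | right y_unl => inr (Sub y (introN idP y_unl))
  end.

Lemma glue_inr_label (k : nat) (F1 F2 : dlgraph k) (i : 'I_k) :
  glue_inr F1 (label F2 i) = glue_inl F2 (label F1 i).
Proof.
rewrite /glue_inr; case: (decP _) => [y_lab | []]; last exact: codom_f.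
by congr (inl (label F1 _)); apply: (@label_inj k F2); rewrite f_iinv.
Qed.

Lemma glue_inr_inj (k : nat) (F1 F2 : dlgraph k) :
  injective (@glue_inr k F1 F2).
Proof.
move=> y z; rewrite /glue_inr.
case: (decP _) => [y_lab|y_unl]; case: (decP _) => [z_lab|z_unl] //.
  by case=> /(@label_inj k F1) eq_i; rewrite -(f_iinv y_lab) eq_i f_iinv.
by case.
Qed.

Definition glue_edge (k : nat) (F1 F2 : dlgraph k) : rel (glue_vertex F1 F2) :=
  fun a b =>
    [exists x, exists y, [&& edge x y, glue_inl F2 x == a & glue_inl F2 y == b]]
    || [exists x, exists y,
          [&& edge x y, glue_inr F1 x == a & glue_inr F1 y == b]].

Lemma glue_edge_sym (k : nat) (F1 F2 : dlgraph k) :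
  symmetric (@glue_edge k F1 F2).
Proof.
suff sub a b : @glue_edge k F1 F2 a b -> @glue_edge k F1 F2 b a.
  by move=> a b; apply/idP/idP; apply: sub.
case/orP=> /existsP[x /existsP[y /and3P[e ea eb]]]; apply/orP; [left|right];
  by apply/existsP; exists y; apply/existsP; exists x; rewrite edge_sym e ea eb.
Qed.

Lemma glue_edge_irr (k : nat) (F1 F2 : dlgraph k) :
  irreflexive (@glue_edge k F1 F2).
Proof.
move=> a; apply/negP=> /orP[] /existsP[x /existsP[y /and3P[e /eqP<- /eqP eq_xy]]].
  by move: e; case: eq_xy => ->; rewrite edge_irr.
by move: e; rewrite (glue_inr_inj eq_xy) edge_irr.
Qed.

Definition glue_graph (k : nat) (F1 F2 : dlgraph k) : sgraph :=
  SGraph (@glue_edge_sym k F1 F2) (@glue_edge_irr k F1 F2).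

Definition glue_label (k : nat) (F1 F2 : dlgraph k) (i : 'I_k) :
  glue_graph F1 F2 := glue_inl F2 (label F1 i).

Lemma glue_label_inj (k : nat) (F1 F2 : dlgraph k) :
  injective (@glue_label k F1 F2).
Proof. by move=> i j [] /(@label_inj k F1). Qed.

Definition glue (k : nat) (F1 F2 : dlgraph k) : dlgraph k :=
  DLGraph (@glue_label_inj k F1 F2).

Definition class_equiv (C : graph_class) (k : nat) (F1 F2 : dlgraph k) : Prop :=
  forall K : dlgraph k, C (soe (glue K F1)) <-> C (soe (glue K F2)).

Definition recognisable (k : nat) (C : graph_class) : Prop :=
  exists (n : nat) (r : 'I_n -> dlgraph k),
    forall F : dlgraph k, exists i : 'I_n, class_equiv C F (r i).

Variant move := MoveL | MoveN | MoveR.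

(* A deterministic Turing machine over the input alphabet bool, with
   tm_tapes.+1 two-way infinite tapes. A cell holds None (blank), Some (inl b)
   (input symbol) or Some (inr a) (work symbol). *)
Definition cell (work : finType) : finType := option (bool + work)%type.

Record TM := MkTM {
  tm_state : finType;
  tm_work : finType;
  tm_tapes : nat;
  tm_start : tm_state;
  tm_halt : pred tm_state;
  tm_accept : pred tm_state;
  tm_delta : tm_state -> {ffun 'I_tm_tapes.+1 -> cell tm_work} ->
             tm_state * ('I_tm_tapes.+1 -> cell tm_work * move) }.

(* The cells to the left of the head (nearest first), the scanned cell, and the
   cells to its right (nearest first); all the other cells are blank. *)
Record tape (work : finType) := Tape {
  tape_left : seq (cell work);
  tape_head : cell work;
  tape_right : seq (cell work) }.

Definition tape_of_word (work : finType) (w : seq bool) : tape work :=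
  if w is b :: w' then
    Tape [::] (Some (inl b)) [seq Some (inl c) | c <- w']
  else Tape [::] None [::].

Definition write_move (work : finType) (t : tape work) (a : cell work * move) :
    tape work :=
  let: Tape l _ r := t in
  let: (c, d) := a in
  match d with
  | MoveL => Tape (behead l) (head None l) (c :: r)
  | MoveN => Tape l c r
  | MoveR => Tape (c :: l) (head None r) (behead r)
  end.

Record config (M : TM) := Config {
  cfg_state : tm_state M;
  cfg_tapes : 'I_(tm_tapes M).+1 -> tape (tm_work M) }.

Definition init_config (M : TM) (w : seq bool) : config M :=
  Config (tm_start M)
    (fun i => tape_of_word (tm_work M) (if i == ord0 then w else [::])).

Definition step (M : TM) (c : config M) : config M :=
  if tm_halt (cfg_state c) then c else
  let: (q, act) :=
    tm_delta (cfg_state c) [ffun i => tape_head (cfg_tapes c i)] in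
  Config q (fun i => write_move (cfg_tapes c i) (act i)).

(* Halting configurations are fixed by step, so that the configuration after
   T (size w) iterations is halting iff M halts within T (size w) steps. *)
Definition decides_in_time (M : TM) (L : seq bool -> Prop) (T : nat -> nat) :
    Prop :=
  forall w : seq bool,
    let q := cfg_state (iter (T (size w)) (@step M) (init_config M w)) in
    tm_halt q /\ (tm_accept q <-> L w).

Definition polynomial_time (L : seq bool -> Prop) : Prop :=
  exists (M : TM) (p : {poly nat}), decides_in_time M L (fun n => p.[n]%R).

(* The number of vertices in unary, a 0, then the adjacency matrix row by row. *)
Definition encode_graph (G : sgraph) : seq bool :=
  nseq #|G| true ++ false :: [seq edge x y | x <- enum G, y <- enum G].

Definition HomInd (C : graph_class) (w : seq bool) : Prop :=
  exists G H : sgraph,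
    w = encode_graph G ++ encode_graph H /\ hom_indist C G H.

(* Main.v *)
(** The proof rests on a counting trick that replaces Gaussian elimination.
    A graph of pathwidth less than k with at least k vertices is built from k
    isolated labelled vertices by a word over the finite alphabet "join two
    labelled vertices" / "move a label to a new isolated vertex", and these
    operations respect the equivalence of the class, so that the words whose
    graph lies in the class form a regular language.  Homomorphism counts are
    computed along a word by 0/1 matrices indexed by labellings.  Hence, for the
    accepted words w of length t, the sum of (hom(F_w,G) - hom(F_w,H))^2 is a
    signed sum of entries of T^t x, where T is a matrix with small natural
    entries whose dimension C is polynomial.  By Cayley-Hamilton all these sums
    vanish as soon as they vanish for t < C, which is an equality between two
    natural numbers of polynomially many bits.  The bits of the vectors T^t x
    are tabulated by column addition, where the carries stay polynomial.  Graphs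
    with fewer than k vertices are finitely many and are checked directly.

    On the machine side, a tape with a marker at position 0 is used as a
    register whose value is the position of its head, and as a memory whose
    content is the rest of the tape. *)
From HB Require Import structures.
From mathcomp Require Import all_boot all_order all_algebra.
From mathcomp Require Import boolp zify ring.
Require Import Defs.

Set Implicit Arguments.
Unset Strict Implicit.
Unset Printing Implicit Defensive.

(** * While programs on registers and their compilation to Turing machines *)

(** Squares make one linear test sufficient: the differences hom(F_w,G) - hom(F_w,H) could cancel in
    a sum over the accepted words, but their squares cannot, and it is harmless that many words
    describe the same graph. A square is a product of two counts. Hence a matrix index consists of a
    state, two graph indices and two labellings, five digits with polynomially many values each
    because k is fixed. After expanding the squares and moving the mixed terms to the other side,
    only natural numbers are compared.

    The machine model shapes the rest. A register is unary, so a value costs time proportional to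
    itself, and registers may only hold polynomially bounded values. The entries of T^t x can be
    exponential in t; they exist only as bits in the table, with one row for each t, computed from
    the preceding row. *)

Definition upd (A : Type) (f : nat -> A) (r : nat) (v : A) : nat -> A :=
  fun x => if x == r then v else f x.

Record store := Store { pos : nat -> nat; mem : nat -> nat -> option bool }.

Definition marker : cell unit := Some (inr tt).

Definition cell_at (s : store) (r p : nat) : cell unit :=
  if p is p'.+1 then omap inl (mem s r p') else marker.

Definition scanned (s : store) (r : nat) : cell unit := cell_at s r (pos s r).

Definition set_pos (s : store) (r v : nat) : store :=
  Store (upd (pos s) r v) (mem s).

Definition put (s : store) (r : nat) (c : option bool) : store :=
  if pos s r is p.+1 then Store (pos s) (upd (mem s) r (upd (mem s r) p c))
  else s.

Inductive prog :=
| Inc of nat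
| Dec of nat
| Put of nat & option bool
| Seq of prog & prog
| If of nat & pred (cell unit) & prog & prog
| While of nat & pred (cell unit) & prog.

(** The last argument is the exact number of steps of the compiled code: a test costs one step, and
    the true branch of [If] and every round of [While] end with one more step for a jump. *)
Inductive exec : prog -> store -> store -> nat -> Prop :=
| ExecInc r s : exec (Inc r) s (set_pos s r (pos s r).+1) 1
| ExecDec r s : exec (Dec r) s (set_pos s r (pos s r).-1) 1
| ExecPut r c s : exec (Put r c) s (put s r c) 1
| ExecSeq P Q s s1 s2 t1 t2 :
    exec P s s1 t1 -> exec Q s1 s2 t2 -> exec (Seq P Q) s s2 (t1 + t2)
| ExecIfT r (b : pred (cell unit)) P Q s s' t :
    b (scanned s r) -> exec P s s' t -> exec (If r b P Q) s s' t.+2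
| ExecIfF r (b : pred (cell unit)) P Q s s' t :
    ~~ b (scanned s r) -> exec Q s s' t -> exec (If r b P Q) s s' t.+1
| ExecWhileF r (b : pred (cell unit)) P s : ~~ b (scanned s r) -> exec (While r b P) s s 1
| ExecWhileT r (b : pred (cell unit)) P s s1 s2 t1 t2 :
    b (scanned s r) -> exec P s s1 t1 -> exec (While r b P) s1 s2 t2 ->
    exec (While r b P) s s2 (t1 + t2).+2.

Fixpoint max_reg (P : prog) : nat :=
  match P with
  | Inc r | Dec r | Put r _ => r
  | Seq P Q => maxn (max_reg P) (max_reg Q)
  | If r _ P Q => maxn r (maxn (max_reg P) (max_reg Q))
  | While r _ P => maxn r (max_reg P)
  end.

Fixpoint code_len (P : prog) : nat :=
  match P with
  | Inc _ | Dec _ | Put _ _ => 1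
  | Seq P Q => code_len P + code_len Q
  | If _ _ P Q => (code_len P + code_len Q).+2
  | While _ _ P => (code_len P).+2
  end.

(** Only the cells from position 0 on are described. [Dec] never moves left of the marker, so the
    cells beyond it are irrelevant, and reading both lists with default [None] makes trailing blanks
    invisible. *)
Definition tape_rel (p : nat) (c : nat -> cell unit) (t : tape unit) : Prop :=
  [/\ tape_head t = c p,
      forall j, j < p -> nth None (tape_left t) j = c (p - j.+1)
    & forall j, nth None (tape_right t) j = c (p + j.+1)].

Lemma nth_consE (A : Type) (x0 x : A) l j :
  nth x0 (x :: l) j = if j is j'.+1 then nth x0 l j' else x.
Proof. by case: j. Qed.

Section TapeRel.
Variables (p : nat) (c c' : nat -> cell unit) (t : tape unit) (a : cell unit).
Hypothesis tc : tape_rel p c t.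
Hypothesis c'E : forall q, c' q = if q == p then a else c q.

Lemma tape_relN : tape_rel p c' (write_move t (a, MoveN)).
Proof.
case: t tc => l h r [/= _ hl hr]; split=> [|j jp|j] /=.
- by rewrite c'E eqxx.
- by rewrite hl // c'E ifF //; lia.
- by rewrite hr // c'E ifF //; lia.
Qed.

Lemma tape_relR : tape_rel p.+1 c' (write_move t (a, MoveR)).
Proof.
case: t tc => l h r [/= _ hl hr]; split=> [|j jp|j] /=.
- by rewrite -nth0 hr c'E ifF ?addn1 //; lia.
- rewrite nth_consE; case: j jp => [|j] jp; first by rewrite subn1 c'E eqxx.
  by rewrite subSS hl ?c'E ?ifF //; lia.
- by rewrite nth_behead hr c'E ifF ?addSnnS //; lia.
Qed.

Lemma tape_relL : 0 < p -> tape_rel p.-1 c' (write_move t (a, MoveL)).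
Proof.
case: t tc => l h r [/= _ hl hr] p0; split=> [|j jp|j] /=.
- by rewrite -nth0 hl // c'E ifF ?subn1 //; lia.
- rewrite nth_behead hl; last lia.
  by rewrite c'E ifF; [congr c; lia | lia].
- rewrite nth_consE; case: j => [|j]; first by rewrite c'E ifT //; lia.
  by rewrite hr c'E ifF; [congr c; lia | lia].
Qed.

End TapeRel.

(** * Compilation and its correctness *)

Section Compile.
Variable T : nat.

Definition scan := {ffun 'I_T.+1 -> cell unit}.
Definition instr := scan -> nat * ('I_T.+1 -> cell unit * move).

Definition act_at (r : nat) (a : cell unit -> cell unit * move) (h : scan) :
    'I_T.+1 -> cell unit * move :=
  fun i => if i == r :> nat then a (h i) else (h i, MoveN).

Definition keep (h : scan) : 'I_T.+1 -> cell unit * move :=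
  fun i => (h i, MoveN).

Definition goto (n : nat) : instr := fun h => (n, keep h).

Definition branch (r : nat) (b : pred (cell unit)) (n1 n2 : nat) : instr :=
  fun h => (if b (h (inord r)) then n1 else n2, keep h).

Fixpoint compile (P : prog) (a : nat) : seq instr :=
  match P with
  | Inc r => [:: fun h => (a.+1, act_at r (fun x => (x, MoveR)) h)]
  | Dec r => [:: fun h => (a.+1,
      act_at r (fun x => (x, if x == marker then MoveN else MoveL)) h)]
  | Put r c => [:: fun h => (a.+1,
      act_at r (fun x => (if x == marker then x else omap inl c, MoveN)) h)]
  | Seq P Q => compile P a ++ compile Q (a + code_len P)
  | If r b P Q =>
      branch r b a.+1 (a + code_len P).+2 :: compile P a.+1 ++
      goto (a + code_len P + code_len Q).+2 :: compile Q (a + code_len P).+2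
  | While r b P =>
      branch r b a.+1 (a + code_len P).+2 :: compile P a.+1 ++ [:: goto a]
  end.

Lemma size_compile P a : size (compile P a) = code_len P.
Proof.
by elim: P a => //= [P IP Q IQ|r b P IP Q IQ|r b P IP] a;
  rewrite size_cat /= ?IP ?IQ //; lia.
Qed.

Definition store_rel (s : store) (tp : 'I_T.+1 -> tape unit) : Prop :=
  forall i : 'I_T.+1, tape_rel (pos s i) (cell_at s i) (tp i).

Lemma store_rel_scanned s tp r : r <= T -> store_rel s tp ->
  [ffun i => tape_head (tp i)] (inord r) = scanned s r.
Proof.
move=> rT rl; rewrite ffunE; have [-> _ _] := rl (inord r).
by rewrite inordK // ltnS.
Qed.

Lemma store_rel_keep s tp : store_rel s tp ->
  store_rel s (fun i => write_move (tp i) (keep [ffun i => tape_head (tp i)] i)).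
Proof.
move=> rl i; rewrite /keep ffunE; apply: tape_relN (rl i) _ => q.
by case: eqP => // ->; case: (rl i).
Qed.

Lemma store_rel_act s s' tp r f :
  store_rel s tp ->
  (forall i : nat, i != r -> pos s' i = pos s i /\ cell_at s' i =1 cell_at s i) ->
  (forall i : 'I_T.+1, i = r :> nat ->
     tape_rel (pos s' i) (cell_at s' i) (write_move (tp i) (f (scanned s i)))) ->
  store_rel s' (fun i => write_move (tp i)
                  (act_at r f [ffun i => tape_head (tp i)] i)).
Proof.
move=> rl other at_r i; rewrite /act_at ffunE.
have [hd _ _] := rl i.
case: eqP => ir; first by rewrite hd; apply: at_r.
have [-> ce] := other i (introN eqP ir); apply: tape_relN (rl i) _ => q.
by rewrite ce; case: eqP => // ->.
Qed.

Variable code : seq instr.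

(** The states are the addresses of the code and the two addresses after it, which halt; the last
    one accepts. *)
Definition prog_machine : TM :=
  @MkTM 'I_(size code).+2 unit T ord0
    (fun q => size code <= q) (fun q => q == (size code).+1 :> nat)
    (fun q h => let: (n, act) := nth (goto 0) code q h in (inord n, act)).

Definition at_pc (a : nat) (tp : 'I_T.+1 -> tape unit) : config prog_machine :=
  @Config prog_machine (inord a) tp.

Lemma halt_at_pc a tp : a < (size code).+2 ->
  tm_halt (cfg_state (at_pc a tp)) = (size code <= a).
Proof. by move=> lt_a; rewrite /= inordK. Qed.

Lemma accept_at_pc a tp : a < (size code).+2 ->
  tm_accept (cfg_state (at_pc a tp)) = (a == (size code).+1).
Proof. by move=> lt_a; rewrite /= inordK. Qed.

Definition embedded (c : seq instr) (a : nat) : Prop :=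
  a + size c <= size code /\
  forall j, j < size c -> nth (goto 0) code (a + j) = nth (goto 0) c j.

Lemma embedded_cat c1 c2 a :
  embedded (c1 ++ c2) a -> embedded c1 a /\ embedded c2 (a + size c1).
Proof.
rewrite /embedded size_cat => -[le nthE]; split; split=> [|j jl]; try lia.
  by rewrite nthE ?nth_cat ?jl //; lia.
by rewrite -addnA nthE ?nth_cat; [rewrite ifF ?addKn //; lia | lia].
Qed.

Lemma embedded_cons x c a :
  embedded (x :: c) a -> nth (goto 0) code a = x /\ embedded c a.+1.
Proof.
rewrite -cat1s => /embedded_cat[[_ /(_ 0 isT)]].
by rewrite addn0 addn1.
Qed.

Lemma step_at a tp : a < size code ->
  step (at_pc a tp) =
  let: (n, act) := nth (goto 0) code a [ffun i => tape_head (tp i)] in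
  at_pc n (fun i => write_move (tp i) (act i)).
Proof.
move=> ac; rewrite /step /= inordK; last lia.
by rewrite leqNgt ac /=; case: (nth _ _ _ _).
Qed.

Lemma embedded_lt x c a : embedded (x :: c) a -> a < size code.
Proof. by case=> /= le _; lia. Qed.

(** The address [a] is arbitrary because the code of a subprogram sits inside that of the whole
    program. For [While], the remaining rounds are an execution of the same loop at the same
    address. *)
Lemma exec_step P s s' t : exec P s s' t -> max_reg P <= T ->
  forall a tp, embedded (compile P a) a -> store_rel s tp ->
  exists2 tp', iter t (@step prog_machine) (at_pc a tp)
               = at_pc (a + code_len P) tp' & store_rel s' tp'.
Proof.
elim=> {P s s' t}.
- move=> r s rT a tp emb rl /=.
  have al := embedded_lt emb; have [nth_a _] := embedded_cons emb.
  rewrite step_at // nth_a addn1; eexists; first by [].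
  apply: store_rel_act => // [i ne|i ir].
    by rewrite /= /upd (negPf ne).
  rewrite /= /upd ir eqxx -ir; apply: tape_relR (rl i) _ => q.
  by rewrite /scanned; case: eqP => // ->.
- move=> r s rT a tp emb rl /=.
  have al := embedded_lt emb; have [nth_a _] := embedded_cons emb.
  rewrite step_at // nth_a addn1; eexists; first by [].
  apply: store_rel_act => // [i ne|i ir].
    by rewrite /= /upd (negPf ne).
  rewrite /= /upd ir eqxx -ir.
  have same q : cell_at s i q = if q == pos s i then scanned s i else cell_at s i q.
    by rewrite /scanned; case: eqP => // ->.
  case pE: (pos s i) => [|p].
    rewrite {2}/scanned pE /=; move: (tape_relN (rl i) same).
    by rewrite pE; apply.
  rewrite {2}/scanned pE ifF; last by rewrite /=; case: (mem s i p).
  have p0 : 0 < pos s i by rewrite pE.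
  by have := tape_relL (rl i) same p0; rewrite pE.
- move=> r c s rT a tp emb rl /=.
  have al := embedded_lt emb; have [nth_a _] := embedded_cons emb.
  rewrite step_at // nth_a addn1; eexists; first by [].
  apply: store_rel_act => // [i ne|i ir].
    rewrite /put; case: (pos s r) => [|p] //=; split=> // q.
    by rewrite /cell_at /= /upd (negPf ne).
  have -> : pos (put s r c) i = pos s i by rewrite /put; case: (pos s r).
  apply: tape_relN (rl i) _ => q; rewrite -ir /put.
  case pE: (pos s i) => [|p].
    rewrite /scanned pE eqxx; case: eqP => // -> //.
  have -> : (scanned s i == marker) = false.
    by rewrite /scanned pE /=; case: (mem s i p).
  case: q => [|q] //=; rewrite /upd eqxx eqSS.
  by case: eqP.
- move=> P Q s s1 s2 t1 t2 _ IP _ IQ /=; rewrite geq_max => /andP[PT QT] a tp.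
  move=> /embedded_cat[eP]; rewrite size_compile => eQ rl.
  have [tp1 E1 rl1] := IP PT _ _ eP rl.
  have [tp2 E2 rl2] := IQ QT _ _ eQ rl1.
  by exists tp2; rewrite // addnC iterD E1 E2 addnA.
- move=> r b P Q s s' t br _ IP /=; rewrite !geq_max => /and3P[rT PT QT] a tp emb rl.
  have al := embedded_lt emb; have [nth_a] := embedded_cons emb.
  move=> /embedded_cat[eP]; rewrite size_compile => emb2.
  have al2 := embedded_lt emb2; have [nth_2 _] := embedded_cons emb2.
  have [tp1 E1 rl1] := IP PT _ _ eP (store_rel_keep rl).
  rewrite -iterS iterSr step_at // nth_a /= ffunE.
  have := store_rel_scanned rT rl; rewrite ffunE => ->; rewrite br E1.
  rewrite step_at // nth_2 /=; eexists; last exact: store_rel_keep rl1.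
  by congr at_pc; lia.
- move=> r b P Q s s' t br _ IQ /=; rewrite !geq_max => /and3P[rT PT QT] a tp emb rl.
  have al := embedded_lt emb; have [nth_a] := embedded_cons emb.
  move=> /embedded_cat[eP]; rewrite size_compile => /embedded_cons[_ emb2].
  rewrite addSn in emb2.
  have [tp1 E1 rl1] := IQ QT _ _ emb2 (store_rel_keep rl).
  rewrite -iterS iterSr step_at // nth_a /= ffunE.
  have := store_rel_scanned rT rl; rewrite ffunE => ->; rewrite (negPf br) E1.
  exists tp1 => //; by congr at_pc; lia.
- move=> r b P s br /=; rewrite !geq_max => /andP[rT PT] a tp emb rl.
  have al := embedded_lt emb; have [nth_a _] := embedded_cons emb.
  rewrite step_at // nth_a /= ffunE.
  have := store_rel_scanned rT rl; rewrite ffunE => ->; rewrite (negPf br).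
  eexists; last exact: store_rel_keep rl.
  by congr at_pc; lia.
- move=> r b P s s1 s2 t1 t2 br _ IP _ IW /=; rewrite !geq_max => /andP[rT PT] a tp emb rl.
  have al := embedded_lt emb; have [nth_a] := embedded_cons emb.
  move=> /embedded_cat[eP]; rewrite size_compile => emb2.
  have al2 := embedded_lt emb2; have [nth_2 _] := embedded_cons emb2.
  have [tp1 E1 rl1] := IP PT _ _ eP (store_rel_keep rl).
  have [|tp2 E2 rl2] := IW _ _ _ emb (store_rel_keep rl1).
    by rewrite /= geq_max rT.
  exists tp2 => //.
  rewrite -2!iterS.
  have -> : (t1 + t2).+2 = t2 + (t1.+2) by lia.
  rewrite iterD [iter t1.+2 _ _]iterS iterSr.
  rewrite step_at // nth_a /= ffunE.
  have := store_rel_scanned rT rl; rewrite ffunE => ->; rewrite br E1.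
  by rewrite step_at // nth_2 /= E2.
Qed.

End Compile.

Definition init_store (w : seq bool) : store :=
  Store (fun=> 0) (fun r p => if r == 0 then onth w p else None).

(* The two leading instructions put the marker on the cell to the left of the
   initial head position, which becomes position 0 of every tape. *)
Definition whole_code (T : nat) (P : prog) (r : nat) : seq (instr T) :=
  [:: (fun h => (1, fun i => (h i, MoveL))) : instr T;
      (fun h => (2, fun i => (marker, MoveN))) : instr T] ++ compile T P 2 ++
  [:: branch r (pred1 marker) (code_len P).+3 (code_len P).+4].

Lemma iter_step_halt (M : TM) (c : config M) n :
  tm_halt (cfg_state c) -> iter n (@step M) c = c.
Proof. by move=> hc; elim: n => //= n ->; rewrite /step hc. Qed.

Lemma natr_expn (n d : nat) : (n ^+ d)%R = n ^ d.
Proof. by elim: d => // d IH; rewrite GRing.exprS IH expnS. Qed.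

(** The base is at least 2, so that a large exponent absorbs every constant. The summand 3 counts
    the two set-up instructions and the final test. *)
Definition time_poly (d : nat) : {poly nat} := (('X + 2%:P) ^+ d + 3%:P)%R.

Lemma horner_time_poly d n : (time_poly d).[n]%R = (n + 2) ^ d + 3.
Proof.
by rewrite /time_poly hornerD horner_exp hornerD hornerX !hornerC natr_expn.
Qed.

Lemma prog_polynomial_time (P : prog) (r d : nat) (L : seq bool -> Prop) :
  (forall w, exists s' t, [/\ exec P (init_store w) s' t,
     t <= (size w + 2) ^ d & pos s' r <> 0 <-> L w]) ->
  polynomial_time L.
Proof.
move=> correct; pose T := maxn r (max_reg P); pose code := whole_code T P r.
have szc : size code = (code_len P).+3.
  by rewrite /code /whole_code /= size_cat size_compile /=; lia.
exists (prog_machine code), (time_poly d) => w; rewrite horner_time_poly.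
have [s' [t [ex td Lw]]] := correct w.
have le_tn : 3 + t <= (size w + 2) ^ d + 3 by rewrite addnC leq_add2r.
move: (_ + 3) le_tn => n le_tn.
have rT : r <= T by rewrite leq_max leqnn.
have PT : max_reg P <= T by rewrite leq_max leqnn orbT.
pose tp0 : 'I_T.+1 -> tape unit :=
  fun i => tape_of_word unit (if i == ord0 then w else [::]).
pose tp1 : 'I_T.+1 -> tape unit := fun i =>
  write_move (write_move (tp0 i) (tape_head (tp0 i), MoveL)) (marker, MoveN).
have rl1 : store_rel (init_store w) tp1.
  move=> i; rewrite /tp1 /tp0; case: eqP => [->|/eqP ne].
    case: w {correct ex td Lw le_tn tp0 tp1} => [|b w].
      by split=> // -[|j]; rewrite /= ?nth_nil.
    split=> // -[|j] //=; rewrite onthE.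
    by elim: w j => [|a w IH] [|j] //=.
  have ne0 : (i == 0 :> nat) = false by apply/negbTE.
  split=> // j; rewrite /cell_at /= ne0 nth_consE.
  by case: j => //= j; rewrite nth_nil.
have /= emb : embedded code code 0 by split.
have {emb} [n0 emb] := embedded_cons emb.
have {emb} [n1 /embedded_cat[embP]] := embedded_cons emb.
rewrite size_compile => embB; have [nB _] := embedded_cons embB.
have [tp2 E2 rl2] := exec_step ex PT embP rl1.
have E : iter (3 + t) (@step (prog_machine code)) (init_config (prog_machine code) w)
  = at_pc code (if pos s' r == 0 then (code_len P).+3 else (code_len P).+4)
      (fun i => write_move (tp2 i) (keep [ffun i => tape_head (tp2 i)] i)).
  rewrite addnC addnS iterS addn2 2!iterSr.
  have -> : init_config (prog_machine code) w = at_pc code 0 tp0.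
    by rewrite /init_config /at_pc; congr Config; apply/val_inj; rewrite /= inordK.
  rewrite step_at ?szc // n0 step_at ?szc // n1.
  have -> : at_pc code 2 (fun i => write_move
      (write_move (tp0 i) ([ffun i => tape_head (tp0 i)] i, MoveL)) (marker, MoveN))
      = at_pc code 2 tp1.
    by congr at_pc; apply: funext => i; rewrite ffunE.
  rewrite E2 step_at ?szc ?nB; last lia.
  rewrite /branch (store_rel_scanned rT rl2) /scanned /cell_at.
  by case: (pos s' r) => //= p; case: (mem s' r p).
have lt_pc (b : bool) : (if b then (code_len P).+3 else (code_len P).+4)
    < (size code).+2 by rewrite szc; case: b.
have hq : tm_halt (cfg_state (iter (3 + t) (@step (prog_machine code))
            (init_config (prog_machine code) w))).
  by rewrite E halt_at_pc ?lt_pc // szc; case: ifP.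
have ha : tm_accept (cfg_state (iter (3 + t) (@step (prog_machine code))
            (init_config (prog_machine code) w))) <-> L w.
  rewrite -Lw E accept_at_pc ?lt_pc // szc.
  by case: (pos s' r) => [|p] /=; split=> //; move/eqP; lia.
(* The steps left until the time bound do not change a halting configuration. *)
by rewrite -(subnK le_tn) iterD iter_step_halt //; apply: (conj hq ha).
Qed.

(** * Polynomial-time functions of a word, a table and a list of numbers *)

Definition runs (P : prog) (s s' : store) (T : nat) : Prop :=
  exists2 t, exec P s s' t & t <= T.

Lemma runs_le P s s' T T' : T <= T' -> runs P s s' T -> runs P s s' T'.
Proof. by move=> le_T [t ex le_t]; exists t => //; apply: leq_trans le_T. Qed.

Lemma runs_seq P Q s s1 s2 T1 T2 :
  runs P s s1 T1 -> runs Q s1 s2 T2 -> runs (Seq P Q) s s2 (T1 + T2).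
Proof.
move=> [t1 e1 l1] [t2 e2 l2]; exists (t1 + t2); last exact: leq_add.
exact: ExecSeq e1 e2.
Qed.

Lemma runs_while r (b : pred (cell unit)) P (s : nat -> store) n T :
  (forall k, k < n -> b (scanned (s k) r)) -> ~~ b (scanned (s n) r) ->
  (forall k, k < n -> runs P (s k) (s k.+1) T) ->
  runs (While r b P) (s 0) (s n) (n * T.+2 + 1).
Proof.
elim: n s => [|n IH] s bT bF body; first by exists 1 => //; apply: ExecWhileF.
have [t2 e2 l2] : runs (While r b P) (s 1) (s n.+1) (n * T.+2 + 1).
  by apply: (IH (s \o succn)) => [k kn||k kn] //=; [apply: bT|apply: body].
have [t1 e1 l1] := body 0 isT.
exists (t1 + t2).+2; last by rewrite mulSn; lia.
by apply: ExecWhileT e1 e2; apply: bT.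
Qed.

(* The word is the content of tape 0 and the table that of tape 1. *)
Definition input := (seq bool * (nat -> bool))%type.

(** A false bit of the table is a blank, so the initially blank tape is the all-false table and only
    true bits are ever written. *)
Definition bank (o : input) (r p : nat) : option bool :=
  match r with
  | 0 => onth o.1 p
  | 1 => if o.2 p then Some true else None
  | _ => None
  end.

Definition st (o : input) (p : nat -> nat) : store := Store p (bank o).

Definition nonzero : pred (cell unit) := predC1 marker.

Lemma nonzero_st o p r : nonzero (scanned (st o p) r) = (p r != 0).
Proof.
by rewrite /nonzero /scanned /cell_at /=; case: (p r) => //= q; case: (bank _ _ _).
Qed.

Lemma upd_same (A : Type) (f : nat -> A) r v : upd f r v r = v.
Proof. by rewrite /upd eqxx. Qed.

Lemma upd_other (A : Type) (f : nat -> A) r v x : x != r -> upd f r v x = f x.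
Proof. by rewrite /upd => /negPf->. Qed.

Ltac upd_eq :=
  try congr st; apply: funext => ?; rewrite /upd; repeat case: eqP => ?;
  subst; try done; try congruence; try lia.

Lemma runs_inc o p r : runs (Inc r) (st o p) (st o (upd p r (p r).+1)) 1.
Proof. by exists 1 => //; apply: ExecInc. Qed.

Lemma runs_dec o p r : runs (Dec r) (st o p) (st o (upd p r (p r).-1)) 1.
Proof. by exists 1 => //; apply: ExecDec. Qed.

(** [Dec] on a register at 0 serves as the missing skip instruction. *)
Lemma runs_skip o p r : p r = 0 -> runs (Dec r) (st o p) (st o p) 1.
Proof.
move=> pr; have := runs_dec o p r.
by congr runs; upd_eq; rewrite pr.
Qed.

(** The invariant [q] is indexed by the number of rounds left, which is the value of the loop
    register itself. *)
Lemma runs_count_down r P o (q : nat -> nat -> nat) n T :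
  (forall k, q k r = k) ->
  (forall k, k < n -> runs P (st o (q k.+1)) (st o (q k)) T) ->
  runs (While r nonzero P) (st o (q n)) (st o (q 0)) (n * T.+2 + 1).
Proof.
move=> qr body; have := @runs_while r nonzero P (fun k => st o (q (n - k))) n T.
rewrite subn0 subnn; apply=> [k kn||k kn]; rewrite ?nonzero_st ?qr; try lia.
have -> : n - k = (n - k.+1).+1 by lia.
by apply: body; lia.
Qed.

Definition zero r := While r nonzero (Dec r).

Lemma runs_zero o p r :
  runs (zero r) (st o p) (st o (upd p r 0)) (p r * 3 + 1).
Proof.
have -> : st o p = st o (upd p r (p r)) by upd_eq.
apply: (@runs_count_down r _ o (upd p r)) => k *; first by rewrite upd_same.
have := runs_dec o (upd p r k.+1) r; congr runs; upd_eq.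
Qed.

Definition pour a y := While a nonzero (Seq (Dec a) (Inc y)).

Lemma runs_pour o p a y : a != y ->
  runs (pour a y) (st o p) (st o (upd (upd p a 0) y (p y + p a)))
    (p a * 4 + 1).
Proof.
move=> ay; pose q k := upd (upd p a k) y (p y + (p a - k)).
have -> : st o p = st o (q (p a)) by rewrite /q; upd_eq.
have -> : upd (upd p a 0) y (p y + p a) = q 0 by rewrite /q subn0.
apply: (@runs_count_down a _ o q) => k *; first by rewrite /q upd_other ?upd_same.
have := runs_seq (runs_dec o (q k.+1) a) (runs_inc _ _ y).
congr runs; rewrite /q; upd_eq.
Qed.

Definition copy a y z :=
  Seq (While a nonzero (Seq (Dec a) (Seq (Inc y) (Inc z)))) (pour z a).

Lemma runs_copy o p a y z : a != y -> a != z -> y != z -> p z = 0 ->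
  runs (copy a y z) (st o p) (st o (upd p y (p y + p a))) (p a * 9 + 2).
Proof.
move=> ay az yz pz.
pose q k := upd (upd (upd p a k) y (p y + (p a - k))) z (p a - k).
have qk k : q k a = k by rewrite /q upd_other // upd_other // upd_same.
have body k : k < p a ->
  runs (Seq (Dec a) (Seq (Inc y) (Inc z))) (st o (q k.+1)) (st o (q k)) 3.
  move=> ka.
  have := runs_seq (runs_dec o (q k.+1) a) (runs_seq (runs_inc _ _ y) (runs_inc _ _ z)).
  congr runs; rewrite /q; upd_eq.
have za : z != a by rewrite eq_sym.
have := runs_seq (runs_count_down qk body) (runs_pour o (q 0) za).
have -> : st o (q (p a)) = st o p by rewrite /q; upd_eq.
have -> : q 0 z = p a by rewrite /q upd_same subn0.
rewrite qk.
have -> : st o (upd (upd (q 0) z 0) a (0 + p a)) = st o (upd p y (p y + p a)).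
  rewrite /q; upd_eq.
by apply: runs_le; lia.
Qed.

(** * Polynomial bounds *)

Definition sz (o : input) (e : seq nat) : nat := size o.1 + 2 + sumn e.

(** Arguments enter [sz] with their values because registers are unary. The summand 2 in [sz] keeps
    the base of the powers above 1, so that exponents absorb sums and constants. The table does not
    enter: access to a cell is paid for by its address. *)
Definition polyb (M : input -> seq nat -> nat) : Prop :=
  exists d, forall o e, M o e <= sz o e ^ d.

Lemma sz_ge2 o e : 1 < sz o e.
Proof. by rewrite /sz; lia. Qed.

Lemma sz_exp_gt0 o e d : 0 < sz o e ^ d.
Proof. by rewrite expn_gt0 (ltnW (sz_ge2 o e)). Qed.

Lemma polyb_le M M' : (forall o e, M o e <= M' o e) -> polyb M' -> polyb M.
Proof. by move=> le_M [d dP]; exists d => o e; apply: leq_trans (dP o e). Qed.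

Lemma polyb_const c : polyb (fun _ _ => c).
Proof.
exists c => o e; apply: leq_trans (ltnW (ltn_expl c (ltnSn 1))) _.
by case: c => // c; rewrite leq_exp2r // sz_ge2.
Qed.

Lemma polyb_sz : polyb sz.
Proof. by exists 1 => o e; rewrite expn1. Qed.

Lemma polyb_mul M1 M2 :
  polyb M1 -> polyb M2 -> polyb (fun o e => M1 o e * M2 o e).
Proof.
by move=> [d1 h1] [d2 h2]; exists (d1 + d2) => o e; rewrite expnD leq_mul.
Qed.

Lemma polyb_add M1 M2 :
  polyb M1 -> polyb M2 -> polyb (fun o e => M1 o e + M2 o e).
Proof.
move=> [d1 h1] [d2 h2]; exists (d1 + d2).+1 => o e.
apply: leq_trans (leq_add (h1 o e) (h2 o e)) _.
have le1 : sz o e ^ d1 <= sz o e ^ (d1 + d2) by rewrite expnD leq_pmulr ?sz_exp_gt0.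
have le2 : sz o e ^ d2 <= sz o e ^ (d1 + d2) by rewrite expnD leq_pmull ?sz_exp_gt0.
by rewrite expnS; have := sz_ge2 o e; nia.
Qed.

Lemma polyb_exp M d : polyb M -> polyb (fun o e => M o e ^ d).
Proof.
move=> MP; elim: d => [|d IH].
  by apply: polyb_le (polyb_const 1) => o e; rewrite expn0.
by apply: polyb_le (polyb_mul MP IH) => o e; rewrite expnS.
Qed.

Lemma polyb_comp M (E : input -> seq nat -> seq nat) :
  polyb M -> polyb (fun o e => sumn (E o e)) -> polyb (fun o e => M o (E o e)).
Proof.
move=> [d dP] EP.
apply: (@polyb_le _ (fun o e => (sz o e + sumn (E o e)) ^ d)).
  move=> o e; apply: leq_trans (dP _ _) _; case: d {dP} => // d.
  by rewrite leq_exp2r // /sz; lia.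
by apply/polyb_exp/polyb_add => //; apply: polyb_sz.
Qed.

Lemma polyb_sumn : polyb (fun _ e => sumn e).
Proof. by apply: polyb_le polyb_sz => o e; rewrite /sz; lia. Qed.

Lemma polyb_sub M M' : polyb M -> polyb (fun o e => M o e - M' o e).
Proof. by apply: polyb_le => o e; apply: leq_subr. Qed.

Create HintDb polyb.
#[local] Hint Resolve polyb_const polyb_sz polyb_mul polyb_add polyb_sumn
  polyb_sub : polyb.

(** Registers 0 and 1 are the heads on the word and on the table; they are parked on the marker
    between two reads. *)
Definition clean (l : nat) (p : nat -> nat) : Prop :=
  [/\ p 0 = 0, p 1 = 0 & forall i, l <= i -> p i = 0].

(* The environment is held in the registers ixs; the registers from l on are
   scratch space, and the result goes to register l. *)
Definition feas (f : input -> seq nat -> nat) : Prop :=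
  polyb f /\
  forall l ixs, 1 < l -> all (fun i => 1 < i < l) ixs ->
  exists (P : prog) (M : input -> seq nat -> nat), polyb M /\
  forall o p, clean l p ->
    runs P (st o p) (st o (upd p l (f o (map p ixs)))) (M o (map p ixs)).

Lemma feas_ext f f' : feas f -> (forall o e, f o e = f' o e) -> feas f'.
Proof.
move=> ff ff'; have -> // : f' = f.
by apply: funext => o; apply: funext => e.
Qed.

Definition load (ixs : seq nat) (j y z : nat) : prog :=
  if j < size ixs then copy (nth 0 ixs j) y z else Dec z.

Lemma runs_load o p l ixs j y z :
  1 < l -> all (fun i => 1 < i < l) ixs -> (y < 2) || (l <= y) -> l <= z ->
  y != z -> p z = 0 ->
  runs (load ixs j y z) (st o p) (st o (upd p y (p y + nth 0 (map p ixs) j)))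
    (sumn (map p ixs) * 9 + 2).
Proof.
move=> l1 /all_nthP ixsP yl lz yz pz; rewrite /load; case: ltnP => [jl|lj].
  have /andP[j1 jlt] := ixsP 0 _ jl.
  rewrite (nth_map 0) //; apply: runs_le (runs_copy _ _ _ _ _) => //; try lia.
  rewrite leq_add2r leq_mul2r orFb -(nth_map 0 0 p jl).
  elim: (map p ixs) j {jl j1 jlt lz} => [|x s IH] [|j] //=; first exact: leq_addr.
  by apply: leq_trans (IH j) _; apply: leq_addl.
rewrite nth_default ?size_map // addn0.
have -> : upd p y (p y) = p by upd_eq.
by apply: runs_le (runs_skip _ _); lia.
Qed.

Lemma feas_var j : feas (fun _ e => nth 0 e j).
Proof.
split.
  apply: polyb_le polyb_sumn => _ e.
  elim: e j => [|x e IH] [|j] //=; first exact: leq_addr.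
  by apply: leq_trans (IH j) _; apply: leq_addl.
move=> l ixs l1 hix; exists (load ixs j l l.+1), (fun _ e => sumn e * 9 + 2).
split; first by auto with polyb.
move=> o p [_ _ pl]; have := @runs_load o p l ixs j l l.+1 l1 hix.
rewrite (pl l) // add0n => H; apply: H; rewrite ?leqnn ?orbT ?leqnSn ?pl //.
by lia.
Qed.

Lemma feas_0 : feas (fun _ _ => 0).
Proof.
split; first exact: polyb_const.
move=> l ixs l1 hix; exists (Dec l), (fun _ _ => 1); split=> [|o p [_ _ pl]].
  exact: polyb_const.
have -> : upd p l 0 = p by upd_eq; rewrite pl.
by apply: runs_skip; apply: pl.
Qed.

Lemma feas_1 : feas (fun _ _ => 1).
Proof.
split; first exact: polyb_const.
move=> l ixs l1 hix; exists (Inc l), (fun _ _ => 1); split=> [|o p [_ _ pl]].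
  exact: polyb_const.
by have := runs_inc o p l; rewrite pl.
Qed.

Lemma map_upd (p : nat -> nat) l v l' ixs : l' <= l ->
  all (fun i => 1 < i < l') ixs -> map (upd p l v) ixs = map p ixs.
Proof.
move=> l'l /allP hix; apply/eq_in_map => i /hix /andP[_ il].
by rewrite upd_other //; lia.
Qed.

Lemma all_ltn l l' ixs : l <= l' -> all (fun i => 1 < i < l) ixs ->
  all (fun i => 1 < i < l') ixs.
Proof. by move=> ll' /allP hix; apply/allP => i /hix; lia. Qed.

(** Environments work like de Bruijn contexts: the value of [g] becomes variable 0 and stays in
    register [l] while [f] runs with scratch space from [l.+1] on. Then [l] is cleared and receives
    the result, which leaves the scratch space clean. *)
Lemma feas_let g f : feas g -> feas f -> feas (fun o e => f o (g o e :: e)).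
Proof.
move=> [gb gP] [fb fP]; split.
  by apply: (polyb_comp fb) => /=; auto with polyb.
move=> l ixs l1 hix.
have [P [MP [PB PP]]] := gP l ixs l1 hix.
have [|Q [MQ [QB QP]]] := fP l.+1 (l :: ixs) (ltnW l1).
  by rewrite /= l1 ltnS leqnn; apply: all_ltn hix.
exists (Seq P (Seq Q (Seq (zero l) (pour l.+1 l)))).
exists (fun o e => MP o e + (MQ o (g o e :: e)
  + ((g o e * 3 + 1) + (f o (g o e :: e) * 4 + 1)))).
have cb F : polyb F -> polyb (fun o e => F o (g o e :: e)).
  by move=> FB; apply: (polyb_comp FB) => /=; auto with polyb.
split; first by have := cb _ QB; have := cb _ fb; auto 10 with polyb.
move=> o p [p0 p1 pl]; set e := map p ixs.
have r1 := PP o p (And3 p0 p1 pl); rewrite -/e in r1.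
set q1 := upd p l (g o e) in r1.
have cl1 : clean l.+1 q1.
  by split=> [||i li]; rewrite /q1 upd_other ?p0 ?p1 ?pl //; lia.
have r2 := QP o q1 cl1.
have eE : map q1 (l :: ixs) = g o e :: e.
  by rewrite /= {1}/q1 upd_same (map_upd _ _ (leqnn l)).
rewrite eE in r2.
set v := f o _ in r2 *.
have lne : l.+1 != l by lia.
have := runs_seq r1 (runs_seq r2 (runs_seq (runs_zero o _ l) (runs_pour o _ lne))).
have -> : st o (upd (upd (upd (upd q1 l.+1 v) l 0) l.+1 0) l
   (upd (upd q1 l.+1 v) l 0 l + upd (upd q1 l.+1 v) l 0 l.+1)) = st o (upd p l v).
  by rewrite /q1; upd_eq; rewrite pl //; lia.
apply: runs_le; rewrite !leq_add2l.
have -> : upd q1 l.+1 v l = g o e by rewrite upd_other ?/q1 ?upd_same //; lia.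
by rewrite upd_other // upd_same.
Qed.

Lemma feas_weak f : feas f -> feas (fun o e => f o (behead e)).
Proof.
have cb F : polyb F -> polyb (fun o e => F o (behead e)).
  move=> FB; apply: (polyb_comp FB) => /=; apply: polyb_le polyb_sumn.
  by move=> _ [|x e] //=; apply: leq_addl.
move=> [fb fP]; split; first exact: cb.
move=> l ixs l1 hix.
have [|P [M [MB PP]]] := fP l (behead ixs) l1; first by case: ixs hix => //= ? ? /andP[].
exists P, (fun o e => M o (behead e)); split; first exact: cb.
by move=> o p cl; have := PP o p cl; rewrite behead_map.
Qed.

Lemma feas_comp1 F x : feas (fun o e => F o (nth 0 e 0)) -> feas x ->
  feas (fun o e => F o (x o e)).
Proof.
by move=> FF xF; apply: (@feas_let x (fun o e => F o (nth 0 e 0)) xF FF).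
Qed.

Lemma feas_comp2 F x y : feas (fun o e => F o (nth 0 e 0) (nth 0 e 1)) ->
  feas x -> feas y -> feas (fun o e => F o (x o e) (y o e)).
Proof.
move=> FF xF yF.
apply: (@feas_let y (fun o e => F o (x o (behead e)) (nth 0 e 0)) yF).
exact: (@feas_let (fun o e => x o (behead e))
  (fun o e => F o (nth 0 e 0) (nth 0 e 1)) (feas_weak xF) FF).
Qed.

Lemma feas_add x y : feas x -> feas y -> feas (fun o e => x o e + y o e).
Proof.
move=> xF yF; apply: (@feas_comp2 (fun _ a b => a + b)) xF yF.
have vb := fun j => (feas_var j).1.
split; first by apply: polyb_add; apply: vb.
move=> l ixs l1 hix; exists (Seq (load ixs 0 l l.+1) (load ixs 1 l l.+1)).
exists (fun _ e => (sumn e * 9 + 2) + (sumn e * 9 + 2)).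
split; first by auto with polyb.
move=> o p [_ _ pl]; set e := map p ixs.
have pl0 : p l = 0 by rewrite pl.
have pl1 : p l.+1 = 0 by rewrite pl.
have lz : l != l.+1 by lia.
have H1 := @runs_load o p l ixs 0 l l.+1 l1 hix _ (leqnSn l) lz pl1.
have H2 := @runs_load o (upd p l (nth 0 e 0)) l ixs 1 l l.+1 l1 hix _ (leqnSn l) lz _.
rewrite upd_same (map_upd _ _ (leqnn l)) // -/e pl0 in H1 H2.
have -> : upd p l (nth 0 e 0 + nth 0 e 1) =
  upd (upd p l (nth 0 e 0)) l (nth 0 e 0 + nth 0 e 1) by upd_eq.
apply: runs_seq (H1 _) (H2 _ _); rewrite ?leqnn ?orbT //.
by rewrite upd_other ?pl1 //; lia.
Qed.

Lemma feas_sub x y : feas x -> feas y -> feas (fun o e => x o e - y o e).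
Proof.
move=> xF yF; apply: (@feas_comp2 (fun _ a b => a - b)) xF yF.
have vb := fun j => (feas_var j).1.
split; first by apply: polyb_sub; apply: vb.
move=> l ixs l1 hix; exists (Seq (load ixs 0 l l.+1)
  (Seq (load ixs 1 l.+1 l.+2) (While l.+1 nonzero (Seq (Dec l.+1) (Dec l))))).
exists (fun _ e => (sumn e * 9 + 2) + ((sumn e * 9 + 2) + (nth 0 e 1 * 4 + 1))).
split; first by have := vb 1; auto 10 with polyb.
move=> o p [_ _ pl]; set e := map p ixs.
have pl0 : p l = 0 by rewrite pl.
have pl1 : p l.+1 = 0 by rewrite pl.
have pl2 : p l.+2 = 0 by rewrite pl // ltnW.
have lz : l != l.+1 by lia.
have lz1 : l.+1 != l.+2 by lia.
have ll2 : l <= l.+2 by lia.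
have H1 := @runs_load o p l ixs 0 l l.+1 l1 hix _ (leqnSn l) lz pl1.
have H2 := @runs_load o (upd p l (nth 0 e 0)) l ixs 1 l.+1 l.+2 l1 hix _ ll2 lz1 _.
have hu j : 0 < j -> upd p l (nth 0 e 0) (l + j) = 0.
  by move=> j0; rewrite upd_other ?pl //; lia.
have hu1 := hu 1 isT; have hu2 := hu 2 isT; rewrite addn1 addn2 in hu1 hu2.
rewrite ?(map_upd _ _ (leqnn l)) // -/e ?pl0 ?hu1 in H1 H2.
pose q k := upd (upd p l.+1 k) l (nth 0 e 0 - (nth 0 e 1 - k)).
apply: runs_seq (H1 _) (runs_seq (H2 _ _) _); rewrite ?leqnn ?orbT ?leqnSn ?orbT //.
have -> : st o (upd (upd p l (nth 0 e 0)) l.+1 (0 + nth 0 e 1)) = st o (q (nth 0 e 1)).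
  by rewrite /q; upd_eq.
have -> : st o (upd p l (nth 0 e 0 - nth 0 e 1)) = st o (q 0).
  by rewrite /q; upd_eq.
apply: runs_count_down => k *; first by rewrite /q upd_other ?upd_same //; lia.
have := runs_seq (runs_dec o (q k.+1) l.+1) (runs_dec _ _ l).
congr runs; rewrite /q; upd_eq.
Qed.

(** Primitive recursion with all intermediate values under a polynomial bound [M]. Without such a
    bound, iterating a step such as squaring would produce values that no unary register reaches in
    polynomial time. *)
Lemma feas_iter (a h n M : input -> seq nat -> nat)
    (R : input -> seq nat -> nat -> nat) :
  feas a -> feas h -> feas n -> polyb M ->
  (forall o e i, i <= n o e -> R o e i <= M o e) ->
  (forall o e, R o e 0 = a o e) ->
  (forall o e i, R o e i.+1 = h o (R o e i :: i :: e)) ->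
  feas (fun o e => R o e (n o e)).
Proof.
move=> [ab aP] [hb hP] [nb nP] MB RM R0 RS; split.
  by apply: polyb_le MB => o e; apply: RM.
move=> l ixs l1 hix.
have [Pn [Tn [TnB PnP]]] := nP l ixs l1 hix.
have [||Pa [Ta [TaB PaP]]] := aP l.+2 ixs; first by lia.
  by apply: all_ltn hix; lia.
have [||Ph [Th [[d dP] PhP]]] := hP l.+3 [:: l.+2, l.+1 & ixs]; first by lia.
  by apply/allP => i; rewrite !inE => /or3P[/eqP->|/eqP->|/(allP hix)]; lia.
pose body := Seq (Dec l) (Seq Ph (Seq (zero l.+2)
  (Seq (pour l.+3 l.+2) (Inc l.+1)))).
exists (Seq Pn (Seq Pa (Seq (While l nonzero body)
  (Seq (zero l.+1) (pour l.+2 l))))).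
pose TB o e := (sz o e + M o e + n o e) ^ d + (8 * M o e + 4).
exists (fun o e => Tn o e + (Ta o e + ((n o e * (TB o e + 2) + 1)
  + ((n o e * 3 + 1) + (M o e * 4 + 1))))).
split.
  have : polyb TB.
    rewrite /TB; apply: polyb_add; last by auto 10 with polyb.
    by apply: polyb_exp; auto 10 with polyb.
  by move=> TBB; auto 20 with polyb.
move=> o p cl; have [p0 p1 pl] := cl; set e := map p ixs; set N := n o e.
have rn := PnP o p cl; rewrite -/e -/N in rn.
have cl2 : clean l.+2 (upd p l N).
  by split=> [||i li]; rewrite upd_other ?p0 ?p1 ?pl //; lia.
have ra := PaP o _ cl2; rewrite (map_upd _ _ (leqnn l)) // -/e -R0 in ra.
(* With k rounds left, register [l] is the counter, [l.+1] the index of the recursion and [l.+2] the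
   current value. *)
pose q k := upd (upd (upd p l k) l.+1 (N - k)) l.+2 (R o e (N - k)).
have qE : st o (upd (upd p l N) l.+2 (R o e 0)) = st o (q N).
  rewrite /q subnn; upd_eq; rewrite pl //; lia.
rewrite qE in ra.
have rb k : k < N -> runs body (st o (q k.+1)) (st o (q k)) (TB o e).
  move=> kN; set i := N - k.+1.
  pose q1 := upd (upd (upd p l k) l.+1 i) l.+2 (R o e i).
  have q1E : st o (upd (q k.+1) l (q k.+1 l).-1) = st o q1.
    by rewrite /q1 /q -/i; upd_eq.
  have s1 := runs_dec o (q k.+1) l; rewrite q1E in s1.
  have cl3 : clean l.+3 q1.
    by split=> [||j lj]; rewrite /q1 !upd_other ?p0 ?p1 ?pl //; lia.
  have s2 := PhP o q1 cl3.
  have mE : map q1 ixs = e.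
    by rewrite /q1 !(@map_upd _ _ _ l) //; lia.
  have m2 : q1 l.+2 = R o e i by rewrite /q1 upd_same.
  have m1 : q1 l.+1 = i by rewrite /q1 upd_other ?upd_same //; lia.
  rewrite /= mE m1 m2 -RS in s2.
  have Nk : N - k = i.+1 by rewrite /i; lia.
  set q2 := upd q1 l.+3 _ in s2.
  have s3 := runs_zero o q2 l.+2.
  have lne : l.+3 != l.+2 by lia.
  have s4 := runs_pour o (upd q2 l.+2 0) lne.
  set q4 := upd (upd (upd q2 l.+2 0) l.+3 0) l.+2 _ in s4.
  have s5 := runs_inc o q4 l.+1.
  have q4E : st o (upd q4 l.+1 (q4 l.+1).+1) = st o (q k).
    rewrite /q4 /q2 /q1 /q Nk; upd_eq; rewrite pl //; lia.
  rewrite q4E in s5.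
  apply: runs_le (runs_seq s1 (runs_seq s2 (runs_seq s3 (runs_seq s4 s5)))).
  have -> : q2 l.+2 = R o e i by rewrite /q2 upd_other ?m2 //; lia.
  have -> : upd q2 l.+2 0 l.+3 = R o e i.+1 by rewrite upd_other // /q2 upd_same.
  have iN : i.+1 <= N by rewrite /i; lia.
  have := RM o e i (ltnW iN); have := RM o e i.+1 iN.
  (* The body runs in an environment extended by the current value and the index, which are at most
     [M o e] and [n o e]. *)
  have : Th o [:: R o e i, i & e] <= (sz o e + M o e + n o e) ^ d.
    apply: leq_trans (dP _ _) _; case: d dP @TB => // d' _ _.
    rewrite leq_exp2r // /sz /= -/N.
    by have := RM o e i (ltnW iN); lia.
  rewrite /TB; lia.
have ql k : q k l = k.
  by rewrite /q upd_other ?[upd _ l.+1 _ l]upd_other ?upd_same //; lia.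
have rw := runs_count_down ql rb.
have q01 : q 0 l.+1 = N by rewrite /q upd_other ?upd_same ?subn0 //; lia.
have q02 : q 0 l.+2 = R o e N by rewrite /q upd_same subn0.
have rz := runs_zero o (q 0) l.+1.
have lne : l.+2 != l by lia.
have rt := runs_pour o (upd (q 0) l.+1 0) lne.
have := runs_seq rn (runs_seq ra (runs_seq rw (runs_seq rz rt))).
have -> : st o (upd (upd (upd (q 0) l.+1 0) l.+2 0) l
     (upd (q 0) l.+1 0 l + upd (q 0) l.+1 0 l.+2)) = st o (upd p l (R o e N)).
  have -> : upd (q 0) l.+1 0 l = 0 by rewrite upd_other ?ql //; lia.
  have -> : upd (q 0) l.+1 0 l.+2 = R o e N by rewrite upd_other ?q02 //; lia.
  rewrite /q; upd_eq; rewrite pl //; lia.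
have -> : upd (q 0) l.+1 0 l.+2 = R o e N by rewrite upd_other ?q02 //; lia.
rewrite q01; apply: runs_le; rewrite -/N !leq_add2l addn2 !leq_add2l.
by rewrite leq_add2r leq_mul2r RM.
Qed.

Lemma feas_sum n (F : input -> seq nat -> nat -> nat) :
  feas n -> feas (fun o e => F o (behead e) (nth 0 e 0)) ->
  feas (fun o e => \sum_(i < n o e) F o e i).
Proof.
move=> nF FF.
pose R o e m := \sum_(i < m) F o e i.
have [d dP] := FF.1.
apply: (@feas_iter (fun _ _ => 0)
  (fun o e => nth 0 e 0 + F o (behead (behead e)) (nth 0 e 1)) n
  (fun o e => n o e * (sz o e + n o e) ^ d) R) => //.
- exact: feas_0.
- apply: (feas_ext (feas_add (feas_var 0) (feas_weak FF))) => o e.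
  by rewrite nth_behead.
- apply: polyb_mul; first exact: nF.1.
  by apply/polyb_exp/polyb_add; [apply: polyb_sz | apply: nF.1].
- move=> o e i le_in; rewrite /R.
  apply: leq_trans (_ : i * (sz o e + n o e) ^ d <= _); last by rewrite leq_mul2r le_in orbT.
  rewrite -[i in i * _]card_ord -sum_nat_const; apply: leq_sum => j _.
  apply: leq_trans (dP o (nat_of_ord j :: e)) _.
  case: d {dP} => // d; rewrite leq_exp2r // /sz /=.
  by have := ltn_ord j; lia.
- by move=> o e; rewrite /R big_ord0.
- by move=> o e i; rewrite /R big_ord_recr.
Qed.

(** The marker occupies position 0, so the symbol of index p lies at position p+1; hence the first
    [Inc r]. The final [zero r] parks the head again. *)
Definition read_tape (r l : nat) : prog :=
  Seq (Inc r) (Seq (If r (pred1 (Some (inl true))) (Inc l) (Dec l)) (zero r)).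

Lemma runs_read o p r l : r < 2 -> 1 < l -> p l = 0 ->
  runs (read_tape r l) (st o p)
    (st o (upd (upd p r 0) l (bank o r (p r) == Some true))) (p r * 3 + 10).
Proof.
move=> r2 l1 pl.
have s1 := runs_inc o p r; set q1 := upd p r _ in s1.
have s2 : runs (If r (pred1 (Some (inl true))) (Inc l) (Dec l)) (st o q1)
   (st o (upd q1 l (bank o r (p r) == Some true))) 3.
  have sc : pred1 (Some (inl true)) (scanned (st o q1) r)
      = (bank o r (p r) == Some true).
    rewrite /scanned /cell_at /= /q1 upd_same /=.
    by case: (bank o r (p r)) => [[]|].
  have q1l : q1 l = 0 by rewrite /q1 upd_other //; lia.
  case: (boolP (bank o r (p r) == Some true)) => b.
    exists 3 => //; apply: ExecIfT; rewrite ?sc //=.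
    have -> : upd q1 l 1 = upd q1 l (q1 l).+1 by rewrite q1l.
    exact: ExecInc.
  exists 2 => //; apply: ExecIfF; rewrite ?sc //=.
  have -> : upd q1 l 0 = upd q1 l (q1 l).-1 by rewrite q1l.
  exact: ExecDec.
have := runs_seq s1 (runs_seq s2 (runs_zero o _ r)).
have -> : upd q1 l (bank o r (p r) == Some true) r = (p r).+1.
  by rewrite upd_other /q1 ?upd_same //; lia.
have -> : st o (upd (upd q1 l (bank o r (p r) == Some true)) r 0)
  = st o (upd (upd p r 0) l (bank o r (p r) == Some true)).
  by rewrite /q1; upd_eq.
by apply: runs_le; lia.
Qed.

Lemma feas_bank r x : r < 2 -> feas x ->
  feas (fun o e => (bank o r (x o e) == Some true) : nat).
Proof.
move=> r2 xF.
apply: (@feas_comp1 (fun o a => (bank o r a == Some true) : nat)) xF.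
split; first by apply: polyb_le (polyb_const 1) => o e; case: (_ == _).
move=> l ixs l1 hix; exists (Seq (load ixs 0 r l.+1) (read_tape r l)).
exists (fun _ e => (sumn e * 9 + 2) + (nth 0 e 0 * 3 + 10)).
split; first by have := (feas_var 0).1; auto 10 with polyb.
move=> o p [p0 p1 pl]; set e := map p ixs.
have rl : r != l.+1 by lia.
have s1 := @runs_load o p l ixs 0 r l.+1 l1 hix _ (leqnSn l) rl (pl _ (leqnSn l)).
have pr : p r = 0 by case: r r2 {rl s1} => [|[]].
rewrite -/e pr add0n in s1.
have s2 := @runs_read o (upd p r (nth 0 e 0)) r l r2 l1 _.
rewrite upd_same in s2.
have -> : st o (upd p l (bank o r (nth 0 e 0) == Some true))
  = st o (upd (upd (upd p r (nth 0 e 0)) r 0) l (bank o r (nth 0 e 0) == Some true)).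
  by upd_eq.
apply: runs_seq (s1 _) (s2 _); first by rewrite r2.
by rewrite upd_other ?pl //; lia.
Qed.

Lemma onth_true (w : seq bool) i : (onth w i == Some true) = nth false w i.
Proof. by elim: w i => [|[] w IH] [|i] //=; rewrite ?nth_nil. Qed.

Lemma feas_word x : feas x -> feas (fun o e => nth false o.1 (x o e) : nat).
Proof.
move=> xF; apply: feas_ext (@feas_bank 0 x isT xF) _ => o e /=.
by rewrite onth_true.
Qed.

Lemma feas_table x : feas x -> feas (fun o e => o.2 (x o e) : nat).
Proof.
move=> xF; apply: feas_ext (@feas_bank 1 x isT xF) _ => o e /=.
by case: (o.2 _).
Qed.

Lemma feas_size : feas (fun o _ => size o.1).
Proof.
split; first by apply: polyb_le polyb_sz => o e; rewrite /sz; lia.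
move=> l ixs l1 hix.
exists (Seq (Inc 0) (Seq (While 0 (predC1 None) (Seq (Inc l) (Inc 0))) (zero 0))).
exists (fun o e => sz o e * 7 + 10); split; first by auto with polyb.
move=> o p [p0 p1 pl]; pose q k := upd (upd p 0 k.+1) l k.
have q0 k : q k 0 = k.+1 by rewrite /q upd_other ?upd_same //; lia.
have s1 := runs_inc o p 0; rewrite p0 in s1.
have qE : st o (upd p 0 1) = st o (q 0).
  by rewrite /q; upd_eq; rewrite pl.
rewrite qE in s1.
have sc k : scanned (st o (q k)) 0 = omap inl (onth o.1 k).
  by rewrite /scanned /cell_at /= q0.
have s2 : runs (While 0 (predC1 None) (Seq (Inc l) (Inc 0))) (st o (q 0))
    (st o (q (size o.1))) (size o.1 * 4 + 1).
  apply: (@runs_while 0 _ _ (fun k => st o (q k))) => [k kw||k kw].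
  - by rewrite sc /=; move: kw; rewrite -onthTE; case: (onth _ _).
  - by rewrite sc /= onth_default.
  have := runs_seq (runs_inc o (q k) l) (runs_inc _ _ 0).
  congr runs; rewrite /q; upd_eq.
have s3 := runs_zero o (q (size o.1)) 0.
have := runs_seq s1 (runs_seq s2 s3).
have -> : st o (upd (q (size o.1)) 0 0) = st o (upd p l (size o.1)).
  by rewrite /q; upd_eq.
by rewrite q0; apply: runs_le; rewrite /sz; lia.
Qed.

(** Course-of-values recursion: cell j is computed from a table whose cells below j are already
    final. It allows for numbers of polynomially many bits, whose values exceed any register. *)
Fixpoint fill (f : input -> seq nat -> nat) (w : seq bool) (i : nat) :
    nat -> bool :=
  if i is j.+1 then upd (fill f w j) j (f (w, fill f w j) [:: j] != 0)
  else fun=> false.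

Lemma fill_default f w i j : i <= j -> fill f w i j = false.
Proof. by elim: i j => //= i IH j ij; rewrite upd_other ?IH //; lia. Qed.

Lemma table_polynomial_time N f g (L : seq bool -> Prop) :
  feas N -> feas f -> feas g ->
  (forall w, g (w, fill f w (N (w, fun=> false) [::])) [::] <> 0 <-> L w) ->
  polynomial_time L.
Proof.
move=> [Nb NP] [fb fP] [gb gP] gL.
have [PN [TN [TNB PNP]]] := NP 2 [::] isT isT.
have [Pf [Tf [TfB PfP]]] := fP 4 [:: 3] isT isT.
have [Pg [Tg [TgB PgP]]] := gP 2 [::] isT isT.
(* Register 2 counts the cells left, 3 holds the address of the current cell and 4 the value of [f]
   there; the registers from 5 on are scratch. *)
pose store1 := Seq (load [:: 3] 0 1 5) (Seq (Inc 1) (Seq (Put 1 (Some true)) (zero 1))).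
pose body := Seq (Dec 2) (Seq Pf (Seq (If 4 nonzero store1 (Dec 5))
  (Seq (zero 4) (Inc 3)))).
have FB := fb; case: FB => df dfP; have [d2 d2P] := TfB.
pose TB (o : input) (e : seq nat) :=
  (sz o e + N o e) ^ d2 + ((N o e * 12 + 20) + ((sz o e + N o e) ^ df * 3 + 5)).
have TBB : polyb TB.
  have B1 d : polyb (fun o e => (sz o e + N o e) ^ d).
    by apply: polyb_exp; auto with polyb.
  by rewrite /TB; have := B1 df; have := B1 d2; auto 20 with polyb.
have [dg dgP] := TgB.
have [d dP] : polyb (fun o e => TN o e + ((N o e * (TB o e + 2) + 1)
    + ((N o e * 3 + 1) + sz o e ^ dg))).
  by have := polyb_exp dg polyb_sz; auto 20 with polyb.
apply: (@prog_polynomial_time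
  (Seq PN (Seq (While 2 nonzero body) (Seq (zero 3) Pg))) 2 d) => w.
pose o0 : input := (w, fun=> false); pose M := N o0 [::].
pose o i : input := (w, fill f w i).
have -> : init_store w = st o0 (fun=> 0).
  by congr Store; apply: funext => -[|[|r]]; apply: funext.
have r1 := PNP o0 (fun=> 0) (And3 erefl erefl (fun _ _ => erefl)).
rewrite /= -/M in r1.
pose q k := upd (upd (fun=> 0) 2 k) 3 (M - k).
have q0E : st o0 (upd (fun=> 0) 2 M) = st (o 0) (q M).
  by rewrite /q subnn; upd_eq.
rewrite q0E in r1.
have rb i : i < M -> runs body (st (o i) (q (M - i))) (st (o i.+1) (q (M - i.+1)))
    (TB o0 [::]).
  move=> iM; set k := M - i.+1; have kE : M - i = k.+1 by rewrite /k; lia.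
  pose q1 := upd (upd (fun=> 0) 2 k) 3 i.
  have s1 := runs_dec (o i) (q k.+1) 2.
  have q1E : st (o i) (upd (q k.+1) 2 (q k.+1 2).-1) = st (o i) q1.
    by rewrite /q1 /q; upd_eq; lia.
  rewrite q1E -kE in s1.
  have cl1 : clean 4 q1 by split=> // j j4; rewrite /q1 !upd_other //; lia.
  have s2 := PfP (o i) q1 cl1; have m3 : map q1 [:: 3] = [:: i] by [].
  rewrite m3 in s2; set v := f _ _ in s2; set q2 := upd q1 4 v in s2.
  have s3 : runs (If 4 nonzero store1 (Dec 5)) (st (o i) q2) (st (o i.+1) q2)
      (i * 12 + 20).
    have nz : nonzero (scanned (st (o i) q2) 4) = (v != 0).
      by rewrite nonzero_st /q2 upd_same.
    case: (boolP (v != 0)) => v0.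
      have [t ex le_t] : runs store1 (st (o i) q2) (st (o i.+1) q2) (i * 12 + 18).
        have h1 := @runs_load (o i) q2 4 [:: 3] 0 1 5 isT isT isT isT isT erefl.
        have e1 : upd q2 1 (q2 1 + nth 0 (map q2 [:: 3]) 0) = upd q2 1 i by [].
        rewrite e1 /= in h1.
        have h2 := runs_inc (o i) (upd q2 1 i) 1.
        have e2 : st (o i) (upd (upd q2 1 i) 1 (upd q2 1 i 1).+1)
           = st (o i) (upd q2 1 i.+1) by upd_eq.
        rewrite e2 in h2.
        have h3 : runs (Put 1 (Some true)) (st (o i) (upd q2 1 i.+1))
            (st (o i.+1) (upd q2 1 i.+1)) 1.
          exists 1 => //.
          have -> : st (o i.+1) (upd q2 1 i.+1)
             = put (st (o i) (upd q2 1 i.+1)) 1 (Some true).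
            rewrite /put /=; congr Store.
            apply: funext => -[|[|r]]; apply: funext => j //=.
            by rewrite upd_same /upd; case: (j =P i) => // _; rewrite -/v v0.
          exact: ExecPut.
        have h4 := runs_zero (o i.+1) (upd q2 1 i.+1) 1.
        have e4 : st (o i.+1) (upd (upd q2 1 i.+1) 1 0) = st (o i.+1) q2.
          by rewrite /q2 /q1; upd_eq.
        rewrite e4 upd_same in h4.
        have m4 : q2 3 = i by [].
        have := runs_seq h1 (runs_seq h2 (runs_seq h3 h4)).
        by apply: runs_le; rewrite m4; lia.
      exists t.+2; last by lia.
      by apply: ExecIfT; rewrite ?nz.
    exists 2; last by lia.
    apply: ExecIfF; rewrite ?nz //.
    (* A false bit leaves its cell blank, so nothing is written. *)
    have -> : st (o i.+1) q2 = st (o i) q2.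
      congr Store; apply: funext => -[|[|r]]; apply: funext => j //=.
      rewrite /upd; case: (j =P i) => // ->.
      by rewrite -/v (negPf v0) fill_default.
    have := ExecDec 5 (st (o i) q2); congr exec.
    by rewrite /set_pos /=; congr Store; rewrite /q2 /q1; upd_eq.
  have s4 := runs_zero (o i.+1) q2 4.
  have s5 := runs_inc (o i.+1) (upd q2 4 0) 3.
  have e5 : st (o i.+1) (upd (upd q2 4 0) 3 (upd q2 4 0 3).+1) = st (o i.+1) (q k).
    by rewrite /q2 /q1 /q; upd_eq; rewrite /k; lia.
  rewrite e5 in s5.
  have := runs_seq s1 (runs_seq s2 (runs_seq s3 (runs_seq s4 s5))).
  have le_exp D : sz (o i) [:: i] ^ D <= (sz o0 [::] + M) ^ D.
    by case: D => // D; rewrite leq_exp2r // /sz /=; lia.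
  have vb : v <= (sz o0 [::] + M) ^ df.
    by apply: leq_trans (dfP _ _) (le_exp _).
  have tb : Tf (o i) [:: i] <= (sz o0 [::] + M) ^ d2.
    by apply: leq_trans (d2P _ _) (le_exp _).
  have q24 : q2 4 = v by [].
  apply: runs_le; rewrite q24 /TB -/M; lia.
have r2 : runs (While 2 nonzero body) (st (o 0) (q M)) (st (o M) (q 0))
    (M * (TB o0 [::]).+2 + 1).
  have := @runs_while 2 nonzero body (fun i => st (o i) (q (M - i))) M (TB o0 [::]).
  rewrite subn0 subnn; apply=> [i iM||i iM] //; last exact: rb.
    by cbv beta; rewrite nonzero_st /q /upd /=; lia.
have r3 := runs_zero (o M) (q 0) 3.
have q3 : q 0 3 = M by rewrite /q upd_same subn0.
have e3 : st (o M) (upd (q 0) 3 0) = st (o M) (fun=> 0).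
  by rewrite /q; upd_eq.
rewrite q3 e3 in r3.
have r4 := PgP (o M) (fun=> 0) (And3 erefl erefl (fun _ _ => erefl)).
have [t ex le_t] := runs_seq r1 (runs_seq r2 (runs_seq r3 r4)).
exists (st (o M) (upd (fun=> 0) 2 (g (o M) [::]))), t; split=> //; last first.
  by rewrite /= upd_same; apply: gL.
have szE : size w + 2 = sz o0 [::] by rewrite /sz addn0.
rewrite szE; apply: leq_trans (dP o0 [::]).
apply: leq_trans le_t _.
by rewrite -/M addn2 !leq_add2l; apply: dgP.
Qed.

(** * Gluing, and the automaton of a recognisable class *)

Lemma graph_iso_sym (G H : sgraph) : graph_iso G H -> graph_iso H G.
Proof.
case=> f [g fK gK] fE; exists g; first by exists f.
by move=> x y; rewrite -fE !gK.
Qed.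

Lemma graph_iso_class (C : graph_class) (G H : sgraph) :
  graph_iso G H -> C G <-> C H.
Proof.
by move=> iso; split; apply: in_class_iso; last exact: graph_iso_sym.
Qed.

Lemma inj_surj_bij (A B : finType) (f : A -> B) :
  injective f -> (forall b, exists a, f a = b) -> bijective f.
Proof.
move=> inj surj.
have surjb b : exists a, f a == b by have [a <-] := surj b; exists a.
pose g b := xchoose (surjb b); have gK : cancel g f.
  by move=> b; apply/eqP/(xchooseP (surjb b)).
by exists g => // a; apply: inj; rewrite gK.
Qed.

Section Gluing.
Variables (k : nat) (K F : dlgraph k).

(** The gluing as a pushout along the labels. It determines the graph up to isomorphism, so two
    gluings are identified by exhibiting two maps, without touching the sum type. *)
Record is_glue (Z : sgraph) (a : soe K -> Z) (b : soe F -> Z) : Prop := IsGlue {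
  glue_injl : injective a;
  glue_injr : injective b;
  glue_lab : forall i, a (label K i) = b (label F i);
  glue_meet : forall x y, a x = b y ->
    exists2 i, x = label K i & y = label F i;
  glue_surj : forall z, (exists x, a x = z) \/ (exists y, b y = z);
  glue_adj : forall z z', edge z z' <->
    (exists x y, [/\ edge x y, a x = z & a y = z']) \/
    (exists x y, [/\ edge x y, b x = z & b y = z']) }.

Lemma glue_is_glue : @is_glue (glue_graph K F) (@glue_inl k K F) (@glue_inr k K F).
Proof.
split.
- by move=> x y [].
- exact: glue_inr_inj.
- by move=> i; rewrite glue_inr_label.
- move=> x y; rewrite /glue_inr; case: (decP _) => [yl|//] [->].
  by exists (iinv yl); rewrite ?f_iinv.
- move=> [x|[y yP]]; first by left; exists x.
  right; exists y; rewrite /glue_inr; case: (decP _) => [yl|yl].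
    by case/negP: (yP).
  by congr inr; apply: val_inj.
move=> z z'; split.
  case/orP=> /existsP[x /existsP[y /and3P[e /eqP <- /eqP <-]]]; [left|right];
    by exists x, y.
case=> -[x [y [e <- <-]]]; apply/orP; [left|right];
  by apply/existsP; exists x; apply/existsP; exists y; rewrite e !eqxx.
Qed.

Lemma is_glue_iso (Z : sgraph) (a : soe K -> Z) (b : soe F -> Z) :
  is_glue a b -> graph_iso (soe (glue K F)) Z.
Proof.
move=> [ai bi lab meet surj adj].
pose f (p : glue_graph K F) : Z :=
  match p with inl x => a x | inr y => b (val y) end.
have fr y : f (glue_inr K y) = b y.
  rewrite /glue_inr /f; case: (decP _) => // yl.
  by rewrite lab f_iinv.
have finj : injective f.
  move=> [x|[y yP]] [x'|[y' y'P]] /=.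
  - by move/ai=> ->.
  - by move=> /meet[i _ yi]; case/negP: (y'P); rewrite yi codom_f.
  - by move=> /esym /meet[i _ yi]; case/negP: (yP); rewrite yi codom_f.
  - by move/bi=> yy'; congr inr; apply: val_inj.
exists f.
  apply: inj_surj_bij finj _ => z; case: (surj z) => [[x <-]|[y <-]].
    by exists (glue_inl F x).
  by exists (glue_inr K y).
move=> p q; apply/idP/idP.
  move/adj=> [] [x [y [e ex ey]]]; apply/(glue_adj glue_is_glue); [left|right];
    exists x, y; split=> //; apply: finj; by rewrite ?fr.
by move/(glue_adj glue_is_glue) => [] [x [y [e <- <-]]]; apply/adj; [left|right];
  exists x, y; rewrite ?fr.
Qed.

End Gluing.

(** * Letters as operations on labelled graphs *)

Section Operations.
Variable k : nat.
Implicit Types F K : dlgraph k.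

(** For [i = j] the second disjunct is void and the graph does not change; thus every pair of labels
    can be a letter. *)
Definition join_edge F (i j : 'I_k) : rel (soe F) := fun x y =>
  edge x y || [&& x != y, x \in [:: label F i; label F j]
                        & y \in [:: label F i; label F j]].

Lemma join_edge_sym F i j : symmetric (@join_edge F i j).
Proof.
by move=> x y; rewrite /join_edge edge_sym eq_sym [(x \in _) && _]andbC.
Qed.

Lemma join_edge_irr F i j : irreflexive (@join_edge F i j).
Proof. by move=> x; rewrite /join_edge edge_irr eqxx. Qed.

Definition join F (i j : 'I_k) : dlgraph k :=
  @DLGraph k (SGraph (@join_edge_sym F i j) (@join_edge_irr F i j))
    (label F) (@label_inj k F).

Definition fresh_edge F : rel (option (soe F)) := fun x y =>
  if x is Some x' then if y is Some y' then edge x' y' else false else false.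

Lemma fresh_edge_sym F : symmetric (@fresh_edge F).
Proof. by move=> [x|] [y|] //=; rewrite edge_sym. Qed.

Lemma fresh_edge_irr F : irreflexive (@fresh_edge F).
Proof. by move=> [x|] //=; rewrite edge_irr. Qed.

Definition fresh_graph F : sgraph := SGraph (@fresh_edge_sym F) (@fresh_edge_irr F).

Definition fresh_label F (i l : 'I_k) : fresh_graph F :=
  if l == i then None else Some (label F l).

Lemma fresh_label_inj F i : injective (@fresh_label F i).
Proof.
move=> l l'; rewrite /fresh_label; case: eqP => [->|_]; case: eqP => // _.
by case=> /(@label_inj k F).
Qed.

(* The vertex labelled i loses its label to a new isolated vertex. *)
Definition fresh F (i : 'I_k) : dlgraph k := DLGraph (@fresh_label_inj F i).

Lemma discrete_sym : symmetric (fun _ _ : 'I_k => false).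
Proof. by []. Qed.

Definition discrete : dlgraph k :=
  @DLGraph k (@SGraph 'I_k (fun _ _ => false) discrete_sym (fun _ => erefl)) id
    (@inj_id _).

(** The edgeless graph on the labels is a unit of the gluing. As a context it turns [class_equiv]
    into membership of the graphs themselves. *)
Lemma glue_discrete F : graph_iso (soe (glue discrete F)) (soe F).
Proof.
apply: (@is_glue_iso k discrete F (soe F) (label F) id); split=> //.
- exact: label_inj.
- by move=> i y <-; exists i.
- by move=> z; right; exists z.
by move=> z z'; split=> [e|[[x [y []]]|[x [y [e <- <-]]]]] //; right; exists z, z'.
Qed.

(** The ends of the new edge are merged vertices, so it does not matter which factor supplies it. *)
Lemma glue_join F K i j :
  graph_iso (soe (glue K (join F i j))) (soe (glue (join K i j) F)).
Proof.
have [ai bi lab meet surj adj] := @glue_is_glue k (join K i j) F.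
pose a : soe K -> glue_graph (join K i j) F := @glue_inl k (join K i j) F.
pose b : soe (join F i j) -> glue_graph (join K i j) F :=
  @glue_inr k (join K i j) F.
apply: (@is_glue_iso k K (join F i j) _ a b); split=> // z z'.
have lab2 x y : x \in [:: label K i; label K j] -> y \in [:: label K i; label K j] ->
    x != y -> exists x' y' : soe F, [/\ x' \in [:: label F i; label F j],
      y' \in [:: label F i; label F j], x' != y',
      b x' = a x
      & b y' = a y].
  have e l : b (label F l) = a (label K l).
    by rewrite /a lab.
  rewrite !inE => /orP[]/eqP-> /orP[]/eqP->; rewrite ?eqxx // => ne.
    exists (label F i), (label F j); rewrite !inE !eqxx ?orbT !e; split=> //.
    by apply: contraNneq ne => /(@label_inj k F)->.
  exists (label F j), (label F i); rewrite !inE !eqxx ?orbT !e; split=> //.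
  by apply: contraNneq ne => /(@label_inj k F)->.
have lab3 x y : x \in [:: label F i; label F j] -> y \in [:: label F i; label F j] ->
    x != y -> exists x' y' : soe K, [/\ x' \in [:: label K i; label K j],
      y' \in [:: label K i; label K j], x' != y',
      b x = a x'
      & b y = a y'].
  have e l : b (label F l) = a (label K l).
    by rewrite /a lab.
  rewrite !inE => /orP[]/eqP-> /orP[]/eqP->; rewrite ?eqxx // => ne.
    exists (label K i), (label K j); rewrite !inE !eqxx ?orbT !e; split=> //.
    by apply: contraNneq ne => /(@label_inj k K)->.
  exists (label K j), (label K i); rewrite !inE !eqxx ?orbT !e; split=> //.
  by apply: contraNneq ne => /(@label_inj k K)->.
split.
  case/adj=> [] [x [y [e <- <-]]]; last first.
    by right; exists x, y; split=> //; apply/orP; left.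
  case/orP: e => [e|/and3P[ne xl yl]]; first by left; exists x, y.
  right; have [x' [y' [x'l y'l ne' ex ey]]] := lab2 x y xl yl ne.
  by exists x', y'; split=> //; apply/orP; right; rewrite ne' x'l.
case=> [] [x [y [e <- <-]]]; apply/adj.
  by left; exists x, y; split=> //; apply/orP; left.
case/orP: e => [e|/and3P[ne xl yl]]; first by right; exists x, y.
left; have [x' [y' [x'l y'l ne' ex ey]]] := lab3 x y xl yl ne.
by exists x', y'; split=> //; apply/orP; right; rewrite ne' x'l.
Qed.

(** In both gluings the i-th labelled vertices of [K] and [F] stay distinct, while all other
    labelled vertices are merged: the new isolated vertex is absorbed by its partner. *)
Lemma glue_fresh F K i :
  graph_iso (soe (glue K (fresh F i))) (soe (glue (fresh K i) F)).
Proof.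
have [ai bi lab meet surj adj] := @glue_is_glue k (fresh K i) F.
pose a (x : soe K) : glue_graph (fresh K i) F :=
  @glue_inl k (fresh K i) F (Some x).
pose b (y : soe (fresh F i)) : glue_graph (fresh K i) F :=
  if y is Some y' then glue_inr (fresh K i) y'
  else a (label K i).
have ab x y : a x = glue_inr (fresh K i) y ->
    exists l, [/\ l != i, x = label K l & y = label F l].
  case/meet=> l; rewrite /= /fresh_label; case: ifP => // /negbT li [xl] yl.
  by exists l.
apply: (@is_glue_iso k K (fresh F i) _ a b); split.
- by move=> x y /ai[].
- move=> [x|] [y|] //=; first by move/bi=> ->.
    by move/esym/ab=> [l [li /(@label_inj k K) il]]; rewrite il eqxx in li.
  by move/ab=> [l [li /(@label_inj k K) il]]; rewrite il eqxx in li.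
- move=> l; rewrite /= /fresh_label; case: eqP => [->//|/eqP li] /=.
  by rewrite -lab /= /fresh_label (negPf li).
- move=> x [y|] /=.
    by case/ab=> l [li xl yl]; exists l => //; rewrite /fresh_label (negPf li) yl.
  by move/ai=> [->]; exists i => //; rewrite /fresh_label eqxx.
- move=> z; case: (surj z) => [[[x|] <-]|[y <-]].
  + by left; exists x.
  + right; exists (Some (label F i)) => /=.
    by rewrite -lab /= /fresh_label eqxx.
  + by right; exists (Some y).
move=> z z'; split.
  case/adj=> [] [x [y [e <- <-]]]; last by right; exists (Some x), (Some y).
  by case: x y e => [x|] [y|] //= e; left; exists x, y.
case=> [] [x [y [e <- <-]]]; apply/adj.
  by left; exists (Some x), (Some y).
by case: x y e => [x|] [y|] //= e; right; exists x, y.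
Qed.

Definition letter := ('I_k * 'I_k + 'I_k)%type.

Definition apply_letter (a : letter) F : dlgraph k :=
  match a with inl (i, j) => join F i j | inr i => fresh F i end.

Definition word_graph (w : seq letter) : dlgraph k := foldr apply_letter discrete w.

Variable C : graph_class.

(** A letter moves across the gluing, so a context [K] for the new graphs is the context
    [apply_letter a K] for the old ones. *)
Lemma class_equiv_letter a F1 F2 :
  class_equiv C F1 F2 -> class_equiv C (apply_letter a F1) (apply_letter a F2).
Proof.
move=> eqF K; case: a => [[i j]|i] /=.
  rewrite (graph_iso_class C (glue_join F1 K i j)).
  by rewrite (graph_iso_class C (glue_join F2 K i j)).
rewrite (graph_iso_class C (glue_fresh F1 K i)).
by rewrite (graph_iso_class C (glue_fresh F2 K i)).
Qed.

Lemma class_equiv_soe F1 F2 : class_equiv C F1 F2 -> C (soe F1) <-> C (soe F2).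
Proof.
move=> /(_ discrete); rewrite (graph_iso_class C (glue_discrete F1)).
by rewrite (graph_iso_class C (glue_discrete F2)).
Qed.

(* The classes of the equivalence are the states of a deterministic automaton
   that reads words from right to left. *)
Lemma recognisable_automaton : recognisable k C ->
  exists (n : nat) (q0 : 'I_n) (delta : letter -> 'I_n -> 'I_n) (acc : pred 'I_n),
  forall w, C (soe (word_graph w)) <-> acc (foldr delta q0 w).
Proof.
move=> [n [r rP]]; pose cls F : 'I_n := projT1 (cid (rP F)).
have clsP F : class_equiv C F (r (cls F)) by rewrite /cls; case: (cid _).
exists n, (cls discrete), (fun a q => cls (apply_letter a (r q))).
exists (fun q => `[< C (soe (r q)) >]) => w.
set q := foldr _ _ w.
suff eqw : class_equiv C (word_graph w) (r q).
  by rewrite (class_equiv_soe eqw); split=> [/asboolP|/asboolP].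
rewrite /q; elim: w {q} => [|a w IH] //= K.
by rewrite (class_equiv_letter a IH K) (clsP _ K).
Qed.

End Operations.

(** * Graphs of bounded pathwidth as word graphs *)

Section Realisation.
Variables (k : nat) (G : sgraph).
Implicit Types (E : rel G) (U : {set G}) (l : 'I_k -> G).

(* Some word graph is isomorphic to (U, E), with the labels at l. *)
Definition realises E U l : Prop :=
  exists (w : seq (letter k)) (phi : soe (word_graph w) -> G),
  [/\ injective phi, forall z, z \in U <-> exists x, phi x = z,
      forall i, phi (label (word_graph w) i) = l i
    & forall x y, edge x y = E (phi x) (phi y)].

Lemma realises_label E U l i : realises E U l -> l i \in U.
Proof. by move=> [w [phi [_ PU <- _]]]; apply/PU; eexists. Qed.

Lemma realises_ext E E' U l : realises E U l ->
  (forall x y, x \in U -> y \in U -> E x y = E' x y) -> realises E' U l.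
Proof.
move=> [w [phi [inj PU lab adj]]] EE'; exists w, phi; split=> // x y.
by rewrite adj EE' //; apply/PU; eexists.
Qed.

Lemma realises_discrete l : injective l ->
  realises (fun _ _ => false) [set l i | i : 'I_k] l.
Proof.
move=> inj; exists [::], l; split=> // z; split; first by case/imsetP=> i _ ->; exists i.
by case=> i <-; apply: imset_f.
Qed.

Lemma realises_join E U l i j : realises E U l ->
  realises (fun x y => E x y ||
    [&& x != y, x \in [:: l i; l j] & y \in [:: l i; l j]]) U l.
Proof.
move=> [w [phi [inj PU lab adj]]]; exists (inl (i, j) :: w), phi; split=> // x y.
rewrite {1}/edge /= /join_edge adj (inj_eq inj).
by rewrite !inE -!lab !(inj_eq inj).
Qed.

Lemma realises_fresh E U l i v : realises E U l -> v \notin U ->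
  realises (fun x y => [&& E x y, x != v & y != v]) (v |: U)
    (fun j => if j == i then v else l j).
Proof.
move=> [w [phi [inj PU lab adj]]] vU; exists (inr i :: w).
exists (fun x : option (soe (word_graph w)) => if x is Some x' then phi x' else v).
have phiv x : phi x != v.
  by apply: contraNneq vU => <-; apply/PU; exists x.
split.
- move=> [x|] [y|] //= => [/inj->//|e|e].
    by have := phiv x; rewrite e eqxx.
  by have := phiv y; rewrite e eqxx.
- move=> z; rewrite !inE; split.
    by case/orP=> [/eqP->|/PU[x <-]]; [exists None|exists (Some x)].
  by case=> [[x|]] /= <-; rewrite ?eqxx // orbC; apply/orP; left; apply/PU; exists x.
- by move=> j; rewrite /= /fresh_label; case: eqP.
move=> [x|] [y|] //=; rewrite ?eqxx ?andbF //.
by transitivity (@edge (soe (word_graph w)) x y); rewrite // adj !phiv !andbT.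
Qed.

(** Every missing edge runs between two labelled vertices, so joining all pairs of labels that are
    adjacent in [G] supplies the missing edges and adds nothing else. *)
Lemma realises_fill E U l : realises E U l ->
  (forall x y, x \in U -> y \in U -> E x y -> edge x y) ->
  (forall x y, x \in U -> y \in U -> edge x y ->
     E x y \/ (exists i j, x = l i /\ y = l j)) ->
  realises (@edge G) U l.
Proof.
move=> rE sub sup.
pose joined (p : 'I_k * 'I_k) (x y : G) :=
  [&& x != y, x \in [:: l p.1; l p.2] & y \in [:: l p.1; l p.2]].
have rj ps : realises (fun x y => E x y || has (fun p => joined p x y) ps) U l.
  elim: ps => [|p ps IH]; first by apply: realises_ext rE _ => *; rewrite orbF.
  apply: realises_ext (realises_join p.1 p.2 IH) _ => x y _ _ /=.
  by rewrite -orbA [has _ _ || _]orbC.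
apply: realises_ext (rj [seq p <- enum predT | edge (l p.1) (l p.2)]) _ => x y xU yU.
apply/idP/idP.
  case/orP=> [/(sub _ _ xU yU)//|/hasP[p]].
  rewrite mem_filter => /andP[e _] /and3P[ne]; rewrite !inE.
  by move=> /orP[]/eqP xe /orP[]/eqP ye; move: ne e; rewrite xe ye ?eqxx // edge_sym.
move=> e; apply/orP; case: (sup _ _ xU yU e) => [|[i [j [xi yj]]]]; [by left|right].
apply/hasP; exists (i, j); first by rewrite mem_filter -xi -yj e mem_enum.
rewrite /joined xi yj !inE !eqxx orbT !andbT.
by apply: contraTneq e => ij; rewrite xi yj ij edge_irr.
Qed.

(* The vertices of a prefix of vs with a neighbour outside of it always carry
   labels, so that a new vertex takes over the label of one without. *)
Lemma layout_realises (vs : seq G) : uniq vs -> 0 < k -> k <= size vs ->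
  (forall j, k <= j < size vs ->
     #|[set u in take j vs | has (edge u) (drop j vs)]| < k) ->
  forall j, k <= j <= size vs -> exists l,
  realises (@edge G) [set u in take j vs] l /\
  forall u, u \in take j vs -> has (edge u) (drop j vs) -> exists i, u = l i.
Proof.
move=> uvs k0 kvs active; elim=> [|j IH] /andP[kj jvs].
  by have := leq_trans k0 kj; rewrite ltnn.
have x0 : G.
  by case: (vs) kvs => [kv|x //]; have := leq_trans k0 kv; rewrite ltnn.
case: (ltnP j k) => [jk|kj'].
  have {jk kj} jE : j.+1 = k by lia.
  rewrite jE in jvs *.
  pose l (i : 'I_k) := nth x0 vs i.
  have linj : injective l.
    move=> i i' /eqP; rewrite /l nth_uniq //; try exact: leq_trans (ltn_ord _) kvs.
    by move/eqP/val_inj.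
  have lU u : u \in take k vs -> exists i, u = l i.
    case/(nthP x0) => i; rewrite size_takel // => ik <-.
    by exists (Ordinal ik); rewrite nth_take.
  exists l; split; last by move=> u /lU.
  have -> : [set u in take k vs] = [set l i | i : 'I_k].
    apply/setP => u; rewrite inE; apply/idP/imsetP => [/lU[i ->]|[i _ ->]].
      by exists i.
    by apply/(nthP x0); exists i; rewrite ?size_takel ?nth_take.
  (* The first k vertices are all labelled, so every edge among them can be joined. *)
  apply: realises_fill (realises_discrete linj) _ _ => // x y.
  case/imsetP=> i _ -> /imsetP[i' _ ->] _; right; by exists i, i'.
have [|l [rl actl]] := IH; first by rewrite kj'; lia.
set v := nth x0 vs j.
have dropE : drop j vs = v :: drop j.+1 vs by rewrite (drop_nth x0).
have takeE : take j.+1 vs = rcons (take j vs) v by rewrite (take_nth x0).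
have vU : v \notin take j vs.
  by move: (take_uniq j.+1 uvs); rewrite takeE rcons_uniq => /andP[].
have linj : injective l.
  have [w [phi [inj _ lab _]]] := rl.
  by move=> i i'; rewrite -!lab => /inj /(@label_inj k _).
(* Fewer than k vertices of the prefix have a later neighbour and [l] is injective, so some label
   sits on a vertex without one and can be moved. *)
have [i iP] : exists i, ~~ has (edge (l i)) (drop j vs).
  apply/existsP; rewrite -negb_forall; apply/negP => /forallP all_act.
  have := active j; rewrite kj' jvs => /(_ isT); rewrite ltnNge => /negP; apply.
  rewrite -[X in X <= _]card_ord -(card_imset predT linj); apply: subset_leq_card.
  apply/subsetP => _ /imsetP[i _ ->]; rewrite inE all_act andbT.
  by have := realises_label i rl; rewrite inE.
exists (fun j => if j == i then v else l j); split.
  have rf := @realises_fresh _ _ _ i v rl; rewrite inE in rf.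
  have -> : [set u in take j.+1 vs] = v |: [set u in take j vs].
    by apply/setP => u; rewrite takeE !inE mem_rcons inE.
  apply: realises_fill (rf vU) _ _ => [x y _ _ /and3P[]//|x y].
  (* A neighbour z of v in the prefix has a later neighbour, namely v. So it is labelled, and not by
     i, whose vertex has no later neighbour. *)
  have back z : z \in take j vs -> edge z v -> exists i', z = if i' == i then v else l i'.
    move=> zU e; have [|i' zi'] := actl z zU; first by rewrite dropE /= e.
    exists i'; case: eqP zi' => // -> zi; case/negP: iP.
    by rewrite -zi dropE /= e.
  rewrite !inE => /orP[/eqP->|xU] /orP[/eqP->|yU]; first by rewrite edge_irr.
  - move=> e; right; have [|i' yi'] := back _ yU; first by rewrite edge_sym.
    by exists i, i'; rewrite eqxx.
  - move=> e; right; have [//|i' xi'] := back _ xU.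
    by exists i', i; rewrite eqxx.
  move=> -> /=; left; apply/andP; split.
    by apply: contraNneq vU => <-.
  by apply: contraNneq vU => <-.
move=> u; rewrite takeE mem_rcons inE => /orP[/eqP-> _|uU act]; first by exists i; rewrite eqxx.
have [|i' ui'] := actl u uU; first by rewrite dropE /= act orbT.
exists i'; case: eqP ui' => // -> ui; case/negP: iP.
by rewrite -ui dropE /= act orbT.
Qed.

(** Since k is positive, the truncation in [decomp_width] is harmless: a maximum M with
    [M.-1 <= k - 1] satisfies [M <= k]. *)
Lemma pathwidth_decomp : 0 < k -> pathwidth G <= k - 1 ->
  exists2 s : seq {set G}, is_path_decomp s & forall B, B \in s -> #|B| <= k.
Proof.
move=> k0; rewrite /pathwidth; case: ex_minnP => m /asboolP[s sP <-] _ wd.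
exists s => // B Bs; have : #|B| <= \max_(B <- s) #|B| by apply: leq_bigmax_seq.
by move: wd; rewrite /decomp_width; lia.
Qed.

(** The vertex separation bound. Vertices are ordered by their first bag. If u precedes v and has a
    neighbour at or after v, some bag at or after the first bag of v contains u, so by the interval
    property that first bag contains u too. One of its at most k places is taken by v itself, which
    makes the bound strict. *)
Lemma decomp_layout (s : seq {set G}) :
  is_path_decomp s -> (forall B, B \in s -> #|B| <= k) ->
  exists vs : seq G, [/\ uniq vs, forall x, x \in vs
    & forall j, j < size vs ->
      #|[set u in take j vs | has (edge u) (drop j vs)]| < k].
Proof.
move=> [cov ecov intv] sz_bag.
pose p (x : G) := find (fun B : {set G} => x \in B) s.
have hasp x : has (fun B : {set G} => x \in B) s by have [B Bs xB] := cov x; apply/hasP; exists B.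
have p_lt x : p x < size s by rewrite /p -has_find.
have in_p x : x \in nth set0 s (p x) := nth_find set0 (hasp x).
have p_le x q : q < size s -> x \in nth set0 s q -> p x <= q.
  move=> qs xq; rewrite leqNgt; apply/negP => /(before_find set0).
  by rewrite /= xq.
pose r := relpre p leq.
have r_tot : total r by move=> x y; apply: leq_total.
have r_tr : transitive r by move=> x y z; apply: leq_trans.
exists (sort r (enum G)); split.
- by rewrite sort_uniq enum_uniq.
- by move=> x; rewrite mem_sort mem_enum.
set vs := sort r _ => j jvs; have so : sorted r vs by apply: sort_sorted.
have x0 : G by case: (vs) jvs => // x.
set v := nth x0 vs j.
have dropE : drop j vs = v :: drop j.+1 vs by rewrite (drop_nth x0).
have uvs : uniq vs by rewrite sort_uniq enum_uniq.
have ple i i' : i <= i' -> i' < size vs -> p (nth x0 vs i) <= p (nth x0 vs i').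
  move=> ii' i's; apply: (sorted_leq_nth r_tr _ x0 so) => //; rewrite ?inE //.
    by move=> x; apply: leqnn.
  exact: leq_ltn_trans i's.
apply: leq_trans (sz_bag (nth set0 s (p v)) (mem_nth _ (p_lt v))).
rewrite (cardsD1 v (nth _ _ _)) in_p add1n ltnS; apply: subset_leq_card.
apply/subsetP => u; rewrite !inE => /andP[ut].
have [i ij ui] : exists2 i, i < j & u = nth x0 vs i.
  case/(nthP x0): ut => i; rewrite size_takel ?(ltnW jvs) // => ij <-.
  by exists i; rewrite ?nth_take.
case/hasP=> v' /(nthP x0)[m]; rewrite size_drop nth_drop => mj v'E e.
have pv : p v <= p v' by rewrite -v'E; apply: (ple j (j + m)); rewrite ?leq_addr -?ltn_subRL.
have pu : p u <= p v by rewrite ui; apply: (ple i j) => //; apply: ltnW.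
have [B Bs /andP[uB v'B]] := ecov _ _ e.
have [q qs Bq] := nthP set0 Bs; rewrite -Bq in uB v'B.
have v'q := p_le _ _ qs v'B.
apply/andP; split; first by rewrite ui /v nth_uniq //; lia.
apply: (subsetP (intv (p u) (p v) q _ qs)); last by rewrite inE in_p.
by rewrite pu; lia.
Qed.

Lemma pathwidth_word : 0 < k -> pathwidth G <= k - 1 -> k <= #|G| ->
  exists w : seq (letter k), graph_iso (soe (word_graph w)) G.
Proof.
move=> k0 pw kG; have [s sP bag] := pathwidth_decomp k0 pw.
have [vs [uvs allvs act]] := decomp_layout sP bag.
have szvs : size vs = #|G|.
  by rewrite cardE; apply: perm_size; apply: uniq_perm => //;
     [apply: enum_uniq | move=> x; rewrite allvs mem_enum].
have kvs : k <= size vs by rewrite szvs.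
have act' j : k <= j < size vs -> _ := fun jP => act j (proj2 (andP jP)).
have [|l [[w [phi [inj PU _ adj]]] _]] :=
  layout_realises uvs k0 kvs act' (j := size vs).
  by rewrite kvs leqnn.
exists w, phi; last by move=> x y; rewrite adj.
apply: inj_surj_bij inj _ => z; apply/PU.
by rewrite inE take_size allvs.
Qed.

End Realisation.

(** * Homomorphism counts *)

Section Digits.
Variable b : nat.

Definition digit (j v : nat) : nat := v %/ b ^ j %% b.

Fixpoint encode (k : nat) (c : nat -> nat) : nat :=
  if k is k'.+1 then c 0 + b * encode k' (c \o succn) else 0.

Lemma digitS j v : digit j.+1 v = digit j (v %/ b).
Proof. by rewrite /digit expnS divnMA. Qed.

Lemma encode_lt k c : (forall j, j < k -> c j < b) -> encode k c < b ^ k.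
Proof.
elim: k c => [|k IH] c cb //=.
have c0 := cb 0 isT; have := IH (c \o succn) (fun j jk => cb j.+1 jk).
rewrite expnS => lt; apply: leq_trans (_ : b * (encode k (c \o succn)).+1 <= _).
  by rewrite mulnS ltn_add2r.
by rewrite leq_mul2l lt orbT.
Qed.

Lemma digit_encode k c j : (forall j, j < k -> c j < b) -> j < k ->
  digit j (encode k c) = c j.
Proof.
elim: k c j => [|k IH] c j cb //.
have c0 := cb 0 isT; have b0 : 0 < b by apply: leq_ltn_trans c0.
case: j => [|j] jk /=; first by rewrite /digit divn1 mulnC addnC modnMDl modn_small.
rewrite digitS mulnC addnC divnMDl // divn_small // addn0.
by rewrite IH // => i ik; apply: cb.
Qed.

Lemma digit_inj k u v : u < b ^ k -> v < b ^ k ->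
  (forall j, j < k -> digit j u = digit j v) -> u = v.
Proof.
elim: k u v => [|k IH] u v; first by rewrite !ltnS !leqn0 => /eqP-> /eqP->.
rewrite expnS => ub vb uv.
have b0 : 0 < b by case: (b) ub => //; rewrite mul0n.
have q : u %/ b = v %/ b.
  by apply: IH; rewrite ?ltn_divLR ?[_ * b]mulnC // => j jk; rewrite -!digitS uv.
have r := uv 0 isT; rewrite /digit !divn1 in r.
by rewrite (divn_eq u b) (divn_eq v b) q r.
Qed.

(** Exactly one code below [b ^ k] has prescribed digits, so a sum against this indicator picks out
    one value of [A]. *)
Lemma sum_encode k (c : 'I_k -> nat) (A : nat -> nat) :
  (forall j, c j < b) ->
  exists e, [/\ e < b ^ k, forall j : 'I_k, digit j e = c j &
    \sum_(v < b ^ k) [forall j : 'I_k, c j == digit j v] * A v = A e].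
Proof.
move=> cb; pose c' (i : nat) := if insub i is Some j then c j else 0.
have c'E (j : 'I_k) : c' j = c j by rewrite /c' valK.
have c'b j : j < k -> c' j < b by move=> jk; rewrite (c'E (Ordinal jk)).
have eb := encode_lt c'b.
have eE (j : 'I_k) : digit j (encode k c') = c j by rewrite digit_encode.
exists (encode k c'); split=> //.
rewrite (bigD1 (Ordinal eb)) //= big1 ?addn0.
  have -> : [forall j : 'I_k, c j == digit j (encode k c')].
    by apply/forallP => j; rewrite eE.
  by rewrite mul1n.
move=> v; apply: contraNeq; rewrite muln_eq0 negb_or eqb0 negbK => /andP[/forallP vc _].
apply/eqP/val_inj/(@digit_inj k) => //= j jk.
by rewrite -(eqP (vc (Ordinal jk))) (eE (Ordinal jk)).
Qed.

End Digits.

(** Vertices are named by their enumeration ranks, as in the encoding read by the machine; numbers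
    out of range are adjacent to nothing. *)
Definition adjacent (G : sgraph) (x y : nat) : bool :=
  [exists a : G, [exists c : G,
    [&& enum_rank a == x :> nat, enum_rank c == y :> nat & edge a c]]].

Lemma adjacent_rank (G : sgraph) (a c : G) :
  adjacent G (enum_rank a) (enum_rank c) = edge a c.
Proof.
apply/existsP/idP => [[a' /existsP[c' /and3P[]]]|e].
  by rewrite !(inj_eq val_inj) !(inj_eq enum_rank_inj) => /eqP-> /eqP->.
by exists a; apply/existsP; exists c; rewrite !eqxx.
Qed.

Lemma sum_rank (G : sgraph) d :
  \sum_(x : G) (enum_rank x == d :> nat) = (d < #|G|).
Proof.
case: ltnP => dG; last first.
  rewrite big1 // => x _; case: eqP => // xd; move: (ltn_ord (enum_rank x)).
  by rewrite xd ltnNge dG.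
rewrite (bigD1 (enum_val (Ordinal dG))) //= enum_valK eqxx big1 // => x.
move=> xd; case: eqP => // e; case/eqP: xd; apply: enum_rank_inj.
by rewrite enum_valK; apply: val_inj.
Qed.

Section HomCounts.
Variables (k b : nat) (G : sgraph).
Hypothesis Gb : #|G| <= b.
Implicit Types F : dlgraph k.

Let dig := digit b.

(* Homomorphisms sending the vertex labelled i to the vertex of G whose rank is
   the i-th base b digit of u. *)
Definition hom_code F (u : nat) : nat :=
  \sum_(f : {ffun soe F -> G})
    is_hom f * [forall i, enum_rank (f (label F i)) == dig i u :> nat].

Lemma rank_lt (x : G) : enum_rank x < b.
Proof. exact: leq_trans (ltn_ord _) Gb. Qed.

(** Each [f] is counted by a single code u, that of its values at the labels, so the weight [A] may
    be evaluated there. *)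
Lemma sum_hom_code F (A : nat -> nat) (B : {ffun soe F -> G} -> nat) :
  (forall (f : {ffun soe F -> G}) e,
     (forall i : 'I_k, dig i e = enum_rank (f (label F i))) -> A e = B f) ->
  \sum_(u < b ^ k) A u * hom_code F u =
  \sum_(f : {ffun soe F -> G}) is_hom f * B f.
Proof.
move=> AB; under eq_bigr do rewrite /hom_code big_distrr /=.
rewrite exchange_big; apply: eq_bigr => f _ /=.
have [e [_ eE sE]] := @sum_encode b k (fun i => enum_rank (f (label F i))) A
  (fun i => rank_lt _).
rewrite -(AB f e eE) -sE big_distrr; apply: eq_bigr => u _ /=.
by rewrite mulnCA [A u * _]mulnC.
Qed.

Lemma hom_code_sum F : \sum_(u < b ^ k) hom_code F u = hom (soe F) G.
Proof.
transitivity (\sum_(f : {ffun soe F -> G}) is_hom f * 1).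
  rewrite -(@sum_hom_code F (fun _ => 1)) //.
  by apply: eq_bigr => u _; rewrite mul1n.
rewrite /hom -sum1_card [RHS]big_mkcond; apply: eq_bigr => f _.
by rewrite inE muln1; case: is_hom.
Qed.

Lemma is_homP (F H : sgraph) (f : {ffun F -> H}) :
  reflect (forall x y, edge x y -> edge (f x) (f y)) (is_hom f).
Proof.
apply: (iffP forallP) => [h x y e|h x]; first by have /forallP/(_ y)/implyP := h x; apply.
by apply/forallP => y; apply/implyP; apply: h.
Qed.

(** If every vertex is labelled, u leaves one candidate map at most, and the count is 0 or 1. This
    covers both the empty word and the graphs with fewer than k vertices. *)
Lemma hom_code_labelled F u : (forall x, exists i, label F i = x) ->
  hom_code F u = [forall i : 'I_k, dig i u < #|G|] *
    [forall i, [forall j, edge (label F i) (label F j) ==>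
                          adjacent G (dig i u) (dig j u)]].
Proof.
move=> lab; have labb x : exists i, label F i == x.
  by have [i <-] := lab x; exists i.
pose num x := xchoose (labb x).
have numK x : label F (num x) = x by apply/eqP/(xchooseP (labb x)).
have labK i : num (label F i) = i by apply: (@label_inj k F); rewrite numK.
rewrite /hom_code; case: (boolP [forall i : 'I_k, dig i u < _]) => [/forallP lt|nlt];
  last first.
  rewrite big1 // => f _; case: forallP => [fE|_]; last by rewrite muln0.
  by case/forallP: nlt => i; rewrite -(eqP (fE i)) ltn_ord.
pose f0 : {ffun soe F -> G} := [ffun x => enum_val (Ordinal (lt (num x)))].
have f0E i : enum_rank (f0 (label F i)) = dig i u :> nat.
  by rewrite ffunE enum_valK /= labK.
rewrite (bigD1 f0) //= big1 ?addn0 => [|f ff0].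
  have -> : [forall i, enum_rank (f0 (label F i)) == dig i u :> nat].
    by apply/forallP => i; rewrite f0E.
  rewrite muln1 mul1n; congr nat_of_bool; apply/is_homP/forallP => [h i|h x y e].
    apply/forallP => j; apply/implyP => e.
    by rewrite -!f0E adjacent_rank; apply: h.
  rewrite -adjacent_rank -(numK x) -(numK y) !f0E.
  by have /forallP/(_ (num y))/implyP := h (num x); apply; rewrite !numK.
case: forallP => [fE|_]; last by rewrite muln0.
case/eqP: ff0; apply/ffunP => x; apply: enum_rank_inj; apply: val_inj.
by rewrite /= -(numK x) f0E (eqP (fE _)).
Qed.

Lemma hom_code_discrete u :
  hom_code (discrete k) u = [forall i : 'I_k, dig i u < #|G|].
Proof.
rewrite hom_code_labelled => [|x]; last by exists x.
have -> : [forall i, [forall j, edge (label (discrete k) i) (label (discrete k) j)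
    ==> adjacent G (dig i u) (dig j u)]] by apply/forallP => i; apply/forallP.
by rewrite muln1.
Qed.

Lemma hom_code_join F i j u :
  hom_code (join F i j) u =
  ((i == j) || adjacent G (dig i u) (dig j u)) * hom_code F u.
Proof.
rewrite /hom_code big_distrr; apply: eq_bigr => f _ /=.
case: forallP => [fE|_]; last by rewrite !muln0.
rewrite -(eqP (fE i)) -(eqP (fE j)) adjacent_rank !muln1 mulnb.
congr nat_of_bool; apply/is_homP/andP => [h|[ij /is_homP h] x y].
  split; last by apply/is_homP => x y e; apply: h; rewrite /edge /= /join_edge e.
  case: eqP => //= /eqP ij; apply: h; rewrite /edge /= /join_edge !inE !eqxx orbT !andbT.
  by rewrite (inj_eq (@label_inj k F)) ij orbT.
case/orP=> [/h//|/and3P[ne]]; rewrite !inE.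
move=> /orP[]/eqP xe /orP[]/eqP ye; move: ne; rewrite xe ye ?eqxx //.
  by rewrite (inj_eq (@label_inj k F)); move: ij => /orP[->//|].
by rewrite (inj_eq (@label_inj k F)) eq_sym edge_sym; move: ij => /orP[->//|].
Qed.

(** The new vertex is isolated, so digit i of u only has to name a vertex. The vertex that lost the
    label is free, hence the sum over all v that agree with u away from i. *)
Lemma hom_code_fresh F i u :
  hom_code (fresh F i) u = (dig i u < #|G|) *
  \sum_(v < b ^ k) [forall l : 'I_k, (l != i) ==> (dig l u == dig l v)] * hom_code F v.
Proof.
rewrite (@sum_hom_code F
  (fun v => [forall l : 'I_k, (l != i) ==> (dig l u == dig l v)])
  (fun f => [forall l : 'I_k, (l != i) ==> (dig l u == enum_rank (f (label F l)))]));
  last first.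
  by move=> f e eE; congr nat_of_bool; apply: eq_forallb => l; rewrite eE.
rewrite -sum_rank big_distrl /=.
under eq_bigr do rewrite big_distrr /=.
rewrite pair_big /= /hom_code.
(* A map on the fresh graph is a map on [F] together with an image of the new vertex. *)
pose mk (p : G * {ffun soe F -> G}) : {ffun soe (fresh F i) -> G} :=
  [ffun x : option (soe F) => if x is Some y then p.2 y else p.1].
rewrite (reindex mk); last first.
  exists (fun f : {ffun soe (fresh F i) -> G} => (f None, [ffun y => f (Some y)])).
    move=> [x g] _ /=; congr pair; first by rewrite ffunE.
    by apply/ffunP => y; rewrite !ffunE.
  by move=> f _; apply/ffunP => -[y|]; rewrite !ffunE.
apply: eq_bigr => -[x g] _ /=.
have -> : is_hom (mk (x, g)) = is_hom g.
  apply/is_homP/is_homP => h.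
    by move=> y z e; have := h (Some y) (Some z) e; rewrite !ffunE.
  by move=> [y|] [z|] //= e; rewrite !ffunE; apply: h.
rewrite mulnCA; congr (_ * _); rewrite mulnb; congr nat_of_bool.
apply/forallP/andP => [h|[hx /forallP h] l].
  split; first by have := h i; rewrite ffunE /= /fresh_label eqxx.
  apply/forallP => l; apply/implyP => li; have := h l.
  by rewrite ffunE /= /fresh_label (negPf li) eq_sym.
rewrite ffunE /= /fresh_label; case: (l =P i) => [->//|/eqP li].
by have := h l; rewrite li eq_sym.
Qed.

End HomCounts.

(** The target graph enters only through its order [n] and an adjacency relation [A] on numbers, so
    that the same formula applies to data parsed from the input. *)
Definition letter_entry (k b n : nat) (A : nat -> nat -> bool) (a : letter k)
    (u v : nat) : nat :=
  match a with
  | inl (i, j) => (u == v) * ((i == j) || A (digit b i u) (digit b j u))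
  | inr i => (digit b i u < n) *
      [forall l : 'I_k, (l != i) ==> (digit b l u == digit b l v)]
  end.

Lemma hom_code_letter (k b : nat) (G : sgraph) (F : dlgraph k) a u :
  #|G| <= b -> u < b ^ k ->
  hom_code b G (apply_letter a F) u =
  \sum_(v < b ^ k) letter_entry b #|G| (adjacent G) a u v * hom_code b G F v.
Proof.
move=> Gb ub; case: a => [[i j]|i] /=.
  rewrite hom_code_join // (bigD1 (Ordinal ub)) //= eqxx mul1n big1 ?addn0 // => v.
  by rewrite -(inj_eq val_inj) eq_sym /= => /negPf ->.
rewrite hom_code_fresh // big_distrr; apply: eq_bigr => v _ /=.
by rewrite mulnA.
Qed.

(** * The transfer matrix *)

Section LinearRecurrence.
Import GRing.Theory.
Local Open Scope ring_scope.

(* By Cayley-Hamilton the sequence satisfies a linear recurrence of order m. *)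
Lemma transfer_eq0 (R : idomainType) (m : nat) (T : 'M[R]_m.+1)
    (r : 'rV[R]_m.+1) (x : 'cV[R]_m.+1) :
  (forall t, (t < m.+1)%N -> r *m T ^+ t *m x = 0) ->
  forall t, r *m T ^+ t *m x = 0.
Proof.
move=> small t; have [n] := ubnP t; elim: n t => // n IH t le_t.
case: (ltnP t m.+1) => [/small//|mt].
have := Cayley_Hamilton T; set p := char_poly T => pT.
have szp : size p = m.+2 by rewrite size_char_poly.
have := congr1 (fun A => r *m (A * T ^+ (t - m.+1)) *m x) pT.
rewrite mul0r mulmx0 mul0mx -[p]coefK poly_def szp raddf_sum /= big_distrl /=.
(* The characteristic polynomial is monic: the top term is the wanted one, and all others have
   exponents below t and vanish by induction. *)
rewrite mulmx_sumr mulmx_suml big_ord_recr /= big1 => [|i _].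
  have -> : p`_m.+1 = 1.
    by have /monicP := char_poly_monic T; rewrite lead_coefE size_char_poly.
  by rewrite scale1r rmorphXn /= horner_mx_X add0r -exprD subnKC.
rewrite linearZ /= rmorphXn /= horner_mx_X -scalerAl -exprD -scalemxAr -scalemxAl.
by rewrite IH ?scaler0 //; have := ltn_ord i; lia.
Qed.

(** An equality of two natural sums is the vanishing of the linear form with coefficients [f - g];
    this needs signs, hence the passage to rational matrices. *)
Lemma transfer_nat_eq (C : nat) (T : nat -> nat -> nat) (W : nat -> nat -> nat)
    (f g : nat -> nat) :
  (forall t c, (c < C)%N -> W t.+1 c = (\sum_(d < C) T c d * W t d)%N) ->
  (forall t, (t < C)%N ->
     (\sum_(c < C) f c * W t c = \sum_(c < C) g c * W t c)%N) ->
  forall t, (\sum_(c < C) f c * W t c = \sum_(c < C) g c * W t c)%N.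
Proof.
case: C => [|m] WS small t; first by rewrite !big_ord0.
pose M : 'M[rat]_m.+1 := \matrix_(i, j) (T i j)%:R.
pose x t : 'cV[rat]_m.+1 := \col_i (W t i)%:R.
pose r : 'rV[rat]_m.+1 := \row_i ((f i)%:R - (g i)%:R).
have xE t' : M ^+ t' *m x 0%N = x t'.
  elim: t' => [|t' IH]; first by rewrite expr0 mul1mx.
  rewrite exprS -mulmxA IH; apply/colP => i; rewrite !mxE WS // natr_sum.
  by apply: eq_bigr => j _; rewrite !mxE natrM.
have rE t' : (r *m M ^+ t' *m x 0%N == 0) =
    (\sum_(c < m.+1) f c * W t' c == \sum_(c < m.+1) g c * W t' c)%N.
  have -> : r *m M ^+ t' *m x 0%N =
    ((\sum_(c < m.+1) f c * W t' c)%N%:R - (\sum_(c < m.+1) g c * W t' c)%N%:R)%:M.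
    rewrite -mulmxA xE; apply/matrixP => i j; rewrite !ord1 !mxE eqxx mulr1n.
    rewrite !natr_sum -sumrB; apply: eq_bigr => c _.
    by rewrite !mxE !natrM mulrBl.
  rewrite -[_ == _ :> nat](@Num.Theory.eqr_nat rat) -[RHS]subr_eq0.
  apply/eqP/eqP => [/matrixP/(_ 0 0)|->]; last by rewrite raddf0.
  by rewrite !mxE mulr1n.
by apply/eqP; rewrite -rE; apply/eqP; apply: transfer_eq0 => t' /small/eqP;
  rewrite -rE => /eqP.
Qed.

End LinearRecurrence.

Lemma sum_divmod b m (f : nat -> nat -> nat) :
  \sum_(c < b * m) f (c %% b) (c %/ b) = \sum_(i < b) \sum_(j < m) f i j.
Proof.
case: b => [|b]; first by rewrite mul0n !big_ord0.
elim: m => [|m IH].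
  by rewrite muln0 big_ord0 big1 // => i _; rewrite big_ord0.
under [RHS]eq_bigr do rewrite big_ord_recr /=.
rewrite big_split /= -IH mulnS addnC big_split_ord /=; congr (_ + _).
apply: eq_bigr => i _.
by rewrite mulnC modnMDl modn_small // divnMDl // divn_small // addn0.
Qed.

Lemma sum_digits b (f : nat -> nat -> nat -> nat -> nat -> nat) :
  \sum_(c < b ^ 5)
    f (digit b 0 c) (digit b 1 c) (digit b 2 c) (digit b 3 c) (digit b 4 c) =
  \sum_(q < b) \sum_(s < b) \sum_(s' < b) \sum_(u < b) \sum_(v < b) f q s s' u v.
Proof.
rewrite expnS.
under eq_bigr do rewrite !digitS /digit !divn1.
rewrite (@sum_divmod b (b ^ 4)
  (fun q c => f q (c %% b) (c %/ b %% b) (c %/ b %/ b %% b) (c %/ b %/ b %/ b %% b))).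
apply: eq_bigr => q _; rewrite expnS.
rewrite (@sum_divmod b (b ^ 3)
  (fun s c => f q s (c %% b) (c %/ b %% b) (c %/ b %/ b %% b))).
apply: eq_bigr => s _; rewrite expnS.
rewrite (@sum_divmod b (b ^ 2) (fun s' c => f q s s' (c %% b) (c %/ b %% b))).
apply: eq_bigr => s' _; rewrite (@sum_divmod b b (fun u c => f q s s' u (c %% b))).
by apply: eq_bigr => u _; apply: eq_bigr => v _; rewrite modn_small.
Qed.

Lemma sum_eq b x (xb : x < b) (B : 'I_b -> nat) :
  \sum_(i < b) (x == i) * B i = B (Ordinal xb).
Proof.
rewrite (bigD1 (Ordinal xb)) //= eqxx mul1n big1 ?addn0 // => i.
by rewrite -(inj_eq val_inj) eq_sym /= => /negPf->.
Qed.

(** * Walks of the transfer matrix as sums over words *)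

Section Transfer.
Variables (k b n : nat) (q0 : 'I_n) (delta : letter k -> 'I_n -> 'I_n) (acc : pred 'I_n).
Variables (N : nat -> nat) (A : nat -> nat -> nat -> bool).

Let D := b ^ k.
Notation dig := (digit D).

(** The entry of the transition matrix from q' to q. The sum over p makes sense of numbers that name
    no state: for them the entry is 0. *)
Definition state_entry (a : letter k) (q q' : nat) : nat :=
  \sum_(p : 'I_n) (p == q' :> nat) * (q == delta a p :> nat).

(* The base D digits of a code are a state of the automaton, the indices (0 or 1)
   of two of the input graphs, and codes of labellings in these two graphs. *)
Definition transfer_letter (a : letter k) (c d : nat) : nat :=
  (dig 1 c == dig 1 d) * ((dig 2 c == dig 2 d) * ((dig 1 c < 2) * ((dig 2 c < 2) *
  (state_entry a (dig 0 c) (dig 0 d) *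
  (letter_entry b (N (dig 1 c)) (A (dig 1 c)) a (dig 3 c) (dig 3 d) *
  letter_entry b (N (dig 2 c)) (A (dig 2 c)) a (dig 4 c) (dig 4 d)))))).

Definition transfer (c d : nat) : nat := \sum_(a : letter k) transfer_letter a c d.

Definition initial (c : nat) : nat :=
  (dig 1 c < 2) * ((dig 2 c < 2) * ((q0 == dig 0 c :> nat) *
  ([forall i : 'I_k, digit b i (dig 3 c) < N (dig 1 c)] *
   [forall i : 'I_k, digit b i (dig 4 c) < N (dig 2 c)]))).

Fixpoint walks (t c : nat) : nat :=
  if t is t'.+1 then \sum_(d < D ^ 5) transfer c d * walks t' d else initial c.

Definition accepting (q : nat) : nat := \sum_(p : 'I_n) acc p * (p == q :> nat).

(** With g and h the counts into the two graphs, [same] collects the terms g^2 + h^2 of the expanded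
    square (g - h)^2 and [diff] the mixed terms 2gh. *)
Definition same (c : nat) : nat := accepting (dig 0 c) * (dig 1 c == dig 2 c).
Definition diff (c : nat) : nat := accepting (dig 0 c) * (dig 1 c != dig 2 c).

(** The states and the graph indices 0 and 1 have to fit into one digit in base [D]. *)
Hypotheses (nD : n <= D) (D2 : 1 < D).
Variable gr : nat -> sgraph.
Hypothesis N_gr : forall s, s < 2 -> N s = #|gr s|.
Hypothesis A_gr : forall s, s < 2 -> forall x y, A s x y = adjacent (gr s) x y.
Hypothesis N_b : forall s, s < 2 -> N s <= b.

Definition run (w : seq (letter k)) : 'I_n := foldr delta q0 w.
Notation hc s w u := (hom_code b (gr s) (word_graph w) u).

Definition walk_word (w : seq (letter k)) (c : nat) : nat :=
  (dig 1 c < 2) * ((dig 2 c < 2) * ((run w == dig 0 c :> nat) *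
  (hc (dig 1 c) w (dig 3 c) * hc (dig 2 c) w (dig 4 c)))).

Lemma dig_lt j c : dig j c < D.
Proof. by rewrite ltn_mod (ltnW D2). Qed.

Lemma run_lt w : run w < D.
Proof. exact: leq_trans (ltn_ord _) nD. Qed.

Lemma letter_entry_gr s (a : letter k) u v : s < 2 ->
  letter_entry b (N s) (A s) a u v = letter_entry b #|gr s| (adjacent (gr s)) a u v.
Proof. by move=> s2; rewrite /letter_entry -N_gr // ; case: a => [[i j]|i] //; rewrite A_gr. Qed.

Lemma state_entry_run a q w :
  state_entry a q (run w) = (q == delta a (run w) :> nat).
Proof.
rewrite /state_entry (bigD1 (run w)) //= eqxx mul1n big1 ?addn0 // => p.
by rewrite -(inj_eq val_inj) => /negPf ->.
Qed.

(** The matrix of a letter is a Kronecker product of five factors: identities on the two graph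
    indices, the transition matrix, and the letter matrices of the two graphs. The sum over codes
    therefore factors. *)
Lemma walk_word_cons a w c :
  walk_word (a :: w) c = \sum_(d < D ^ 5) transfer_letter a c d * walk_word w d.
Proof.
rewrite /transfer_letter /walk_word.
rewrite (@sum_digits D (fun q s s' u v =>
  (dig 1 c == s) * ((dig 2 c == s') * ((dig 1 c < 2) * ((dig 2 c < 2) *
  (state_entry a (dig 0 c) q *
  (letter_entry b (N (dig 1 c)) (A (dig 1 c)) a (dig 3 c) u *
   letter_entry b (N (dig 2 c)) (A (dig 2 c)) a (dig 4 c) v)))))
  * ((s < 2) * ((s' < 2) * ((run w == q :> nat) * (hc s w u * hc s' w v)))))).
case: (boolP (dig 1 c < 2)) => s2; last first.
  rewrite mul0n big1 // => q _; rewrite big1 // => s _; rewrite big1 // => s' _.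
  by rewrite big1 // => u _; rewrite big1 // => v _; rewrite !(muln0, mul0n).
case: (boolP (dig 2 c < 2)) => s2'; last first.
  rewrite mul0n big1 // => q _; rewrite big1 // => s _; rewrite big1 // => s' _.
  by rewrite big1 // => u _; rewrite big1 // => v _; rewrite !(muln0, mul0n).
pose e1 := letter_entry b (N (dig 1 c)) (A (dig 1 c)) a (dig 3 c).
pose e2 := letter_entry b (N (dig 2 c)) (A (dig 2 c)) a (dig 4 c).
transitivity (\sum_(q < D) (run w == q :> nat) * (state_entry a (dig 0 c) q *
  ((\sum_(u < D) e1 u * hc (dig 1 c) w u) * (\sum_(v < D) e2 v * hc (dig 2 c) w v)))).
  rewrite (sum_eq (run_lt w)) /= state_entry_run !mul1n.
  rewrite [dig 0 c == _]eq_sym; congr (_ * _).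
  rewrite /= !hom_code_letter ?dig_lt -?N_gr ?N_b //.
  by congr (_ * _); apply: eq_bigr => u _; rewrite /e1 /e2 letter_entry_gr // N_gr.
apply: eq_bigr => q _.
transitivity (\sum_(s < D) (dig 1 c == s) * \sum_(s' < D) (dig 2 c == s') *
  \sum_(u < D) \sum_(v < D) (s < 2) * ((s' < 2) * ((run w == q :> nat) *
    (state_entry a (dig 0 c) q * ((e1 u * hc s w u) * (e2 v * hc s' w v)))))).
  rewrite (sum_eq (dig_lt 1 c)) (sum_eq (dig_lt 2 c)) /= s2 s2'.
  rewrite big_distrlr !big_distrr /=; apply: eq_bigr => u _.
  rewrite !big_distrr /=; apply: eq_bigr => v _.
  by rewrite !mul1n.
apply: eq_bigr => s _; rewrite big_distrr; apply: eq_bigr => s' _ /=.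
rewrite mulnA big_distrr; apply: eq_bigr => u _ /=; rewrite big_distrr.
apply: eq_bigr => v _ /=; rewrite -/(e1 u) -/(e2 v); ring.
Qed.

Fixpoint words (t : nat) : seq (seq (letter k)) :=
  if t is t'.+1 then [seq a :: w | a <- enum predT, w <- words t'] else [:: [::]].

Lemma mem_words w : w \in words (size w).
Proof.
elim: w => [|a w IH] //=; apply/allpairsP; exists (a, w).
by rewrite /= mem_enum; split.
Qed.

Lemma walks_words t c : walks t c = \sum_(w <- words t) walk_word w c.
Proof.
elim: t c => [|t IH] c /=.
  rewrite big_seq1 /walk_word /initial /run /=.
  case: (boolP (dig 1 c < 2)) => // s2; case: (boolP (dig 2 c < 2)) => // s2'.
  by rewrite !hom_code_discrete -?N_gr // N_b.
rewrite big_allpairs_dep /= big_enum /=.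
under eq_bigr => d _ do rewrite IH big_distrl /=.
rewrite exchange_big; apply: eq_bigr => a _ /=.
under [RHS]eq_bigr => w _ do rewrite walk_word_cons.
rewrite [RHS]exchange_big; apply: eq_bigr => d _ /=.
by rewrite big_distrr.
Qed.

Notation hom_word s w := (hom (soe (word_graph w)) (gr s)).

Lemma accepting_run w : accepting (run w) = acc (run w).
Proof.
rewrite /accepting (bigD1 (run w)) //= eqxx muln1 big1 ?addn0 // => p.
by rewrite -(inj_eq val_inj) => /negPf ->; rewrite muln0.
Qed.

(** Common form of [same] and [diff], with [h] the indicator of equal or distinct graph indices.
    Summing over the labellings turns labelled counts into plain homomorphism counts. *)
Lemma sum_walk_word (h : nat -> nat -> nat) w :
  \sum_(c < D ^ 5) accepting (dig 0 c) * h (dig 1 c) (dig 2 c) * walk_word w c =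
  acc (run w) * \sum_(s < 2) \sum_(s' < 2) h s s' * (hom_word s w * hom_word s' w).
Proof.
rewrite /walk_word.
rewrite (@sum_digits D (fun q s s' u v => accepting q * h s s' * ((s < 2) *
  ((s' < 2) * ((run w == q :> nat) * (hc s w u * hc s' w v)))))).
transitivity (\sum_(q < D) (run w == q :> nat) * (accepting q *
  \sum_(s < 2) \sum_(s' < 2) h s s' * (hom_word s w * hom_word s' w))); last first.
  by rewrite (sum_eq (run_lt w)) /= accepting_run.
apply: eq_bigr => q _.
have sum2 (B : nat -> nat) : \sum_(s < D) (s < 2) * B s = \sum_(s < 2) B s.
  rewrite (big_ord_widen D B D2) [RHS]big_mkcond; apply: eq_bigr => s _.
  by case: ifP; rewrite ?mul1n.
rewrite -(sum2 (fun s => \sum_(s' < 2) h s s' * (hom_word s w * hom_word s' w))).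
rewrite !big_distrr; apply: eq_bigr => s _ /=.
rewrite -(sum2 (fun s' => h s s' * (hom_word s w * hom_word s' w))).
rewrite !big_distrr; apply: eq_bigr => s' _ /=.
case: (ltnP s 2) => s2; last first.
  rewrite [LHS]big1 => [|u _]; first by rewrite !(mul0n, muln0).
  by rewrite big1 // => v _; rewrite !(mul0n, muln0).
case: (ltnP s' 2) => s2'; last first.
  rewrite [LHS]big1 => [|u _]; first by rewrite !(mul0n, muln0).
  by rewrite big1 // => v _; rewrite !(mul0n, muln0).
rewrite -!(@hom_code_sum k b) -?N_gr ?N_b // big_distrlr !big_distrr; apply: eq_bigr => u _ /=.
by rewrite !big_distrr; apply: eq_bigr => v _ /=; ring.
Qed.

Lemma sum_same t : \sum_(c < D ^ 5) same c * walks t c =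
  \sum_(w <- words t) acc (run w) * (hom_word 0 w ^ 2 + hom_word 1 w ^ 2).
Proof.
under [LHS]eq_bigr => c _ do rewrite walks_words big_distrr /=.
rewrite exchange_big; apply: eq_bigr => w _ /=.
rewrite (@sum_walk_word (fun s s' => s == s')) !big_ord_recr !big_ord0 /=.
by congr (_ * _); lia.
Qed.

Lemma sum_diff t : \sum_(c < D ^ 5) diff c * walks t c =
  \sum_(w <- words t) acc (run w) * (2 * (hom_word 0 w * hom_word 1 w)).
Proof.
under [LHS]eq_bigr => c _ do rewrite walks_words big_distrr /=.
rewrite exchange_big; apply: eq_bigr => w _ /=.
rewrite (@sum_walk_word (fun s s' => s != s')) !big_ord_recr !big_ord0 /=.
by congr (_ * _); lia.
Qed.

Lemma square_le x y : 2 * (x * y) <= x ^ 2 + y ^ 2.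
Proof. by rewrite nat_Cauchy. Qed.

(* The difference of the two sides is the sum of
   (hom(F_w,G) - hom(F_w,H))^2 over the accepted words w. *)
Lemma walks_hom_indist :
  \sum_(t < D ^ 5) \sum_(c < D ^ 5) same c * walks t c =
  \sum_(t < D ^ 5) \sum_(c < D ^ 5) diff c * walks t c <->
  forall w, acc (run w) -> hom_word 0 w = hom_word 1 w.
Proof.
split=> [eqs|eqw]; last first.
  apply: eq_bigr => t _; rewrite sum_same sum_diff; apply: eq_bigr => w _.
  case: (boolP (acc (run w))) => // /eqw ->; rewrite !mul1n; lia.
(* For each length the mixed terms are at most the squares, so equal totals force equality at every
   length below [D ^ 5]. *)
have le_t (t : 'I_(D ^ 5)) : true -> \sum_(c < D ^ 5) diff c * walks t c
    <= \sum_(c < D ^ 5) same c * walks t c ?= iff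
    (\sum_(c < D ^ 5) diff c * walks t c == \sum_(c < D ^ 5) same c * walks t c).
  move=> _; split=> //; rewrite sum_same sum_diff; apply: leq_sum => w _.
  by rewrite leq_mul2l square_le orbT.
have [_] := leqif_sum le_t; rewrite eqs eqxx => /esym/forallP eqt.
(* The linear recurrence extends the equality to all lengths. *)
have eq_all t : \sum_(c < D ^ 5) same c * walks t c = \sum_(c < D ^ 5) diff c * walks t c.
  apply: (@transfer_nat_eq (D ^ 5) transfer walks same diff) => // t' t'D.
  by have := eqt (Ordinal t'D); rewrite implyTb => /eqP ->.
move=> w aw; have := eq_all (size w); rewrite sum_same sum_diff => eq_w.
(* Among the words of one length the inequality holds term by term, so equality of the sums passes
   to every accepted word. *)
have le_w v : true -> acc (run v) * (2 * (hom_word 0 v * hom_word 1 v))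
    <= acc (run v) * (hom_word 0 v ^ 2 + hom_word 1 v ^ 2) ?= iff
    (acc (run v) * (2 * (hom_word 0 v * hom_word 1 v)) ==
     acc (run v) * (hom_word 0 v ^ 2 + hom_word 1 v ^ 2)).
  by move=> _; split=> //; rewrite leq_mul2l square_le orbT.
have : all (fun v => acc (run v) * (2 * (hom_word 0 v * hom_word 1 v)) ==
     acc (run v) * (hom_word 0 v ^ 2 + hom_word 1 v ^ 2)) (words (size w)).
  elim: (words _) eq_w => //= v s IH; rewrite !big_cons => eq_vs.
  have le_s : \sum_(j <- s) acc (run j) * (2 * (hom_word 0 j * hom_word 1 j))
    <= \sum_(j <- s) acc (run j) * (hom_word 0 j ^ 2 + hom_word 1 j ^ 2).
    by apply: leq_sum => u _; have [] := le_w u isT.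
  have [le_v _] := le_w v isT.
  by rewrite IH; [rewrite andbT; apply/eqP | ]; lia.
move/allP/(_ w (mem_words w)); rewrite aw !mul1n.
by have [_ ->] := nat_Cauchy (hom_word 0 w) (hom_word 1 w) => /eqP.
Qed.

End Transfer.

(** * Polynomial-time arithmetic and column addition *)

Lemma feas_drop n f : feas f -> feas (fun o e => f o (drop n e)).
Proof.
elim: n f => [|n IH] f ff; first by apply: feas_ext ff _ => o e; rewrite drop0.
by apply: feas_ext (feas_weak (IH f ff)) _ => o e; rewrite -drop1 drop_drop addn1.
Qed.

Lemma feas_mul x y : feas x -> feas y -> feas (fun o e => x o e * y o e).
Proof.
move=> xF yF; apply: feas_ext (@feas_sum x (fun o e _ => y o e) xF (feas_weak yF)) _.
by move=> o e; rewrite sum_nat_const card_ord.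
Qed.

Lemma feas_not (P : input -> seq nat -> bool) :
  feas (fun o e => P o e) -> feas (fun o e => ~~ P o e).
Proof. by move=> PF; apply: feas_ext (feas_sub feas_1 PF) _ => o e; case: (P o e). Qed.

Lemma feas_and (P Q : input -> seq nat -> bool) : feas (fun o e => P o e) ->
  feas (fun o e => Q o e) -> feas (fun o e => P o e && Q o e).
Proof. by move=> PF QF; apply: feas_ext (feas_mul PF QF) _ => o e; rewrite mulnb. Qed.

Lemma feas_or (P Q : input -> seq nat -> bool) : feas (fun o e => P o e) ->
  feas (fun o e => Q o e) -> feas (fun o e => P o e || Q o e).
Proof.
move=> PF QF; apply: feas_ext (feas_not (feas_and (feas_not PF) (feas_not QF))) _.
by move=> o e; rewrite negb_and !negbK.
Qed.

Lemma feas_bconst (c : bool) : feas (fun _ _ => c).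
Proof. by case: c; [apply: feas_1 | apply: feas_0]. Qed.

Lemma feas_const c : feas (fun _ _ => c).
Proof.
elim: c => [|c IH]; first exact: feas_0.
by apply: feas_ext (feas_add feas_1 IH) _.
Qed.

Lemma feas_leq x y : feas x -> feas y -> feas (fun o e => x o e <= y o e).
Proof.
move=> xF yF; apply: feas_ext (feas_sub feas_1 (feas_sub xF yF)) _ => o e.
by rewrite /leq; case: (x o e - y o e).
Qed.

Lemma feas_ltn x y : feas x -> feas y -> feas (fun o e => x o e < y o e).
Proof.
move=> xF yF.
by apply: (feas_leq (x := fun o e => (x o e).+1)) yF; apply: (feas_add feas_1 xF).
Qed.

Lemma feas_eq x y : feas x -> feas y -> feas (fun o e => x o e == y o e).
Proof.
move=> xF yF; apply: feas_ext (feas_and (feas_leq xF yF) (feas_leq yF xF)) _.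
by move=> o e; rewrite eqn_leq.
Qed.

Lemma feas_if (P : input -> seq nat -> bool) x y : feas (fun o e => P o e) ->
  feas x -> feas y -> feas (fun o e => if P o e then x o e else y o e).
Proof.
move=> PF xF yF.
apply: feas_ext (feas_add (feas_mul PF xF) (feas_mul (feas_not PF) yF)) _.
by move=> o e; case: (P o e); rewrite !mul1n ?addn0.
Qed.

Lemma feas_exp x d : feas x -> feas (fun o e => x o e ^ d).
Proof.
move=> xF; elim: d => [|d IH]; first exact: feas_1.
by apply: feas_ext (feas_mul xF IH) _ => o e; rewrite expnS.
Qed.

Lemma sum_ltn n m : \sum_(i < n) (i < m) = minn n m.
Proof.
elim: n => [|n IH]; first by rewrite big_ord0 min0n.
by rewrite big_ord_recr /= IH; lia.
Qed.

(** The quotient is the number of q with (q+1)y <= x; the factor [0 < y] matches the convention that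
    division by 0 gives 0. *)
Lemma feas_div x y : feas x -> feas y -> feas (fun o e => x o e %/ y o e).
Proof.
move=> xF yF.
apply: feas_ext (feas_mul (feas_ltn feas_0 yF) (@feas_sum x
  (fun o e q => q.+1 * y o e <= x o e) xF _)) _.
  apply: feas_leq (feas_weak xF); apply: feas_mul (feas_weak yF).
  exact: (feas_add feas_1 (feas_var 0)).
move=> o e /=; case: (posnP (y o e)) => [->|y0]; first by rewrite divn0.
rewrite mul1n; under eq_bigr => q _ do rewrite -leq_divRL //.
by rewrite sum_ltn; apply/minn_idPr; apply: leq_div.
Qed.

Lemma feas_mod x y : feas x -> feas y -> feas (fun o e => x o e %% y o e).
Proof.
move=> xF yF; apply: feas_ext (feas_sub xF (feas_mul (feas_div xF yF) yF)) _ => o e.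
by rewrite {1}(divn_eq (x o e) (y o e)) addKn.
Qed.

Lemma feas_digit b j x :
  feas b -> feas x -> feas (fun o e => digit (b o e) j (x o e)).
Proof. by move=> bF xF; apply/feas_mod => //; apply/feas_div/feas_exp. Qed.

(** The range does not depend on the input, so the sum is unrolled in the program. It serves for
    letters, states and labels. *)
Lemma feas_finsum (I : Type) (r : seq I) (F : I -> input -> seq nat -> nat) :
  (forall i, feas (F i)) -> feas (fun o e => \sum_(i <- r) F i o e).
Proof.
move=> FF; elim: r => [|i r IH].
  by apply: feas_ext feas_0 _ => o e; rewrite big_nil.
by apply: feas_ext (feas_add (FF i) IH) _ => o e; rewrite big_cons.
Qed.

(** Quantifiers are computed by counting counterexamples. *)
Lemma forall_sum (I : finType) (P : pred I) :
  [forall i, P i] = (\sum_i ~~ P i == 0).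
Proof.
rewrite sum_nat_eq0; apply: eq_forallb => i.
by rewrite implyTb eqb0 negbK.
Qed.

Lemma feas_finall (I : finType) (P : I -> input -> seq nat -> bool) :
  (forall i, feas (fun o e => P i o e)) ->
  feas (fun o e => [forall i, P i o e]).
Proof.
move=> PF; apply: feas_ext (feas_eq (feas_finsum _ (fun i => feas_not (PF i))) feas_0) _.
by move=> o e; rewrite forall_sum.
Qed.

Lemma feas_all n (P : input -> seq nat -> nat -> bool) : feas n ->
  feas (fun o e => P o (behead e) (nth 0 e 0)) ->
  feas (fun o e => [forall i : 'I_(n o e), P o e i]).
Proof.
move=> nF PF; apply: feas_ext (feas_eq (@feas_sum n
  (fun o e i => ~~ P o e i) nF (feas_not PF)) feas_0) _.
by move=> o e; rewrite forall_sum.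
Qed.

(** * Binary column addition of multiples *)

Section ColumnAddition.
Variables (m : nat) (T : nat -> nat) (X : nat -> nat -> nat).

Definition column (j : nat) : nat := \sum_(i < m) T i * X i j.

Fixpoint carry (j : nat) : nat :=
  if j is j'.+1 then (carry j' + column j') %/ 2 else 0.

Definition sum_bit (j : nat) : nat := (carry j + column j) %% 2.

(** The carry into column j is what the sum of the numbers truncated to their lowest j bits
    contributes beyond those bits. *)
Lemma carryE (x : nat -> nat) j :
  (forall i j', i < m -> j' < j -> X i j' = digit 2 j' (x i)) ->
  carry j = (\sum_(i < m) T i * (x i %% 2 ^ j)) %/ 2 ^ j.
Proof.
elim: j => [|j IH] XE /=; first by rewrite divn1 big1 // => i _; rewrite modn1 muln0.
rewrite IH => [|i j' im j'j]; last by apply: XE => //; apply: ltnW.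
have -> : \sum_(i < m) T i * (x i %% 2 ^ j.+1) =
    column j * 2 ^ j + \sum_(i < m) T i * (x i %% 2 ^ j).
  rewrite /column big_distrl -big_split; apply: eq_bigr => i _ /=.
  rewrite XE // /digit -mulnA -mulnDr; congr (_ * _).
  rewrite {1}(divn_eq (x i) (2 ^ j)) {1}(divn_eq (x i %/ 2 ^ j) 2).
  rewrite mulnDl -mulnA -expnS -addnA modnMDl modn_small //.
  have : x i %% 2 ^ j < 2 ^ j by rewrite ltn_mod expn_gt0.
  have : x i %/ 2 ^ j %% 2 < 2 by rewrite ltn_mod.
  by rewrite expnS; nia.
by rewrite expnSr divnMA divnMDl ?expn_gt0 // addnC.
Qed.

Lemma sum_bitE (x : nat -> nat) j :
  (forall i j', i < m -> j' <= j -> X i j' = digit 2 j' (x i)) ->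
  sum_bit j = digit 2 j (\sum_(i < m) T i * x i).
Proof.
move=> XE; rewrite /sum_bit (@carryE x) => [|i j' im j'j]; last exact/XE/ltnW.
have -> : \sum_(i < m) T i * x i = (\sum_(i < m) T i * (x i %/ 2 ^ j)) * 2 ^ j
   + \sum_(i < m) T i * (x i %% 2 ^ j).
  rewrite big_distrl -big_split; apply: eq_bigr => i _ /=.
  by rewrite -mulnA -mulnDr -divn_eq.
rewrite /digit divnMDl ?expn_gt0 // [in RHS]addnC.
rewrite -modnDmr -[in RHS]modnDmr; congr ((_ + _) %% 2).
rewrite /column; elim/big_ind2: _ => // [u u' v v' uE vE|i _].
  by rewrite -modnDm uE vE modnDm.
by rewrite XE // /digit modnMmr.
Qed.

(** If S is the sum of the coefficients, every column is at most S, and (S + S) / 2 = S is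
    invariant. The carries thus do not grow with j and fit into a unary register. *)
Lemma carry_le j : (forall i j', X i j' <= 1) -> carry j <= \sum_(i < m) T i.
Proof.
move=> X1; elim: j => //= j IH; have : column j <= \sum_(i < m) T i.
  by apply: leq_sum => i _; rewrite -[X in _ <= X]muln1 leq_mul2l X1 orbT.
move=> le_c; apply: leq_trans (leq_div2r 2 (leq_add IH le_c)) _.
by rewrite addnn -muln2 mulnK.
Qed.

End ColumnAddition.

(** [T] and [X] refer to the outer environment; the forms with [drop n e] let them be evaluated
    below n bound variables. *)
Lemma feas_sum_bit m (T : input -> seq nat -> nat -> nat)
    (X : input -> seq nat -> nat -> nat -> nat) j : feas m -> feas j ->
  (forall n x, feas x -> feas (fun o e => T o (drop n e) (x o e))) ->
  (forall n x y, feas x -> feas y ->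
     feas (fun o e => X o (drop n e) (x o e) (y o e))) ->
  (forall o e i j, X o e i j <= 1) ->
  feas (fun o e => sum_bit (m o e) (T o e) (X o e) (j o e)).
Proof.
move=> mF jF TF XF X1.
have cF n y : feas y -> feas (fun o e => column (m o (drop n e)) (T o (drop n e))
    (X o (drop n e)) (y o e)).
  move=> yF; apply: (@feas_sum (fun o e => m o (drop n e)) (fun o e i =>
    T o (drop n e) i * X o (drop n e) i (y o e))); first exact: feas_drop.
  apply: feas_mul.
    apply: feas_ext (TF n.+1 _ (feas_var 0)) _ => o e.
    by rewrite -drop1 drop_drop addn1.
  apply: feas_ext (XF n.+1 _ _ (feas_var 0) (feas_weak yF)) _ => o e.
  by rewrite -drop1 drop_drop addn1.
have STF : feas (fun o e => \sum_(i < m o e) T o e i).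
  apply: (@feas_sum m) => //; apply: feas_ext (TF 1 _ (feas_var 0)) _ => o e.
  by rewrite drop1.
apply: feas_mod (feas_const 2); apply: feas_add; last first.
  by apply: feas_ext (cF 0 _ jF) _ => o e; rewrite drop0.
apply: (@feas_iter (fun _ _ => 0) (fun o e =>
  (nth 0 e 0 + column (m o (drop 2 e)) (T o (drop 2 e)) (X o (drop 2 e)) (nth 0 e 1))
   %/ 2) j (fun o e => \sum_(i < m o e) T o e i)
  (fun o e i => carry (m o e) (T o e) (X o e) i)) => //.
- exact: feas_0.
- by apply: feas_div (feas_const 2); apply: feas_add (feas_var 0) (cF 2 _ (feas_var 1)).
- exact: STF.1.
- by move=> o e i _; apply: carry_le.
by move=> o e i /=; rewrite drop0.
Qed.

(** * Parsing the input *)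

(** The length of the run of true symbols from p on: summand i is 1 if the run has more than i
    symbols. The default [false] ends a run at the end of the word. *)
Definition ones (w : seq bool) (p : nat) : nat :=
  \sum_(i < size w) [forall j : 'I_i.+1, nth false w (p + j)].

Lemma onesE w p m : p + m < size w -> (forall i, i < m -> nth false w (p + i)) ->
  ~~ nth false w (p + m) -> ones w p = m.
Proof.
move=> pm tr fa; rewrite /ones.
under eq_bigr => i _.
  have -> : [forall j : 'I_i.+1, nth false w (p + j)] = (i < m).
    apply/forallP/idP => [h|im j].
      rewrite ltnNge; apply: contra fa => mi.
      by have := h (Ordinal (mi : m < i.+1)).
    by apply: tr; have := ltn_ord j; lia.
  over.
by rewrite sum_ltn; apply/minn_idPr; lia.
Qed.

Lemma nth_ones w p i : i < ones w p -> nth false w (p + i).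
Proof.
move=> io; apply: contraTT io => fa; rewrite -leqNgt.
apply: leq_trans (geq_minr (size w) i); rewrite -sum_ltn.
apply: leq_sum => i' _; case: forallP => // h.
rewrite lt0b ltnNge; apply: contra fa => ii'.
by have := h (Ordinal (ii' : i < i'.+1)).
Qed.

Definition offset (w : seq bool) (s : nat) : nat :=
  if s == 0 then 0 else ones w 0 + (1 + ones w 0 ^ 2).

Definition order_of (w : seq bool) (s : nat) : nat := ones w (offset w s).

Definition adjacency (w : seq bool) (s x y : nat) : bool :=
  [&& x < order_of w s, y < order_of w s &
  nth false w (offset w s + (order_of w s + (1 + (x * order_of w s + y))))].

Definition well_formed (w : seq bool) : bool :=
  [&& size w == offset w 1 + (order_of w 1 + (1 + order_of w 1 ^ 2)),
      [forall s : 'I_2, ~~ nth false w (offset w s + order_of w s)] &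
      [forall s : 'I_2, [forall x : 'I_(order_of w s), [forall y : 'I_(order_of w s),
        (adjacency w s x y == adjacency w s y x) && ~~ adjacency w s x x]]]].

Lemma feas_ones p : feas p -> feas (fun o e => ones o.1 (p o e)).
Proof.
move=> pF; apply: (@feas_sum _ (fun o e i =>
  [forall j : 'I_i.+1, nth false o.1 (p o e + j)]) feas_size).
apply: (@feas_all (fun o e => (nth 0 e 0).+1)
  (fun o e j => nth false o.1 (p o (behead e) + j))).
  exact: (feas_add feas_1 (feas_var 0)).
apply: (@feas_word (fun o e => p o (behead (behead e)) + nth 0 e 0)).
by apply: feas_add (feas_var 0); apply: feas_weak (feas_weak pF).
Qed.

Lemma feas_offset s : feas s -> feas (fun o e => offset o.1 (s o e)).
Proof.
move=> sF; apply: feas_if (feas_eq sF feas_0) feas_0 _.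
have oF := feas_ones feas_0.
by apply: feas_add => //; apply: feas_add feas_1 _; apply: feas_exp.
Qed.

Lemma feas_order s : feas s -> feas (fun o e => order_of o.1 (s o e)).
Proof. by move=> sF; apply/feas_ones/feas_offset. Qed.

Lemma feas_adjacency s x y : feas s -> feas x -> feas y ->
  feas (fun o e => adjacency o.1 (s o e) (x o e) (y o e)).
Proof.
move=> sF xF yF; have oF := feas_order sF.
apply: feas_and; first exact: feas_ltn.
apply: feas_and; first exact: feas_ltn.
apply: (@feas_word (fun o e => offset o.1 (s o e) + (order_of o.1 (s o e) +
  (1 + (x o e * order_of o.1 (s o e) + y o e))))).
apply: feas_add (feas_offset sF) _; apply: feas_add => //.
by apply: feas_add feas_1 _; apply: feas_add => //; apply: feas_mul.
Qed.

Lemma feas_well_formed : feas (fun o _ => well_formed o.1).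
Proof.
apply: feas_and.
  apply: feas_eq feas_size _; apply: feas_add; first exact: (feas_offset feas_1).
  apply: feas_add; first exact: (feas_order feas_1).
  by apply: feas_add feas_1 _; apply: feas_exp (feas_order feas_1).
apply: feas_and.
  apply: (feas_finall (P := fun (s : 'I_2) o _ =>
    ~~ nth false o.1 (offset o.1 s + order_of o.1 s))) => s.
  apply: feas_not; apply: (@feas_word (fun o _ => offset o.1 s + order_of o.1 s)).
  by apply: feas_add; [apply: feas_offset | apply: feas_order]; apply: feas_const.
apply: (feas_finall (P := fun (s : 'I_2) o _ => [forall x : 'I_(order_of o.1 s),
  [forall y : 'I_(order_of o.1 s), (adjacency o.1 s x y == adjacency o.1 s y x)
    && ~~ adjacency o.1 s x x]])) => s.
have oF : feas (fun o _ => order_of o.1 s) by apply: feas_order; apply: feas_const.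
apply: (@feas_all (fun o _ => order_of o.1 s) (fun o _ x =>
  [forall y : 'I_(order_of o.1 s), (adjacency o.1 s x y == adjacency o.1 s y x)
    && ~~ adjacency o.1 s x x])) => //.
apply: (@feas_all (fun o _ => order_of o.1 s) (fun o e y =>
  (adjacency o.1 s (nth 0 e 0) y == adjacency o.1 s y (nth 0 e 0))
    && ~~ adjacency o.1 s (nth 0 e 0) (nth 0 e 0))) => //.
have xF := feas_weak (feas_var 0); have yF := feas_var 0.
have aF x y : feas x -> feas y -> feas (fun o e => adjacency o.1 s (x o e) (y o e)).
  by apply: feas_adjacency; apply: feas_const.
apply: feas_and; last by apply: feas_not; apply: aF.
apply: feas_ext (feas_eq (aF _ _ xF yF) (aF _ _ yF xF)) _ => o e.
by do 2!case: adjacency.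
Qed.

Lemma nth_flatten_const (T U V : Type) (f : T -> U -> V) (s : seq T) (t : seq U)
    x0 y0 z0 i j : i < size s -> j < size t ->
  nth z0 [seq f x y | x <- s, y <- t] (i * size t + j) = f (nth x0 s i) (nth y0 t j).
Proof.
elim: s i => // x s IH [|i] /= is_ jt; rewrite nth_cat size_map.
  by rewrite jt (nth_map y0).
rewrite mulSn -addnA ifF; last by lia.
by rewrite addKn IH.
Qed.

(** * The encoding of a graph, symbol by symbol *)

Section Encoding.
Variables (G : sgraph) (r : seq bool).

Lemma size_encode : size (encode_graph G) = #|G| + (1 + #|G| ^ 2).
Proof. by rewrite size_cat size_nseq /= size_allpairs -!cardE mulnn. Qed.

Lemma nth_encode_true i : i < #|G| -> nth false (encode_graph G ++ r) i.
Proof. by move=> iG; rewrite /encode_graph -catA nth_cat size_nseq iG nth_nseq iG. Qed.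

Lemma nth_encode_false : ~~ nth false (encode_graph G ++ r) #|G|.
Proof. by rewrite /encode_graph -catA nth_cat size_nseq ltnn subnn. Qed.

Lemma adjacentE (x y : 'I_#|G|) : adjacent G x y = edge (enum_val x) (enum_val y).
Proof. by rewrite -adjacent_rank !enum_valK. Qed.

Lemma nth_encode_edge x y : x < #|G| -> y < #|G| ->
  nth false (encode_graph G ++ r) (#|G| + (1 + (x * #|G| + y))) = adjacent G x y.
Proof.
move=> xG yG; rewrite /encode_graph -catA nth_cat size_nseq ifF; last by lia.
have lt_n : x * #|G| + y < #|G| * #|G|.
  by apply: leq_trans (_ : x.+1 * #|G| <= _); rewrite ?leq_mul2r ?xG ?orbT // mulSn addnC ltn_add2r.
rewrite addKn add1n /= nth_cat size_allpairs -!cardE lt_n.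
rewrite (adjacentE (Ordinal xG) (Ordinal yG)).
have x0 := enum_val (Ordinal xG).
rewrite [X in x * X + y]cardE.
by rewrite (nth_flatten_const _ x0 x0) -?cardE // !(enum_val_nth x0).
Qed.

Lemma adjacent_lt x y : adjacent G x y -> x < #|G| /\ y < #|G|.
Proof.
by case/existsP=> a /existsP[c /and3P[/eqP<- /eqP<- _]]; split; apply: ltn_ord.
Qed.

Lemma adjacent_sym x y : adjacent G x y = adjacent G y x.
Proof.
suff sub u v : adjacent G u v -> adjacent G v u by apply/idP/idP; apply: sub.
case/existsP=> a /existsP[c /and3P[ea ec e]].
by apply/existsP; exists c; apply/existsP; exists a; rewrite ec ea edge_sym.
Qed.

Lemma adjacent_irr x : ~~ adjacent G x x.
Proof.
apply/existsP=> -[a /existsP[c /and3P[/eqP ea /eqP ec e]]].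
by move: e; rewrite (enum_rank_inj (val_inj (etrans ea (esym ec)))) edge_irr.
Qed.

End Encoding.

Lemma parse_encode (G H : sgraph) (w : seq bool) :
  w = encode_graph G ++ encode_graph H ->
  [/\ well_formed w,
      forall s, s < 2 -> order_of w s = #|if s == 0 then G else H|
    & forall s, s < 2 -> forall x y,
        adjacency w s x y = adjacent (if s == 0 then G else H) x y].
Proof.
move=> wE.
have szw : size w = #|G| + (1 + #|G| ^ 2) + (#|H| + (1 + #|H| ^ 2)).
  by rewrite wE size_cat !size_encode.
pose r s := if s == 0 then encode_graph H else [::].
pose gr s := if s == 0 then G else H.
have on0 : ones w 0 = #|G|.
  apply: onesE; rewrite ?add0n.
  - by rewrite szw; lia.
  - by move=> i iG; rewrite add0n wE nth_encode_true.
  by rewrite wE nth_encode_false.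
have off1 : offset w 1 = size (encode_graph G) by rewrite /offset /= on0 size_encode.
have nthE s i : s < 2 -> nth false w (offset w s + i) =
    nth false (encode_graph (gr s) ++ r s) i.
  case: s => [|[]] // _; first by rewrite wE.
  by rewrite off1 wE nth_cat ltnNge leq_addr /= addKn cats0.
have ordE s : s < 2 -> order_of w s = #|gr s|.
  move=> s2; apply: onesE; rewrite ?nthE ?nth_encode_false //.
    case: s s2 => [|[]] // _; first by rewrite szw /gr /offset /=; lia.
    by rewrite off1 size_encode szw /gr /=; lia.
  by move=> i ig; rewrite nthE ?nth_encode_true.
have adjE s : s < 2 -> forall x y, adjacency w s x y = adjacent (gr s) x y.
  move=> s2 x y; rewrite /adjacency ordE //.
  case: ltnP => [xg|gx] /=; last first.
    by apply/esym/negbTE/negP => /adjacent_lt[]; rewrite ltnNge gx.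
  case: ltnP => [yg|gy] /=; last first.
    by apply/esym/negbTE/negP => /adjacent_lt[_]; rewrite ltnNge gy.
  by rewrite nthE // nth_encode_edge.
split=> //; apply/and3P; split.
- by rewrite ordE // off1 szw size_encode.
- by apply/forallP => s; rewrite ordE ?nthE ?nth_encode_false.
apply/forallP => s; apply/forallP => x; apply/forallP => y.
by rewrite !adjE // adjacent_sym eqxx adjacent_irr.
Qed.

(** [HomInd] contains only words that encode two graphs, so the syntactic test has to be exact in
    this direction too. *)
Lemma parse_complete (w : seq bool) : well_formed w ->
  exists G H : sgraph, w = encode_graph G ++ encode_graph H.
Proof.
case/and3P=> /eqP szw /forallP fa /forallP adj.
have sym s (s2 : s < 2) : symmetric (fun x y : 'I_(order_of w s) => adjacency w s x y).
  by move=> x y; have /forallP/(_ x)/forallP/(_ y)/andP[/eqP] := adj (Ordinal s2).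
have irr s (s2 : s < 2) : irreflexive (fun x y : 'I_(order_of w s) => adjacency w s x y).
  move=> x; have /forallP/(_ x)/forallP/(_ x)/andP[_] := adj (Ordinal s2).
  by move/negPf.
(* On ordinals the enumeration rank is the number itself, so these graphs are encoded by the very
   matrices found in the word. *)
pose gr s (s2 : s < 2) := SGraph (sym s s2) (irr s s2).
have card_gr s s2 : #|gr s s2| = order_of w s by rewrite card_ord.
have adj_gr s s2 x y : x < order_of w s -> y < order_of w s ->
    adjacent (gr s s2) x y = adjacency w s x y.
  move=> xo yo; have := @adjacent_rank (gr s s2) (Ordinal xo) (Ordinal yo).
  by rewrite !enum_rank_ord.
have nthE s s2 r i : i < #|gr s s2| + (1 + #|gr s s2| ^ 2) ->
    nth false w (offset w s + i) = nth false (encode_graph (gr s s2) ++ r) i.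
  move=> lti; case: (ltngtP i (#|gr s s2|)) => [ig|gi|ig].
  - by rewrite nth_encode_true // nth_ones // -/(order_of w s) -(card_gr s s2).
  (* The position inside the adjacency matrix; its quotient and remainder by the order are the row
     and the column. *)
  - pose m := i - #|gr s s2|.+1; have g0 : 0 < #|gr s s2| by move: lti gi; nia.
    have mq : m %/ #|gr s s2| < #|gr s s2|.
      by rewrite ltn_divLR // /m; move: lti gi; rewrite -mulnn; lia.
    have mr : m %% #|gr s s2| < #|gr s s2| by rewrite ltn_mod.
    have -> : i = #|gr s s2| + (1 + (m %/ #|gr s s2| * #|gr s s2| + m %% #|gr s s2|)).
      by rewrite -divn_eq /m; lia.
    rewrite nth_encode_edge //; move: mq mr; rewrite card_gr => mq mr.
    by rewrite adj_gr // /adjacency mq mr.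
  have -> : nth false (encode_graph (gr s s2) ++ r) i = false.
    by rewrite ig; apply/negbTE/nth_encode_false.
  by rewrite ig card_gr; apply/negbTE; apply: (fa (Ordinal s2)).
pose G := gr 0 isT; pose H := gr 1 isT; exists G, H.
have off1 : offset w 1 = size (encode_graph G) by rewrite size_encode card_gr.
apply: (@eq_from_nth _ false).
  by rewrite szw off1 size_cat [size (encode_graph H)]size_encode card_gr.
move=> i isz; case: (ltnP i (size (encode_graph G))) => [iG|Gi].
  by rewrite -(nthE 0 isT) ?add0n // -size_encode.
rewrite nth_cat ltnNge Gi /= -[encode_graph H]cats0 -(nthE 1 isT).
  by rewrite off1 subnKC.
by move: isz; rewrite szw off1 card_gr; lia.
Qed.

(** * The decision procedure *)

Lemma hom_iso (F F' G : sgraph) : graph_iso F F' -> hom F G = hom F' G.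
Proof.
case=> f [g fK gK] fE; rewrite /hom.
pose h (p : {ffun F' -> G}) : {ffun F -> G} := [ffun x => p (f x)].
have hinj : injective h.
  by move=> p p' /ffunP hp; apply/ffunP => y; have := hp (g y); rewrite !ffunE gK.
rewrite -(card_imset _ hinj); apply: eq_card => p; rewrite inE.
apply/idP/imsetP => [/is_homP hp|[p' + ->]].
  exists [ffun y => p (g y)]; last by apply/ffunP => x; rewrite !ffunE fK.
  by rewrite inE; apply/is_homP => x y e; rewrite !ffunE; apply: hp; rewrite -fE !gK.
by rewrite inE => /is_homP hp'; apply/is_homP => x y e; rewrite !ffunE hp' ?fE.
Qed.

(** A brute-force count over all codes of maps; it is used for m < k only, where [b ^ m] is
    polynomial. *)
Definition small_hom (b N : nat) (A : nat -> nat -> bool) (m : nat)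
    (E : {ffun 'I_m * 'I_m -> bool}) : nat :=
  \sum_(u < b ^ m) [forall i : 'I_m, digit b i u < N] *
    [forall i : 'I_m, [forall j : 'I_m, E (i, j) ==> A (digit b i u) (digit b j u)]].

Definition presents (X : sgraph) (m : nat) (E : {ffun 'I_m * 'I_m -> bool}) : Prop :=
  exists2 l : 'I_m -> X, bijective l & forall i j, E (i, j) = edge (l i) (l j).

Lemma presents_card (X : sgraph) :
  exists E : {ffun 'I_#|X| * 'I_#|X| -> bool}, presents X E.
Proof.
exists [ffun p => edge (enum_val p.1) (enum_val p.2)], enum_val; first exact: enum_val_bij.
by move=> i j; rewrite ffunE.
Qed.

(** The bijection labels all vertices of [X], which makes [hom_code_labelled] applicable with m
    labels. *)
Lemma presents_hom (X G : sgraph) (b m : nat) (E : {ffun 'I_m * 'I_m -> bool}) :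
  #|G| <= b -> presents X E -> hom X G = small_hom b #|G| (adjacent G) E.
Proof.
move=> Gb [l [l' lK l'K] lE]; pose F := @DLGraph m X l (can_inj lK).
rewrite -(hom_code_sum Gb F); apply: eq_bigr => u _.
rewrite hom_code_labelled => [|x]; last by exists (l' x); apply: l'K.
congr (_ * nat_of_bool _); apply: eq_forallb => i; apply: eq_forallb => j.
by rewrite lE.
Qed.

Lemma leq_bool_mul (c : bool) x y : x <= y -> c * x <= y.
Proof. by case: c => //; rewrite mul1n. Qed.

Lemma bits_inj B x y : x < 2 ^ B -> y < 2 ^ B ->
  [forall j : 'I_B, digit 2 j x == digit 2 j y] = (x == y).
Proof.
move=> xB yB; apply/forallP/eqP => [h|-> j //].
by apply: (@digit_inj 2 B) => // j jB; apply/eqP/(h (Ordinal jB)).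
Qed.

Lemma divn_add_lt a m j : j < m -> (a * m + j) %/ m = a.
Proof. by move=> jm; rewrite divnMDl ?divn_small ?addn0 //; apply: leq_ltn_trans jm. Qed.

Lemma modn_add_lt a m j : j < m -> (a * m + j) %% m = j.
Proof. by move=> jm; rewrite modnMDl modn_small. Qed.

(** * The table, the verdict and their size *)

Section Decision.
Variables (k n : nat) (q0 : 'I_n) (delta : letter k -> 'I_n -> 'I_n) (acc : pred 'I_n).
Variable small : forall m, {ffun 'I_m * 'I_m -> bool} -> bool.

(** Large enough for the orders of both graphs, for the number of states, and for the graph indices
    0 and 1. *)
Definition base (w : seq bool) : nat := size w + (n + 2).
Definition dim (w : seq bool) : nat := (base w ^ k) ^ 5.
Definition growth : nat := #|{: letter k}| * n.

(* All the sums compared by the decision procedure are less than 2 ^ bits w. *)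
Definition bits (w : seq bool) : nat :=
  dim w * dim w + (n + growth * dim w * dim w).

Definition init_of w := initial k (base w) q0 (order_of w).
Definition trans_of w := transfer (base w) delta (order_of w) (adjacency w).
Definition walks_of w := walks (base w) q0 delta (order_of w) (adjacency w).
Definition same_of w := same k (base w) acc.
Definition diff_of w := diff k (base w) acc.

(* Cell (t * dim w + c) * bits w + j of the table is bit j of walks_of w t c. *)
Definition entry (o : input) (i : nat) : nat :=
  let r := i %/ bits o.1 in let j := i %% bits o.1 in
  let c := r %% dim o.1 in let t := r %/ dim o.1 in
  if t == 0 then (j == 0) * init_of o.1 c
  else sum_bit (dim o.1) (trans_of o.1 c)
    (fun d j' => o.2 (((t - 1) * dim o.1 + d) * bits o.1 + j')) j.

Definition table_bit (o : input) (i j : nat) : nat := o.2 (i * bits o.1 + j).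

(** [m] and [E] range over a finite set fixed by k, so the values of [small] are built into the
    program. *)
Definition small_ok (w : seq bool) : bool :=
  [forall m : 'I_k, [forall E : {ffun 'I_m * 'I_m -> bool}, small E ==>
    (small_hom (base w) (order_of w 0) (adjacency w 0) E ==
     small_hom (base w) (order_of w 1) (adjacency w 1) E)]].

Definition verdict (o : input) : bool :=
  [&& well_formed o.1, small_ok o.1 & [forall j : 'I_(bits o.1),
    sum_bit (dim o.1 * dim o.1) (fun i => same_of o.1 (i %% dim o.1)) (table_bit o) j ==
    sum_bit (dim o.1 * dim o.1) (fun i => diff_of o.1 (i %% dim o.1)) (table_bit o) j]].

Section Bounds.
Variable w : seq bool.
Local Notation C := (dim w).

Lemma dim_gt0 : 0 < C.
Proof. by rewrite /dim !expn_gt0 /base; case: k => *; rewrite ?addn_gt0 ?orbT. Qed.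

Lemma init_le1 c : init_of w c <= 1.
Proof. by rewrite /init_of /initial; do 4!apply: leq_bool_mul; apply: leq_b1. Qed.

Lemma sum_indicator_le (Q : 'I_n -> nat) :
  (forall p, Q p <= 1) -> \sum_p Q p <= n.
Proof.
move=> Q1; apply: leq_trans (_ : \sum_(p : 'I_n) 1 <= _); first exact: leq_sum.
by rewrite sum1_card card_ord.
Qed.

Lemma letter_entry_le (N : nat) (A : nat -> nat -> bool) (a : letter k) u v :
  letter_entry (base w) N A a u v <= 1.
Proof. by case: a => [[i j]|i] /=; apply: leq_bool_mul; apply: leq_b1. Qed.

Lemma trans_le c d : trans_of w c d <= growth.
Proof.
rewrite /trans_of /transfer /growth -sum_nat_const; apply: leq_sum => a _.
rewrite /transfer_letter; do 4!apply: leq_bool_mul.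
rewrite -[X in _ <= X]muln1; apply: leq_mul; last by apply: (@leq_mul _ _ 1 1); apply: letter_entry_le.
by apply: sum_indicator_le => p; do 2!case: (_ == _).
Qed.

Lemma walks_le t c : walks_of w t c <= (growth * C) ^ t.
Proof.
elim: t c => [|t IH] c; first exact: init_le1.
rewrite expnS mulnAC [growth * _ * C]mulnC -[X in X * _]card_ord -sum_nat_const.
by apply: leq_sum => d _; apply: leq_mul (trans_le c d) (IH d).
Qed.

(** There are fewer than 2^(C*C) summands. In each, the weight is at most 2^n, and a walk count,
    with exponent at most C, is at most (growth * C)^C <= 2^(growth*C*C). This is the origin of
    [bits]. *)
Lemma sum_walks_lt (f : nat -> nat) : (forall c, f c <= n) ->
  \sum_(i < C * C) f (i %% C) * walks_of w (i %/ C) (i %% C) < 2 ^ bits w.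
Proof.
move=> fn; have C0 := dim_gt0.
have le2 x : x < 2 ^ x by apply: ltn_expl.
apply: leq_ltn_trans (_ : \sum_(i < C * C) 2 ^ (n + growth * C * C) < _).
  apply: leq_sum => i _; rewrite expnD; apply: leq_mul.
    by apply: leq_trans (fn _) (ltnW (le2 n)).
  apply: leq_trans (walks_le _ _) _; rewrite expnM.
  have iC : i %/ C <= C by apply/ltnW; rewrite ltn_divLR.
  apply: leq_trans (leq_pexp2l _ iC); last by rewrite expn_gt0.
  by case: (i %/ C) => // t; rewrite leq_exp2r // ltnW.
by rewrite sum_nat_const card_ord /bits [X in _ < X]expnD ltn_pmul2r ?expn_gt0.
Qed.

Lemma accepting_le q : accepting acc q <= n.
Proof.
by apply: sum_indicator_le => p; case: (acc p); case: (_ == _).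
Qed.

Lemma same_le c : same_of w c <= n.
Proof. by rewrite /same_of /same mulnC; apply/leq_bool_mul/accepting_le. Qed.

Lemma diff_le c : diff_of w c <= n.
Proof. by rewrite /diff_of /diff mulnC; apply/leq_bool_mul/accepting_le. Qed.

Lemma bits_gt0 : 0 < bits w.
Proof. by rewrite /bits addn_gt0 muln_gt0 dim_gt0. Qed.

End Bounds.

Definition entry_nat (o : input) (e : seq nat) : nat := entry o (nth 0 e 0).

(** Row t of the table reads only row t-1, whose cells have smaller addresses and are final by the
    induction hypothesis. *)
Lemma fill_entry w M i : i < M ->
  fill entry_nat w M i =
  (digit 2 (i %% bits w) (walks_of w (i %/ bits w %/ dim w) (i %/ bits w %% dim w)) != 0).
Proof.
elim: M i => // M IH i; rewrite ltnS leq_eqVlt /= => /orP[/eqP->|iM]; last first.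
  by rewrite upd_other ?IH //; apply: contraTneq iM => ->; rewrite ltnn.
rewrite upd_same; congr (_ != 0); rewrite /entry_nat /entry /=.
have B0 := bits_gt0 w; have C0 := dim_gt0 w.
set j := M %% _; set c := _ %% dim w; set t := _ %/ dim w.
have jB : j < bits w by rewrite ltn_mod.
case: eqP => [->|/eqP t0] /=.
  (* Row 0 consists of zeros and ones, so all bits except the lowest vanish. *)
  have := init_le1 w c; rewrite /walks_of /= -/(init_of w c).
  case: eqP => [->|/eqP j0]; first by case: (init_of w c) => [|[]].
  rewrite mul0n /digit => i1; rewrite divn_small ?mod0n //.
  by apply: leq_ltn_trans i1 _; rewrite -[1](expn0 2) ltn_exp2l // lt0n.
have [t' tE] : exists t', t = t'.+1 by case: (t) t0 => // t' _; exists t'.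
rewrite tE subn1 /=.
rewrite (@sum_bitE _ _ _ (walks_of w t')) // => d j' dC j'j.
have j'B : j' < bits w by apply: leq_ltn_trans jB.
rewrite IH.
  rewrite !divn_add_lt // !modn_add_lt //.
  by rewrite /digit; case: (_ %% 2) (ltn_mod (walks_of w t' d %/ 2 ^ j') 2) => [|[]].
(* All cells of row t' lie below the first cell of row t'+1. *)
rewrite (divn_eq M (bits w)) -/j (divn_eq (M %/ bits w) (dim w)) -/t -/c tE mulSn.
by apply: leq_trans (_ : (t' * dim w + dim w) * bits w <= _); nia.
Qed.

Definition cells (o : input) (_ : seq nat) : nat :=
  dim o.1 * dim o.1 * bits o.1.

Lemma table_bitE w i j : i < dim w * dim w -> j < bits w ->
  table_bit (w, fill entry_nat w (dim w * dim w * bits w)) i j =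
  digit 2 j (walks_of w (i %/ dim w) (i %% dim w)).
Proof.
move=> iC jB; rewrite /table_bit /= fill_entry; last by nia.
rewrite divn_add_lt // modn_add_lt //.
set x := walks_of _ _ _.
by rewrite /digit; case: (_ %% 2) (ltn_mod (x %/ 2 ^ j) 2) => [|[]].
Qed.

Lemma sum_cells w (f : nat -> nat) :
  \sum_(i < dim w * dim w) f (i %% dim w) * walks_of w (i %/ dim w) (i %% dim w) =
  \sum_(t < dim w) \sum_(c < dim w) f c * walks_of w t c.
Proof.
by rewrite (@sum_divmod _ _ (fun c t => f c * walks_of w t c)) exchange_big.
Qed.

Lemma verdict_sums w :
  [forall j : 'I_(bits w),
    sum_bit (dim w * dim w) (fun i => same_of w (i %% dim w))
      (table_bit (w, fill entry_nat w (dim w * dim w * bits w))) j ==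
    sum_bit (dim w * dim w) (fun i => diff_of w (i %% dim w))
      (table_bit (w, fill entry_nat w (dim w * dim w * bits w))) j] =
  (\sum_(t < dim w) \sum_(c < dim w) same_of w c * walks_of w t c ==
   \sum_(t < dim w) \sum_(c < dim w) diff_of w c * walks_of w t c).
Proof.
rewrite -!sum_cells -(bits_inj (sum_walks_lt w (@same_le w)) (sum_walks_lt w (@diff_le w))).
apply: eq_forallb => j.
by congr (_ == _);
  apply: (@sum_bitE _ _ _ (fun i => walks_of w (i %/ dim w) (i %% dim w))) => i j' iC j'j; apply: table_bitE => //;
  apply: leq_ltn_trans j'j (ltn_ord j).
Qed.

(** * Polynomial-time computability of the table and of the verdict *)

Lemma feas_base : feas (fun o _ => base o.1).
Proof. by apply: feas_add feas_size _; apply: feas_const. Qed.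

Lemma feas_dim : feas (fun o _ => dim o.1).
Proof. by do 2!apply: feas_exp; apply: feas_base. Qed.

Lemma feas_bits : feas (fun o _ => bits o.1).
Proof.
have dF := feas_dim; apply: feas_add; first exact: feas_mul.
apply: feas_add (feas_const n) _; apply: feas_mul => //.
by apply: feas_mul => //; apply: feas_const.
Qed.

Lemma feas_code j x : feas x -> feas (fun o e => digit (base o.1 ^ k) j (x o e)).
Proof.
by move=> xF; apply: (feas_digit j (b := fun o _ => base o.1 ^ k)) => //;
  apply: feas_exp feas_base.
Qed.

Lemma feas_bdigit j x : feas x -> feas (fun o e => digit (base o.1) j (x o e)).
Proof. by apply: (feas_digit j (b := fun o _ => base o.1)); apply: feas_base. Qed.

Lemma feas_letter_entry (a : letter k) s u v : feas s -> feas u -> feas v ->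
  feas (fun o e => letter_entry (base o.1) (order_of o.1 (s o e))
    (adjacency o.1 (s o e)) a (u o e) (v o e)).
Proof.
move=> sF uF vF; case: a => [[i j]|i] /=.
  apply: feas_mul; first exact: feas_eq.
  by apply: feas_or; [apply: feas_bconst | apply: feas_adjacency => //;
    apply: feas_bdigit].
apply: feas_mul; first by apply: feas_ltn; [apply: feas_bdigit | apply: feas_order].
apply: (feas_finall (P := fun (l : 'I_k) o e =>
  (l != i) ==> (digit (base o.1) l (u o e) == digit (base o.1) l (v o e)))) => l.
case: (l != i); last exact: feas_1.
by apply: feas_eq; apply: feas_bdigit.
Qed.

Lemma feas_trans c d : feas c -> feas d ->
  feas (fun o e => trans_of o.1 (c o e) (d o e)).
Proof.
move=> cF dF; rewrite /trans_of /transfer.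
apply: (feas_finsum _ (F := fun a o e => transfer_letter (base o.1) delta
  (order_of o.1) (adjacency o.1) a (c o e) (d o e))) => a.
have lF j := feas_ltn (feas_code j cF) (feas_const 2).
have eF j := feas_eq (feas_code j cF) (feas_code j dF).
do 4!apply: feas_mul => //.
apply: feas_mul.
  apply: (feas_finsum _ (F := fun (p : 'I_n) o e => (p == digit (base o.1 ^ k) 0 (d o e) :> nat)
    * (digit (base o.1 ^ k) 0 (c o e) == delta a p :> nat))) => p.
  by apply: feas_mul; apply: feas_eq; try exact: feas_code; apply: feas_const.
by apply: feas_mul; apply: feas_letter_entry; apply: feas_code.
Qed.

Lemma feas_labels s u : feas s -> feas u ->
  feas (fun o e => [forall i : 'I_k, digit (base o.1) i (u o e) < order_of o.1 (s o e)]).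
Proof.
move=> sF uF; apply: (feas_finall (P := fun (i : 'I_k) o e =>
  digit (base o.1) i (u o e) < order_of o.1 (s o e))) => i.
by apply: feas_ltn; [apply: feas_bdigit | apply: feas_order].
Qed.

Lemma feas_init c : feas c -> feas (fun o e => init_of o.1 (c o e)).
Proof.
move=> cF; have lF j := feas_ltn (feas_code j cF) (feas_const 2).
do 2!apply: feas_mul => //; apply: feas_mul.
  by apply: feas_eq; [apply: feas_const | apply: feas_code].
by apply: feas_mul; apply: feas_labels; apply: feas_code.
Qed.

Lemma feas_accepting q : feas q -> feas (fun o e => accepting acc (q o e)).
Proof.
move=> qF; apply: (feas_finsum _ (F := fun (p : 'I_n) o e => acc p * (p == q o e :> nat))) => p.
by apply: feas_mul (feas_const _) _; apply: feas_eq => //; apply: feas_const.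
Qed.

Lemma feas_same c : feas c -> feas (fun o e => same_of o.1 (c o e)).
Proof.
move=> cF; apply: feas_mul; first by apply/feas_accepting/feas_code.
by apply: feas_eq; apply: feas_code.
Qed.

Lemma feas_diff c : feas c -> feas (fun o e => diff_of o.1 (c o e)).
Proof.
move=> cF; apply: feas_mul; first by apply/feas_accepting/feas_code.
by apply: feas_not; apply: feas_eq; apply: feas_code.
Qed.

Lemma feas_entry : feas entry_nat.
Proof.
have bF := feas_bits; have dF := feas_dim; have iF := feas_var 0.
have rF := feas_div iF bF; have jF := feas_mod iF bF.
have cF := feas_mod rF dF; have tF := feas_div rF dF.
rewrite /entry_nat /entry /=.
apply: (feas_if (feas_eq tF feas_0) (feas_mul (feas_eq jF feas_0) (feas_init cF))).
apply: (@feas_sum_bit (fun o _ => dim o.1)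
  (fun o e d => trans_of o.1 (nth 0 e 0 %/ bits o.1 %% dim o.1) d)
  (fun o e d j' => o.2 (((nth 0 e 0 %/ bits o.1 %/ dim o.1 - 1) * dim o.1 + d)
                          * bits o.1 + j')) (fun o e => nth 0 e 0 %% bits o.1)) => //.
- by move=> m x xF; apply: feas_trans => //; apply: (feas_drop m cF).
- move=> m x y xF yF; apply: (@feas_table (fun o e =>
    ((nth 0 (drop m e) 0 %/ bits o.1 %/ dim o.1 - 1) * dim o.1 + x o e)
                          * bits o.1 + y o e)).
  apply: feas_add => //; apply: feas_mul => //; apply: feas_add => //.
  by apply: feas_mul => //; apply: feas_sub feas_1; apply: (feas_drop m tF).
by move=> o e i j; apply: leq_b1.
Qed.

Lemma feas_cells : feas cells.
Proof. by have dF := feas_dim; apply: feas_mul feas_bits; apply: feas_mul. Qed.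

Lemma feas_small_hom m (E : {ffun 'I_m * 'I_m -> bool}) s :
  feas (fun o _ => small_hom (base o.1) (order_of o.1 s) (adjacency o.1 s) E).
Proof.
have uF j : feas (fun o e => digit (base o.1) j (nth 0 e 0)) := feas_bdigit j (feas_var 0).
apply: (@feas_sum (fun o _ => base o.1 ^ m) (fun o _ u =>
  [forall i : 'I_m, digit (base o.1) i u < order_of o.1 s] *
  [forall i : 'I_m, [forall j : 'I_m, E (i, j) ==>
    adjacency o.1 s (digit (base o.1) i u) (digit (base o.1) j u)]])).
  exact: feas_exp feas_base.
apply: feas_mul.
  apply: (feas_finall (P := fun (i : 'I_m) o e =>
    digit (base o.1) i (nth 0 e 0) < order_of o.1 s)) => i.
  by apply: feas_ltn => //; apply: feas_order; apply: feas_const.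
apply: (feas_finall (P := fun (i : 'I_m) o e => [forall j : 'I_m, E (i, j) ==>
    adjacency o.1 s (digit (base o.1) i (nth 0 e 0)) (digit (base o.1) j (nth 0 e 0))])) => i.
apply: (feas_finall (P := fun (j : 'I_m) o e => E (i, j) ==>
    adjacency o.1 s (digit (base o.1) i (nth 0 e 0)) (digit (base o.1) j (nth 0 e 0)))) => j.
case: (E (i, j)); last exact: feas_1.
by apply: feas_adjacency => //; apply: feas_const.
Qed.

Lemma feas_small_ok : feas (fun o _ => small_ok o.1).
Proof.
apply: (feas_finall (P := fun (m : 'I_k) o _ =>
  [forall E : {ffun 'I_m * 'I_m -> bool}, small E ==>
  (small_hom (base o.1) (order_of o.1 0) (adjacency o.1 0) E ==
   small_hom (base o.1) (order_of o.1 1) (adjacency o.1 1) E)])) => m.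
apply: (feas_finall (P := fun (E : {ffun 'I_m * 'I_m -> bool}) o _ => small E ==>
  (small_hom (base o.1) (order_of o.1 0) (adjacency o.1 0) E ==
   small_hom (base o.1) (order_of o.1 1) (adjacency o.1 1) E))) => E.
case: (small E); last exact: feas_1.
by apply: feas_eq; apply: feas_small_hom.
Qed.

Lemma feas_verdict : feas (fun o _ => verdict o).
Proof.
apply: feas_and feas_well_formed _; apply: feas_and feas_small_ok _.
have dF := feas_dim; have bF := feas_bits; have ddF := feas_mul dF dF.
have TF x y : feas x -> feas y -> feas (fun o e => table_bit o (x o e) (y o e)).
  move=> xF yF; apply: (@feas_table (fun o e => x o e * bits o.1 + y o e)).
  by apply: feas_add => //; apply: feas_mul.
apply: (@feas_all (fun o _ => bits o.1) (fun o _ j =>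
  sum_bit (dim o.1 * dim o.1) (fun i => same_of o.1 (i %% dim o.1)) (table_bit o) j ==
  sum_bit (dim o.1 * dim o.1) (fun i => diff_of o.1 (i %% dim o.1)) (table_bit o) j)) => //.
apply: feas_eq.
  apply: (@feas_sum_bit (fun o _ => dim o.1 * dim o.1)
    (fun o _ i => same_of o.1 (i %% dim o.1)) (fun o _ => table_bit o)
    (fun _ e => nth 0 e 0)) => //.
  - exact: feas_var.
  - by move=> m x xF; apply: feas_same; apply: feas_mod.
  by move=> o e i j; apply: leq_b1.
apply: (@feas_sum_bit (fun o _ => dim o.1 * dim o.1)
  (fun o _ i => diff_of o.1 (i %% dim o.1)) (fun o _ => table_bit o)
  (fun _ e => nth 0 e 0)) => //.
- exact: feas_var.
- by move=> m x xF; apply: feas_diff; apply: feas_mod.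
by move=> o e i j; apply: leq_b1.
Qed.

Hypothesis k_gt0 : 0 < k.

Lemma verdict_encode (G H : sgraph) (w : seq bool) :
  w = encode_graph G ++ encode_graph H ->
  verdict (w, fill entry_nat w (dim w * dim w * bits w)) <->
  (forall m (E : {ffun 'I_m * 'I_m -> bool}), m < k -> small E ->
     small_hom (base w) #|G| (adjacent G) E = small_hom (base w) #|H| (adjacent H) E) /\
  (forall v, acc (run q0 delta v) ->
     hom (soe (word_graph v)) G = hom (soe (word_graph v)) H).
Proof.
move=> wE; have [wf ordE adjE] := parse_encode wE.
pose gr s := if s == 0 then G else H.
have szw : size w = #|G| + (1 + #|G| ^ 2) + (#|H| + (1 + #|H| ^ 2)).
  by rewrite wE size_cat !size_encode.
have ord_base s : s < 2 -> order_of w s <= base w.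
  by move=> s2; rewrite ordE // /base szw; case: ifP; lia.
(* As k is positive, one digit in base D has room for whatever is below [base w]. *)
have base_D : base w <= base w ^ k.
  by rewrite -{1}[base w]expn1 leq_pexp2l // /base; lia.
have nD : n <= base w ^ k by apply: leq_trans base_D; rewrite /base; lia.
have D2 : 1 < base w ^ k by apply: leq_trans base_D; rewrite /base; lia.
rewrite /verdict wf /= verdict_sums.
have indist := @walks_hom_indist k (base w) n q0 delta acc (order_of w) (adjacency w)
  nD D2 gr ordE adjE ord_base.
have smallE s m (E : {ffun 'I_m * 'I_m -> bool}) : s < 2 ->
  small_hom (base w) (order_of w s) (adjacency w s) E =
  small_hom (base w) #|gr s| (adjacent (gr s)) E.
  move=> s2; rewrite /small_hom ordE //; apply: eq_bigr => u _.
  congr (_ * nat_of_bool _); apply: eq_forallb => i; apply: eq_forallb => j.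
  by rewrite adjE.
split=> [/andP[/forallP sm /eqP/indist hom_eq]|[sm hom_eq]].
  split=> // m E mk smE; have /forallP/(_ E) := sm (Ordinal mk).
  by rewrite smE /= => /eqP; rewrite !smallE.
apply/andP; split; last by apply/eqP/indist.
apply/forallP => m; apply/forallP => E; apply/implyP => smE.
by rewrite !smallE //; apply/eqP; apply: sm.
Qed.

End Decision.

Theorem theorem3 (k : nat) (F : graph_class) (hk : 1 <= k)
    (hrec : recognisable k F)
    (hpw : forall G : sgraph, F G -> pathwidth G <= k - 1) :
  polynomial_time (HomInd F).
Proof.
have [n [q0 [delta [acc accP]]]] := recognisable_automaton hrec.
(* Classically defined, but a finite table of truth values for m < k, which the machine carries
   along. *)
pose small m (E : {ffun 'I_m * 'I_m -> bool}) : bool :=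
  `[< exists2 X : sgraph, F X & presents X E >].
apply: (table_polynomial_time (@feas_cells k n) (feas_entry q0 delta)
  (feas_verdict k acc small)) => w; rewrite /cells /=.
set o := (w, _).
have -> : verdict k acc small o <> 0 :> nat <-> verdict k acc small o.
  by case: verdict.
have sound G H : w = encode_graph G ++ encode_graph H ->
    verdict k acc small o <-> hom_indist F G H.
  move=> wE; rewrite (verdict_encode q0 delta acc small hk wE).
  have szw : size w = #|G| + (1 + #|G| ^ 2) + (#|H| + (1 + #|H| ^ 2)).
    by rewrite wE size_cat !size_encode.
  have Gb : #|G| <= base n w by rewrite /base szw; lia.
  have Hb : #|H| <= base n w by rewrite /base szw; lia.
  split=> [[sm hom_eq] X FX|indist].
    (* A word graph contains k distinct labelled vertices, so smaller graphs escape the automaton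
       and are compared by brute force. *)
    case: (ltnP #|X| k) => [Xk|kX].
      have [E XE] := presents_card X.
      rewrite (presents_hom Gb XE) (presents_hom Hb XE); apply: sm => //.
      by apply/asboolP; exists X.
    have [v vX] := pathwidth_word hk (hpw X FX) kX.
    rewrite -!(hom_iso _ vX); apply: hom_eq; apply/accP.
    by apply/(graph_iso_class F vX).
  split=> [m E mk /asboolP[X FX XE]|v /accP]; last exact: indist.
  by rewrite -(presents_hom Gb XE) -(presents_hom Hb XE); apply: indist.
split=> [ver|[G [H [wE ind]]]]; last by apply/(sound G H).
have wf : well_formed w by case/and3P: ver.
have [G [H wE]] := parse_complete wf.
by exists G, H; split=> //; apply/(sound G H wE).
Qed.
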